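(* Suppose that for every $t\in(0,1)$ $$\lim_{r\to1}\frac{g(\phi_t(r))}{g(r)}=\limsup_{z\to1}\frac{u(z)}{u(\phi_t(z))}<\infty\quad\text{and}\quad\lim_{z\to1}T_t(z)\in[0,\infty),$$ and that the upper-bound conditions (U1) and (U2) of the context hold. Then, for $X=H^\infty_u$ or $X=H^0_u$, $$\|I_K\|_{e,X\to H^\infty_u}=\int_0^1\limsup_{z\to1}\frac{u(z)}{u(\phi_t(z))}\,T_t(z)\,dt .$$
   Context: $\mathbb D$ is the open unit disk, $\mathcal H(\mathbb D)$ the analytic functions on $\mathbb D$, $H^\infty$ the bounded ones; $r$ denotes real numbers in $(0,1)$, $r\to1$ from below, and $z\to1$ with $z\in\mathbb D$. Spaces. $u:\mathbb D\to(0,\infty)$ is continuous and radial ($u(z)=u(|z|)$) with $\sup_{\mathbb D}u=1$ and $u(z)\to0$ as $|z|\to1$; $H^\infty_u=\{f\in\mathcal H(\mathbb D):\|f\|_{H^\infty_u}=\sup_{\mathbb D}|f|u<\infty\}$; $\|\cdot\|_{L^\infty_u}$ is the same expression for measurable $f$; $H^0_u=\{f\in H^\infty_u:\lim_{|z|\to1}|f(z)|u(z)=0\}$ with the same norm. Standing assumptions: point evaluations $\delta_z$, $z\in\mathbb D$, are bounded on $H^\infty_u$ and $\int_0^1\|\delta_s\|_{(H^\infty_u)^*}\,ds<\infty$. Operator. $K:\mathbb D\times\mathbb D\to\mathbb C$ is analytic, $K(z,\cdot)\in H^\infty$ for every $z\in\mathbb D$, $\lim_{(z,w)\to(1,1)}|K(z,w)|=\infty$,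 and $I_K(f)(z)=\int_0^1f(x)K(z,x)\,dx$ is assumed bounded $H^\infty_u\to H^\infty_u$. For $t\in(0,1)$, $z\in\mathbb D$: $\phi_t(z)=\frac{t}{(t-1)z+1}$ and $T_t(z)=K(z,\phi_t(z))\frac{\partial}{\partial t}\phi_t(z)=K(z,\phi_t(z))\frac{1-z}{((t-1)z+1)^2}$. The function $g\in\mathcal H(\mathbb D)$ is assumed to satisfy $\sup_{z\in\mathbb D}|g(z)|u(z)\le1$; $\limsup_{z\to e^{i\theta}}|g(z)|u(z)=0$ for every boundary point $e^{i\theta}\ne1$; and $|g(r)|u(r)\to1$ as $r\to1$. Upper-bound conditions. With $D_{\le R,t}=\phi_t(\mathbb D)\cap\{|w|\le R\}$ and $D_{>R,t}=\phi_t(\mathbb D)\setminus\{|w|\le R\}$: (U1) there is $0<R_0<1$ with $\int_0^1\sup_{z\in\phi_t^{-1}(D_{>R_0,t})}\frac{|T_t(z)|u(z)}{u(\phi_t(z))}\,dt<\infty$; (U2) for every $0<R<1$, $\int_0^1\|T_t\chi_{\phi_t^{-1}(D_{\le R,t})}\|_{L^\infty_u}\,dt<\infty$. Essential norm. $\|T\|_{e,X\to Y}=\inf\{\|T-L\|_{X\to Y}:L:X\to Y\text{ compact}\}$; for $X=H^0_u$ the operator is the restriction of $I_K$. *)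

(* Defs.v *)
From HB Require Import structures.
From mathcomp Require Import all_boot all_order all_algebra.
From mathcomp Require Import all_classical all_reals all_analysis.
From mathcomp Require Import complex.

Set Implicit Arguments.
Unset Strict Implicit.
Unset Printing Implicit Defensive.

Import Order.TTheory GRing.Theory Num.Theory.
Import numFieldNormedType.Exports.

Local Open Scope classical_set_scope.
Local Open Scope ring_scope.
Local Open Scope complex_scope.

(* The complex numbers R[i], typed as a numFieldType so that their topology and
   normed module structure are those of numFieldNormedType. *)
Definition Cx (R : realType) : numFieldType := R[i].

Definition toCx (R : realType) (x : R) : Cx R := x%:C.

(* Modulus with values in R; the norm of Cx R is the same number seen as an
   element of Cx R. *)
Definition cabs (R : realType) (z : Cx R) : R := complex.Re `|z|.

Definition disc (R : realType) : set (Cx R) := [set z | cabs z < 1].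
Arguments disc R : clear implicits.

Definition disc_at (R : realType) (a : Cx R) : set_system (Cx R) :=
  within (disc R) (nbhs a).

(* The filter of |z| -> 1, z in the disc *)
Definition disc_bdry (R : realType) : set_system (Cx R) :=
  [set A | \forall r \near (1 : R)^'-, forall z : Cx R, cabs z = r -> A z].
Arguments disc_bdry R : clear implicits.

(* Functions on the disc are represented by total functions; the values
   outside the disc are never used. *)
Definition analytic_disc (R : realType) (f : Cx R -> Cx R) : Prop :=
  forall z : Cx R, disc R z -> derivable f z 1.

Definition analytic_disc2 (R : realType) (K : Cx R -> Cx R -> Cx R) : Prop :=
  forall z w : Cx R, disc R z -> disc R w ->
    differentiable (fun p : Cx R * Cx R => K p.1 p.2) (z, w).

Record weight (R : realType) (u : Cx R -> R) : Prop := Weight {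
  weight_gt0 : forall z, disc R z -> 0 < u z;
  weight_cont : forall z : Cx R, disc R z -> {for z, continuous u};
  weight_radial : forall z, disc R z -> u z = u (toCx (cabs z));
  weight_sup : ereal_sup [set (u z)%:E | z in disc R] = 1%E;
  weight_vanish : u z @[z --> disc_bdry R] --> 0 }.

Definition wnorm (R : realType) (u : Cx R -> R) (f : Cx R -> Cx R) : \bar R :=
  ereal_sup [set (cabs (f z) * u z)%:E | z in disc R].

Definition Hinf (R : realType) (u : Cx R -> R) : set (Cx R -> Cx R) :=
  [set f | analytic_disc f /\ (wnorm u f < +oo)%E].

Definition Hzero (R : realType) (u : Cx R -> R) : set (Cx R -> Cx R) :=
  [set f | Hinf u f /\ cabs (f z) * u z @[z --> disc_bdry R] --> 0].

Definition delta_norm (R : realType) (u : Cx R -> R) (z : Cx R) : \bar R :=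
  ereal_sup [set (cabs (f z))%:E | f in [set f | Hinf u f /\ (wnorm u f <= 1)%E]].

Definition cintegral (R : realType) (D : set R) (f : R -> Cx R) : Cx R :=
  ((\int[lebesgue_measure]_(x in D) complex.Re (f x)) +i*
   (\int[lebesgue_measure]_(x in D) complex.Im (f x)))%C.

Definition IK (R : realType) (K : Cx R -> Cx R -> Cx R) (f : Cx R -> Cx R)
    (z : Cx R) : Cx R :=
  cintegral `]0, 1[ (fun x : R => f (toCx x) * K z (toCx x)).

Definition phi (R : realType) (t : R) (z : Cx R) : Cx R :=
  toCx t / ((toCx t - 1) * z + 1).

(* The factor of K is the derivative of t |-> phi t z. *)
Definition Tt (R : realType) (K : Cx R -> Cx R -> Cx R) (t : R) (z : Cx R) :
    Cx R :=
  K z (phi t z) * ((1 - z) / ((toCx t - 1) * z + 1) ^+ 2).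

Definition opnorm (R : realType) (u : Cx R -> R) (X : set (Cx R -> Cx R))
    (T : (Cx R -> Cx R) -> Cx R -> Cx R) : \bar R :=
  ereal_sup [set wnorm u (T f) | f in [set f | X f /\ (wnorm u f <= 1)%E]].

Definition bounded_op (R : realType) (u : Cx R -> R) (X : set (Cx R -> Cx R))
    (T : (Cx R -> Cx R) -> Cx R -> Cx R) : Prop :=
  (forall f, X f -> Hinf u (T f)) /\ (opnorm u X T < +oo)%E.

(* Linearity is tested on the disc only. A linear operator with finite
   opnorm sends functions equal on the disc to functions equal on the disc,
   so no separate compatibility condition is needed. *)
Definition linear_op (R : realType) (X : set (Cx R -> Cx R))
    (L : (Cx R -> Cx R) -> Cx R -> Cx R) : Prop :=
  forall (a : Cx R) (f g : Cx R -> Cx R), X f -> X g ->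
  forall z, disc R z -> L (fun w => a * f w + g w) z = a * L f z + L g z.

Definition compact_op (R : realType) (u : Cx R -> R) (X : set (Cx R -> Cx R))
    (L : (Cx R -> Cx R) -> Cx R -> Cx R) : Prop :=
  [/\ linear_op X L, bounded_op u X L &
      forall f : nat -> Cx R -> Cx R,
        (forall n, X (f n) /\ (wnorm u (f n) <= 1)%E) ->
        exists s : nat -> nat, exists h : Cx R -> Cx R,
          [/\ {homo s : m n / (m < n)%N}, Hinf u h &
              wnorm u (fun z => L (f (s n)) z - h z) @[n --> \oo] --> 0%E]].

Definition ess_norm (R : realType) (u : Cx R -> R) (X : set (Cx R -> Cx R))
    (T : (Cx R -> Cx R) -> Cx R -> Cx R) : \bar R :=
  ereal_inf [set opnorm u X (fun f z => T f z - L f z) | L in compact_op u X].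

Definition weight_ratio_limsup (R : realType) (u : Cx R -> R) (t : R) : \bar R :=
  limf_esup (fun z : Cx R => (u z / u (phi t z))%:E) (disc_at 1).

Definition preim_gt (R : realType) (t r : R) : set (Cx R) :=
  disc R `&` phi t @^-1` (phi t @` disc R `\` [set w | cabs w <= r]).

Definition preim_le (R : realType) (t r : R) : set (Cx R) :=
  disc R `&` phi t @^-1` (phi t @` disc R `&` [set w | cabs w <= r]).

Definition upper_cond1 (R : realType) (u : Cx R -> R)
    (K : Cx R -> Cx R -> Cx R) : Prop :=
  exists r : R, 0 < r < 1 /\
  (\int[lebesgue_measure]_(t in `]0%R, 1%R[)
     ereal_sup [set (cabs (Tt K t z) * u z / u (phi t z))%:E |
                z in preim_gt t r] < +oo)%E.

Definition upper_cond2 (R : realType) (u : Cx R -> R)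
    (K : Cx R -> Cx R -> Cx R) : Prop :=
  forall r : R, 0 < r < 1 ->
  (\int[lebesgue_measure]_(t in `]0%R, 1%R[)
     wnorm u (fun z => (Tt K t z * toCx (\1_(preim_le t r) z))%R) < +oo)%E.

(* Main.v *)
(* Cauchy's theorem deforms the segment [0, 1] into the curves t |-> phi t z, so
   I_K f z is the integral over t of f (phi t z) T_t(z).
   Upper bound: average the dilations f (r_j z) over many radii r_j, increasing
   fast, and truncate the Taylor series. The result is a finite rank operator S
   such that f - S f is small on |z| <= R while its norm stays below 1 + eta (a
   sliding hump), so I_K - I_K S is controlled by the supremum of
   |T_t| u / (u o phi_t) over |phi_t| > R. As R -> 1 the integral of this
   supremum tends to the value, by dominated convergence.
   Lower bound: multiply g by spikes h_n that tend to 0 locally uniformly but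
   are close to 1 at phi_t(r_n), with r_n -> 1. Sums of many sparse members of
   the sequence g h_n stay bounded, so a compact operator sends a subsequence to
   0, whereas |I_K(g h_n)(r_n)| u(r_n) tends to the value by dominated
   convergence. *)
Require Import Defs.
From HB Require Import structures.
From mathcomp Require Import all_boot all_order all_algebra.
From mathcomp Require Import all_classical all_reals all_analysis.
From mathcomp Require Import complex measurable_realfun.
From mathcomp Require Import ring lra.

Set Implicit Arguments.
Unset Strict Implicit.
Unset Printing Implicit Defensive.

Import Order.TTheory GRing.Theory Num.Theory.
Import numFieldNormedType.Exports.

Local Open Scope classical_set_scope.
Local Open Scope ring_scope.
Local Open Scope complex_scope.

(** * Complex differentiability and integrals *)

(** Three obstacles shape the proof. A function of the unit ball may be unbounded near 1, the common
    end point of the segment and of all the curves. Path independence is therefore proved for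
    functions differentiable on the closed disc, then for bounded ones, then for f times K(z, .),
    the last two by dilation and dominated convergence. The norms of the point evaluations dominate
    on the segment, (U1) and (U2) on the curves. A single dilation leaves f - f(r w) with norm up to
    2. In an average of N dilations at most one term per point is that large and the others are at
    most about 1, so the excess over 1 is of order 1/N. Finite rank then reduces compactness to
    bounded sequences of scalars. In the lower bound one spike must serve every t. Since 1 - phi_t(1
    - d^2) is comparable to d^2 (1 - t)/t, for fixed t and small d it lies between the scales d^3
    and d at which the two factors of the spike act. The spikes vanish at 1, which puts g h_n into
    H^0_u, so the test functions serve both spaces. *)

Section ComplexBasics.
Variable R : realType.
Implicit Types (x y e : R) (z w a : Cx R).

Lemma cnormE z : `|z| = toCx (cabs z).
Proof. by case: z => x y. Qed.

Lemma toCx_le x y : (toCx x <= toCx y) = (x <= y).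
Proof. exact: lecR. Qed.

Lemma toCx_lt x y : (toCx x < toCx y) = (x < y).
Proof. exact: ltcR. Qed.

Lemma toCx_inj : injective (@toCx R).
Proof. exact: complexI. Qed.

Lemma toCxD x y : toCx (x + y) = toCx x + toCx y.
Proof. exact: (rmorphD (real_complex R)). Qed.
Lemma toCxN x : toCx (- x) = - toCx x.
Proof. exact: (rmorphN (real_complex R)). Qed.
Lemma toCxB x y : toCx (x - y) = toCx x - toCx y.
Proof. exact: (rmorphB (real_complex R)). Qed.
Lemma toCxM x y : toCx (x * y) = toCx x * toCx y.
Proof. exact: (rmorphM (real_complex R)). Qed.
Lemma toCxV x : toCx x^-1 = (toCx x)^-1.
Proof. exact: (fmorphV (real_complex R)). Qed.
Lemma toCxX x n : toCx (x ^+ n) = (toCx x) ^+ n.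
Proof. exact: (rmorphXn (real_complex R)). Qed.
Lemma toCx0 : toCx 0 = 0 :> Cx R. Proof. by []. Qed.
Lemma toCx1 : toCx 1 = 1 :> Cx R. Proof. by []. Qed.

Lemma cabsM z w : cabs (z * w) = cabs z * cabs w.
Proof. by apply: toCx_inj; rewrite -cnormE normrM !cnormE -toCxM. Qed.

Lemma cabsV z : cabs z^-1 = (cabs z)^-1.
Proof. by apply: toCx_inj; rewrite -cnormE normfV !cnormE -toCxV. Qed.

Lemma cabsX z n : cabs (z ^+ n) = (cabs z) ^+ n.
Proof. by apply: toCx_inj; rewrite -cnormE normrX !cnormE -toCxX. Qed.

Lemma cabsN z : cabs (- z) = cabs z.
Proof. by rewrite /cabs normrN. Qed.

Lemma cabsBC z w : cabs (z - w) = cabs (w - z).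
Proof. by rewrite /cabs distrC. Qed.

Lemma cabs0 : cabs (0 : Cx R) = 0.
Proof. by rewrite /cabs normr0. Qed.

Lemma cabs1 : cabs (1 : Cx R) = 1.
Proof. by rewrite /cabs normr1. Qed.

Lemma cabs_ge0 z : 0 <= cabs z.
Proof. by rewrite -toCx_le -cnormE normr_ge0. Qed.

Lemma cabs_eq0 z : (cabs z == 0) = (z == 0).
Proof. by rewrite -(inj_eq toCx_inj) -cnormE normr_eq0. Qed.

Lemma cabs_gt0 z : (0 < cabs z) = (z != 0).
Proof. by rewrite lt_def cabs_ge0 andbT cabs_eq0. Qed.

Lemma cabsD z w : cabs (z + w) <= cabs z + cabs w.
Proof. by rewrite -toCx_le toCxD -!cnormE ler_normD. Qed.

Lemma cabsB z w : cabs (z - w) <= cabs z + cabs w.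
Proof. by rewrite -(cabsN w) cabsD. Qed.

Lemma cabs_dist z w : cabs z - cabs w <= cabs (z - w).
Proof. by rewrite lerBlDr (le_trans _ (cabsD _ _)) ?subrK. Qed.

Lemma cabs_toCx x : cabs (toCx x) = `|x|.
Proof. by apply: toCx_inj; rewrite -cnormE normc_def /= expr0n addr0 sqrtr_sqr. Qed.

Lemma cabs_sum (I : Type) (r : seq I) (P : pred I) (F : I -> Cx R) :
  cabs (\sum_(i <- r | P i) F i) <= \sum_(i <- r | P i) cabs (F i).
Proof.
elim/big_rec2: _ => [|i y z _ h]; first by rewrite cabs0.
by rewrite (le_trans (cabsD _ _)) // lerD2l.
Qed.

Lemma cabs_sqr z : cabs z ^+ 2 = complex.Re z ^+ 2 + complex.Im z ^+ 2.
Proof.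
by apply: toCx_inj; rewrite toCxX -cnormE -add_Re2_Im2.
Qed.

Lemma cabs_ge_Re z : `|complex.Re z| <= cabs z.
Proof. by rewrite -toCx_le -cnormE; exact: normc_ge_Re. Qed.

Lemma cabs_ge_Im z : `|complex.Im z| <= cabs z.
Proof.
rewrite -[X in _ <= X]ger0_norm ?cabs_ge0 // -ler_sqr ?nnegrE // !real_normK ?num_real //.
by rewrite cabs_sqr lerDr sqr_ge0.
Qed.

Lemma cabs_le_ReIm z : cabs z <= `|complex.Re z| + `|complex.Im z|.
Proof.
rewrite -ler_sqr ?nnegrE ?cabs_ge0 ?addr_ge0 //.
by rewrite cabs_sqr sqrrD !real_normK ?num_real // lerD2r lerDl mulrn_wge0 // mulr_ge0.
Qed.

Lemma cReD z w : complex.Re (z + w) = complex.Re z + complex.Re w.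
Proof. by case: z w => [? ?] [? ?]. Qed.
Lemma cImD z w : complex.Im (z + w) = complex.Im z + complex.Im w.
Proof. by case: z w => [? ?] [? ?]. Qed.
Lemma cReN z : complex.Re (- z) = - complex.Re z.
Proof. by case: z => [? ?]. Qed.
Lemma cImN z : complex.Im (- z) = - complex.Im z.
Proof. by case: z => [? ?]. Qed.
Lemma cReM z w : complex.Re (z * w) =
  complex.Re z * complex.Re w - complex.Im z * complex.Im w.
Proof. by case: z w => [? ?] [? ?]. Qed.
Lemma cImM z w : complex.Im (z * w) =
  complex.Re z * complex.Im w + complex.Im z * complex.Re w.
Proof. by case: z w => [? ?] [? ?]. Qed.

Lemma CxP z w : complex.Re z = complex.Re w -> complex.Im z = complex.Im w -> z = w.
Proof. by case: z w => [? ?] [? ?] /= -> ->. Qed.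

Lemma nbhsCP a (A : set (Cx R)) :
  nbhs a A <-> exists2 e : R, 0 < e & forall z, cabs (z - a) < e -> A z.
Proof.
split.
- move=> /nbhs_ballP[e /= e0 h]; exists (complex.Re e).
    by move: e0; rewrite ltcE /= => /andP[_].
  move=> z hz; apply: h; rewrite -ball_normE /= cnormE.
  (* In the order of [R[i]], [0 < e] includes that [e] is real. *)
  have -> : e = toCx (complex.Re e).
    by apply: CxP => //=; move: e0; rewrite ltcE /= => /andP[/eqP].
  by rewrite toCx_lt cabsBC.
- move=> [e e0 h]; apply/nbhs_ballP; exists (toCx e) => /=; first by rewrite toCx_lt.
  by move=> z; rewrite -ball_normE /= cnormE toCx_lt cabsBC; exact: h.
Qed.

Lemma cvgCP (T : Type) (F : set_system T) (FF : Filter F) (f : T -> Cx R) a :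
  f @ F --> a <-> forall e : R, 0 < e -> \forall x \near F, cabs (f x - a) < e.
Proof.
split.
- move=> fa e e0; apply: (fa [set z | cabs (z - a) < e]).
  by apply/nbhsCP; exists e.
- move=> h A /nbhsCP[e e0 hA]; apply: filterS (h e e0) => x; exact: hA.
Qed.

Lemma cvg_toCx (T : Type) (F : set_system T) (FF : Filter F) (f : T -> R) x :
  f @ F --> x -> toCx (f t) @[t --> F] --> toCx x.
Proof.
move=> fx; apply/cvgCP => // e e0.
move/cvgrPdist_lt: fx => /(_ e e0); apply: filterS => t.
by rewrite -toCxB cabs_toCx distrC.
Qed.

Lemma cvg_ReC (T : Type) (F : set_system T) (FF : Filter F) (f : T -> Cx R) a :
  f @ F --> a -> complex.Re (f t) @[t --> F] --> complex.Re a.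
Proof.
move=> /(cvgCP FF) fa; apply/cvgrPdist_lt => e e0; near=> t.
rewrite distrC -cReN -cReD (le_lt_trans (cabs_ge_Re _)) //.
by near: t; exact: fa.
Unshelve. all: by end_near. Qed.

Lemma cvg_ImC (T : Type) (F : set_system T) (FF : Filter F) (f : T -> Cx R) a :
  f @ F --> a -> complex.Im (f t) @[t --> F] --> complex.Im a.
Proof.
move=> /(cvgCP FF) fa; apply/cvgrPdist_lt => e e0; near=> t.
rewrite distrC -cImN -cImD (le_lt_trans (cabs_ge_Im _)) //.
by near: t; exact: fa.
Unshelve. all: by end_near. Qed.

Lemma cvg_cabs (T : Type) (F : set_system T) (FF : Filter F) (f : T -> Cx R) a :
  f @ F --> a -> cabs (f t) @[t --> F] --> cabs a.
Proof.
move=> /(cvgCP FF) fa; apply/cvgrPdist_lt => e e0; near=> t.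
have h : cabs (f t - a) < e by near: t; exact: fa.
rewrite ltr_norml; have := cabs_dist (f t) a; have := cabs_dist a (f t).
by rewrite (cabsBC a); lra.
Unshelve. all: by end_near. Qed.

Lemma cvg_CReIm (T : Type) (F : set_system T) (FF : Filter F) (f : T -> Cx R) a :
  complex.Re (f t) @[t --> F] --> complex.Re a ->
  complex.Im (f t) @[t --> F] --> complex.Im a -> f @ F --> a.
Proof.
move=> /cvgrPdist_lt fr /cvgrPdist_lt fi; apply/cvgCP => // e e0; near=> t.
have h1 : `|complex.Re a - complex.Re (f t)| < e / 2.
  by near: t; apply: fr; rewrite divr_gt0.
have h2 : `|complex.Im a - complex.Im (f t)| < e / 2.
  by near: t; apply: fi; rewrite divr_gt0.
rewrite (le_lt_trans (cabs_le_ReIm _)) // cReD cReN cImD cImN.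
by rewrite distrC (distrC (complex.Im _)); lra.
Unshelve. all: by end_near. Qed.

(* Differentiability with the increment bounded by [e], so that the same
   format covers functions of a complex and of a real variable. *)
Definition cdiff (f : Cx R -> Cx R) (z d : Cx R) :=
  forall e, 0 < e -> exists2 dl : R, 0 < dl & forall w, cabs (w - z) < dl ->
    cabs (f w - f z - d * (w - z)) <= e * cabs (w - z).

Definition rdiff (f : R -> Cx R) (x : R) (d : Cx R) :=
  forall e, 0 < e -> exists2 dl : R, 0 < dl & forall y, `|y - x| < dl ->
    cabs (f y - f x - d * toCx (y - x)) <= e * `|y - x|.

(* An opaque name, so that unification never unfolds the filter. *)
Definition ccont (f : R -> Cx R) (x : R) : Prop := {for x, continuous f}.

Lemma ccontM (f g : R -> Cx R) x : ccont f x -> ccont g x ->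
  ccont (fun s => f s * g s) x.
Proof. exact: (@cvgM (Cx R)). Qed.

Lemma ccontD (f g : R -> Cx R) x : ccont f x -> ccont g x ->
  ccont (fun s => f s + g s) x.
Proof. exact: (@cvgD (Cx R)). Qed.

Lemma ccont_cst (k : Cx R) x : ccont (fun=> k) x.
Proof. exact: cvg_cst. Qed.

Lemma ccontB (f g : R -> Cx R) x : ccont f x -> ccont g x ->
  ccont (fun s => f s - g s) x.
Proof. exact: (@cvgB (Cx R)). Qed.

Lemma is_derive_cdiff (f : Cx R -> Cx R) z d : is_derive z 1 f d <-> cdiff f z d.
Proof.
split.
- case=> df fd e e0.
  have : (fun h => h^-1 *: ((f \o shift z) (h *: 1) - f z)) @ 0^' --> d.
    by rewrite -fd /derive.
  move=> /(@cvgCP _ _ _ _ d) => /(_ e e0).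
  rewrite /dnbhs near_withinE => /nbhsCP[dl dl0 h]; exists dl => // w hw.
  have [->|wz] := eqVneq w z.
    by rewrite !subrr mulr0 subrr cabs0 mulr0.
  have wz0 : w - z != 0 by rewrite subr_eq0.
  have := h (w - z); rewrite subr0 => /(_ hw wz0) /=.
  rewrite [_ *: 1]mulr1 subrK => H.
  rewrite -ler_pdivrMr ?cabs_gt0 // -cabsV -cabsM mulrC mulrBr mulrCA mulVf // mulr1.
  exact: ltW.
- move=> h.
  have : (fun h => h^-1 *: ((f \o shift z) (h *: 1) - f z)) @ 0^' --> d.
    apply/cvgCP => e e0; rewrite /dnbhs near_withinE.
    have [dl dl0 H] := h (e / 2) ltac:(lra).
    apply/nbhsCP; exists dl => // w; rewrite subr0 => hw w0 /=.
    have := H (w + z); rewrite addrK => /(_ hw).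
    rewrite [_ *: 1]mulr1 -ler_pdivrMr ?cabs_gt0 // -cabsV -cabsM mulrC mulrBr mulrCA mulVf // mulr1.
    move=> /le_lt_trans; apply; lra.
  move=> H; split; first by apply/cvg_ex; exists d.
  by apply/cvg_lim.
Qed.

Lemma derivable_cdiff (f : Cx R -> Cx R) z : derivable f z 1 <-> exists d, cdiff f z d.
Proof.
split; first by move=> df; exists ('D_1 f z); apply/is_derive_cdiff/derivableP.
by case=> d /is_derive_cdiff[].
Qed.

Lemma cdiff_cont (f : Cx R -> Cx R) z d : cdiff f z d -> {for z, continuous f}.
Proof.
move=> /is_derive_cdiff[fd _].
by apply/differentiable_continuous/derivable1_diffP.
Qed.

Lemma cdiff_rdiff (f : Cx R -> Cx R) x d : cdiff f (toCx x) d ->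
  rdiff (f \o @toCx R) x d.
Proof.
move=> h e /h[dl dl0 H]; exists dl => // y hy.
by have := H (toCx y); rewrite -toCxB cabs_toCx; apply.
Qed.

Lemma cdiff_lip (f : Cx R -> Cx R) z d : cdiff f z d ->
  exists2 dl : R, 0 < dl & forall w, cabs (w - z) < dl ->
    cabs (f w - f z) <= (cabs d + 1) * cabs (w - z).
Proof.
move=> /(_ 1 ltr01)[dl dl0 h]; exists dl => // w /h.
rewrite mulrDl -cabsM.
have := cabsD (f w - f z - d * (w - z)) (d * (w - z)); rewrite subrK; lra.
Qed.

Lemma rdiff_lip (f : R -> Cx R) x d : rdiff f x d ->
  exists2 dl : R, 0 < dl & forall y, `|y - x| < dl ->
    cabs (f y - f x) <= (cabs d + 1) * `|y - x|.
Proof.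
move=> /(_ 1 ltr01)[dl dl0 h]; exists dl => // y /h.
rewrite mulrDl -[X in cabs d * X]cabs_toCx -cabsM.
have := cabsD (f y - f x - d * toCx (y - x)) (d * toCx (y - x)); rewrite subrK; lra.
Qed.

Lemma rdiff_cont (f : R -> Cx R) x d : rdiff f x d -> ccont f x.
Proof.
move=> /rdiff_lip[dl dl0 h]; apply/cvgCP => e e0.
have c0 : 0 < cabs d + 1 by have := cabs_ge0 d; lra.
near=> y.
have h1 : `|y - x| < dl.
  by near: y; apply: (@cvgr_distC_lt _ _ _ _ _ idfun).
have h2 : `|y - x| < e / (cabs d + 1).
  by near: y; apply: (@cvgr_distC_lt _ _ _ _ _ idfun) => //; rewrite divr_gt0.
rewrite (le_lt_trans (h _ h1)) //.
by rewrite mulrC -ltr_pdivlMr.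
Unshelve. all: by end_near. Qed.

Lemma ccont_comp (g : Cx R -> Cx R) (f : R -> Cx R) x d : ccont f x ->
  cdiff g (f x) d -> ccont (fun s => g (f s)) x.
Proof. by move=> fc /cdiff_cont gc; exact: (@continuous_comp _ _ _ f g). Qed.

Lemma rdiff_comp (g : Cx R -> Cx R) (f : R -> Cx R) x d d' :
  rdiff f x d -> cdiff g (f x) d' -> rdiff (g \o f) x (d' * d).
Proof.
move=> fd gd e e0.
have [d1 d10 h1] := rdiff_lip fd.
have c0 : 0 < cabs d + 1 by have := cabs_ge0 d; lra.
have k0 : 0 < cabs d' + 1 by have := cabs_ge0 d'; lra.
have [d2 d20 h2] := gd (e / 2 / (cabs d + 1)) ltac:(rewrite !divr_gt0 //).
have [d3 d30 h3] := fd (e / 2 / (cabs d' + 1)) ltac:(rewrite !divr_gt0 //).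
exists (Num.min d1 (Num.min d3 (d2 / (cabs d + 1)))).
  by rewrite !lt_min d10 d30 divr_gt0.
move=> y; rewrite !lt_min => /and3P[y1 y3 y2].
have {}h1 := h1 _ y1; have {}h3 := h3 _ y3.
have l2 : cabs (f y - f x) < d2.
  by rewrite (le_lt_trans h1) // mulrC -ltr_pdivlMr.
have {}h2 := h2 _ l2.
rewrite /comp.
have -> : g (f y) - g (f x) - d' * d * toCx (y - x) =
  (g (f y) - g (f x) - d' * (f y - f x)) + d' * (f y - f x - d * toCx (y - x)) by ring.
rewrite (le_trans (cabsD _ _)) // cabsM.
have A : cabs (g (f y) - g (f x) - d' * (f y - f x)) <= e / 2 * `|y - x|.
  rewrite (le_trans h2) // -mulrA ler_wpM2l //; first lra.
  by rewrite mulrC ler_pdivrMr // mulrC.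
have B : cabs d' * cabs (f y - f x - d * toCx (y - x)) <= e / 2 * `|y - x|.
  have : cabs d' * cabs (f y - f x - d * toCx (y - x)) <= (cabs d' + 1) *
     (e / 2 / (cabs d' + 1) * `|y - x|).
    by apply: ler_pM; rewrite ?cabs_ge0 // lerDl.
  move=> /le_trans; apply; rewrite mulrA.
  have -> // : (cabs d' + 1) * (e / 2 / (cabs d' + 1)) = e / 2.
  by field; rewrite gt_eqF.
lra.
Qed.

Lemma rdiff_is_derive_Re (f : R -> Cx R) x d : rdiff f x d ->
  is_derive x (1 : R) (fun y => complex.Re (f y)) (complex.Re d).
Proof.
move=> fd.
have H : (fun h : R => h^-1 *: (((fun y => complex.Re (f y)) \o shift x) (h *: 1) - complex.Re (f x)))
   @ 0^' --> complex.Re d.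
  apply/cvgrPdist_lt => e e0; rewrite near_withinE.
  have [dl dl0 h] := fd (e / 2) ltac:(lra).
  near=> y => y0 /=; rewrite [_ *: 1]mulr1 distrC.
  have hy : `|y| < dl by near: y; exact: (@cvgr0_norm_lt _ _ _ _ _ idfun).
  have := h (y + x); rewrite addrK => /(_ hy) H.
  have -> : y^-1 *: (complex.Re (f (y + x)) - complex.Re (f x)) - complex.Re d =
     y^-1 * complex.Re (f (y + x) - f x - d * toCx y).
    by rewrite !cReD !cReN cReM /= mulr0 subr0 mulrBr [_ *: _]/(_ * _) mulrCA mulVf // mulr1.
  rewrite normrM normfV -ltr_pdivlMl ?invr_gt0 ?normr_gt0 // invrK.
  rewrite (le_lt_trans (cabs_ge_Re _)) // (le_lt_trans H) // mulrC ltr_pM2l ?normr_gt0 //; lra.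
split; first by apply/cvg_ex; exists (complex.Re d).
by apply/cvg_lim.
Unshelve. all: by end_near. Qed.

Lemma rdiff_is_derive_Im (f : R -> Cx R) x d : rdiff f x d ->
  is_derive x (1 : R) (fun y => complex.Im (f y)) (complex.Im d).
Proof.
move=> fd.
have <- : complex.Re (- 'i * d) = complex.Im d.
  by case: d {fd} => p q; rewrite cReM /=; ring.
have -> : (fun y => complex.Im (f y)) = (fun y => complex.Re (- 'i * f y)).
  by apply/funext => y; case: (f y) => p q; rewrite cReM /=; ring.
apply: rdiff_is_derive_Re => e /fd[dl dl0 h]; exists dl => // y /h.
have -> : - 'i * f y - - 'i * f x - - 'i * d * toCx (y - x) =
  - 'i * (f y - f x - d * toCx (y - x)) :> Cx R by ring.
rewrite cabsM cabsN.
have -> : cabs ('i : Cx R) = 1; last by rewrite mul1r.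
by rewrite /cabs normc_def /= expr0n expr1n add0r sqrtr1.
Qed.

End ComplexBasics.

(** * Integrals of complex-valued functions of a real variable *)

Section ComplexIntegral.
Variable R : realType.
Notation mu := (@lebesgue_measure R).
Implicit Types (f g : R -> Cx R) (D : set (measurableTypeR R)).

Definition cintegrable D f :=
  mu.-integrable D (fun x => (complex.Re (f x))%:E) /\
  mu.-integrable D (fun x => (complex.Im (f x))%:E).

Lemma eq_cintegral D f g : {in D, f =1 g} -> cintegral D f = cintegral D g.
Proof.
move=> fg; rewrite /cintegral; congr (_ +i* _)%C.
  by apply: eq_Rintegral => x xD; rewrite fg.
by apply: eq_Rintegral => x xD; rewrite fg.
Qed.

Lemma eq_cintegrable D f g : measurable D -> {in D, f =1 g} ->
  cintegrable D f -> cintegrable D g.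
Proof.
move=> mD fg [h1 h2]; split.
  by apply: (eq_integrable mD _ _ _ h1) => x xD; rewrite fg.
by apply: (eq_integrable mD _ _ _ h2) => x xD; rewrite fg.
Qed.

Lemma cintegrable_cont (a b : R) f :
  (forall x, a <= x <= b -> ccont f x) -> cintegrable `[a, b] f.
Proof.
move=> fc; split.
  apply: continuous_compact_integrable; first exact: segment_compact.
  apply: continuous_in_subspaceT => x; rewrite inE /= in_itv /= => /fc cx.
  exact: cvg_ReC.
apply: continuous_compact_integrable; first exact: segment_compact.
apply: continuous_in_subspaceT => x; rewrite inE /= in_itv /= => /fc cx.
exact: cvg_ImC.
Qed.

Lemma cintegrableD D f g : measurable D -> cintegrable D f -> cintegrable D g ->
  cintegrable D (fun x => f x + g x).
Proof.
move=> mD [f1 f2] [g1 g2]; split.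
  apply: (eq_integrable mD _ _ _ (integrableD mD f1 g1)) => x xD /=.
  by rewrite cReD.
apply: (eq_integrable mD _ _ _ (integrableD mD f2 g2)) => x xD /=.
by rewrite cImD.
Qed.

Lemma cintegralD D f g : measurable D -> cintegrable D f -> cintegrable D g ->
  cintegral D (fun x => f x + g x) = cintegral D f + cintegral D g.
Proof.
move=> mD [f1 f2] [g1 g2]; rewrite /cintegral; apply: CxP => /=.
  rewrite -RintegralD //.
  by apply: eq_Rintegral => x _; rewrite cReD.
rewrite -RintegralD //.
by apply: eq_Rintegral => x _; rewrite cImD.
Qed.

Lemma cintegrableZ D f (c : Cx R) : measurable D -> cintegrable D f ->
  cintegrable D (fun x => c * f x).
Proof.
move=> mD [f1 f2]; split.
  apply: (eq_integrable mD _ _ _ (integrableB mD (integrableZl mD (complex.Re c) f1)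
    (integrableZl mD (complex.Im c) f2))) => x xD /=.
  by rewrite cReM.
apply: (eq_integrable mD _ _ _ (integrableD mD (integrableZl mD (complex.Re c) f2)
  (integrableZl mD (complex.Im c) f1))) => x xD /=.
by rewrite cImM.
Qed.

Lemma cintegralZ D f (c : Cx R) : measurable D -> cintegrable D f ->
  cintegral D (fun x => c * f x) = c * cintegral D f.
Proof.
move=> mD [f1 f2]; rewrite /cintegral.
have z1 (k : R) := integrableZl mD k f1.
have z2 (k : R) := integrableZl mD k f2.
apply: CxP => /=.
  rewrite cReM /= -!RintegralZl // -RintegralB //; [|exact: z1|exact: z2].
  by apply: eq_Rintegral => x _; rewrite cReM.
rewrite cImM /= -!RintegralZl // -RintegralD //; [|exact: z2|exact: z1].
by apply: eq_Rintegral => x _; rewrite cImM.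
Qed.

Lemma cintegrableB D f g : measurable D -> cintegrable D f -> cintegrable D g ->
  cintegrable D (fun x => f x - g x).
Proof.
move=> mD fi gi.
apply: (@eq_cintegrable D (fun x => f x + -1 * g x)) => //.
  by move=> x _; rewrite mulN1r.
exact/cintegrableD/cintegrableZ.
Qed.

Lemma cintegralB D f g : measurable D -> cintegrable D f -> cintegrable D g ->
  cintegral D (fun x => f x - g x) = cintegral D f - cintegral D g.
Proof.
move=> mD fi gi.
rewrite -[X in _ - X]mul1r -mulNr -cintegralZ // -cintegralD //.
  by apply: eq_cintegral => x _; rewrite mulN1r.
exact: cintegrableZ.
Qed.

Lemma cintegral_cst (a b : R) (c : Cx R) : a <= b ->
  cintegral `[a, b] (fun=> c) = c * toCx (b - a).
Proof.
move=> ab.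
apply: CxP; rewrite ?cReM ?cImM /= ?mulr0 ?subr0 ?addr0 ?add0r Rintegral_cst //=;
  rewrite lebesgue_measure_itv /= lte_fin; move: ab; rewrite le_eqVlt;
  by case/predU1P => [->|->] //=; rewrite ?ltxx ?subrr.
Qed.

(** A unimodular factor [c] rotates the integral onto the positive axis, which reduces the bound to
    real parts. [h] is extended-real because it will be built from suprema over the disc. *)
Lemma cabs_cintegral_le D f (h : R -> \bar R) : measurable D ->
  cintegrable D f -> mu.-integrable D h ->
  (forall x, D x -> (cabs (f x))%:E <= h x)%E ->
  ((cabs (cintegral D f))%:E <= \int[mu]_(x in D) h x)%E.
Proof.
move=> mD fi hi fh; set I := cintegral D f.
have [I0|I0] := eqVneq I 0.
  rewrite I0 cabs0; apply: integral_ge0 => x Dx.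
  by rewrite (le_trans _ (fh x Dx)) // lee_fin cabs_ge0.
pose c := I^-1 * toCx (cabs I).
have c1 : cabs c = 1.
  by rewrite /c cabsM cabsV cabs_toCx ger0_norm ?cabs_ge0 // mulVf // cabs_eq0.
have [ci _] := cintegrableZ c mD fi.
have -> : cabs I = complex.Re (cintegral D (fun x => c * f x)).
  by rewrite cintegralZ // -/I /c mulrAC mulVf // mul1r.
rewrite /cintegral /= /Rintegral fineK; last exact: integrable_fin_num.
apply: le_integral => // x /set_mem Dx.
rewrite (le_trans _ (fh x Dx)) // lee_fin.
rewrite (le_trans (ler_norm _)) // (le_trans (cabs_ge_Re _)) //.
by rewrite cabsM c1 mul1r.
Qed.

Lemma cabs_cintegral_itv (a b : R) f (M : R) : a <= b ->
  cintegrable `[a, b] f -> (forall x, a <= x <= b -> cabs (f x) <= M) ->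
  cabs (cintegral `[a, b] f) <= M * (b - a).
Proof.
move=> ab fi fM.
have := @cabs_cintegral_le `[a, b] f (fun=> M%:E) ltac:(by []) fi.
have Mi : mu.-integrable `[a, b] (fun=> M%:E).
  apply: continuous_compact_integrable; first exact: segment_compact.
  by apply: continuous_subspaceT => x; exact: cvg_cst.
move=> /(_ Mi) H; rewrite -lee_fin.
have -> : (M * (b - a))%:E = (\int[mu]_(x in `[a, b]) M%:E)%E.
  rewrite integral_cst //= lebesgue_measure_itv /= lte_fin.
  by case: ltgtP ab => // -> _; rewrite subrr mulr0 mule0.
by apply: H => x /=; rewrite in_itv /= lee_fin; exact: fM.
Qed.

Lemma cintegral_split (a b c : R) f : a <= b <= c ->
  cintegrable `[a, c] f ->
  cintegral `[a, c] f = cintegral `[a, b] f + cintegral `[b, c] f.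
Proof.
move=> /andP[ab bc] [f1 f2].
have S (g : R -> R) : mu.-integrable `[a, c] (fun x => (g x)%:E) ->
    Rintegral mu `[a, c] g = Rintegral mu `[a, b] g + Rintegral mu `[b, c] g.
  move=> gi.
  have := @Rintegral_itvB _ g (BLeft a) (BRight c) b gi.
  rewrite !bnd_simp => /(_ ab bc).
  rewrite Rintegral_itv_obnd_cbnd; first by move=> <-; rewrite addrC subrK.
  apply: (integrableS _ _ _ gi) => // x /=.
  by rewrite !in_itv /= => /andP[/ltW bx ->]; rewrite (le_trans ab).
by apply: CxP => /=; apply: S.
Qed.

Lemma cintegral_FTC (a b : R) (F f : R -> Cx R) : a <= b ->
  (forall x, a <= x <= b -> rdiff F x (f x)) ->
  (forall x, a <= x <= b -> ccont f x) ->
  cintegral `[a, b] f = F b - F a.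
Proof.
rewrite le_eqVlt => /predU1P[<-|ab] Ff fc.
  by rewrite subrr /cintegral set_itv1 !Rintegral_set1.
have S (p : Cx R -> R) (G g : R -> R) :
   (forall x, a <= x <= b -> is_derive x (1 : R) G (g x)) ->
   (forall x, a <= x <= b -> {for x, continuous g}) ->
   Rintegral mu `[a, b] g = G b - G a.
  move=> Gg gc; rewrite /Rintegral (@continuous_FTC2 _ g G a b) //.
  - by apply: continuous_in_subspaceT => x; rewrite inE /= in_itv /= => /gc.
  - have Gc x : a <= x <= b -> {for x, continuous G}.
      move=> /Gg[dG _].
      by apply/differentiable_continuous/derivable1_diffP.
    split.
    + move=> x; rewrite in_itv /= => /andP[/ltW ax /ltW xb].
      by have [] := Gg x; rewrite ?ax ?xb.
    + by apply: cvg_at_right_filter; apply: Gc; rewrite lexx ltW.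
    + by apply: cvg_at_left_filter; apply: Gc; rewrite lexx ltW.
  - move=> x; rewrite in_itv /= => /andP[/ltW ax /ltW xb].
    by rewrite derive1E; have [] := Gg x; rewrite ?ax ?xb.
apply: CxP; rewrite ?cReD ?cImD ?cReN ?cImN /=.
  apply: (S (@complex.Re R) (fun x => complex.Re (F x))).
    by move=> x /Ff; exact: rdiff_is_derive_Re.
  by move=> x /fc; exact: cvg_ReC.
apply: (S (@complex.Im R) (fun x => complex.Im (F x))).
  by move=> x /Ff; exact: rdiff_is_derive_Im.
by move=> x /fc; exact: cvg_ImC.
Qed.

Lemma cintegrable_dominated D f (h : R -> \bar R) : measurable D ->
  measurable_fun D (fun x => complex.Re (f x)) ->
  measurable_fun D (fun x => complex.Im (f x)) ->
  mu.-integrable D h -> (forall x, D x -> (cabs (f x))%:E <= h x)%E ->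
  cintegrable D f.
Proof.
move=> mD m1 m2 hi fh; split; apply: (le_integrable mD _ _ hi).
- exact/measurable_EFinP.
- move=> x Dx; rewrite (le_trans _ (lee_abs _)) // (le_trans _ (fh x Dx)) //.
  by rewrite lee_fin cabs_ge_Re.
- exact/measurable_EFinP.
- move=> x Dx; rewrite (le_trans _ (lee_abs _)) // (le_trans _ (fh x Dx)) //.
  by rewrite lee_fin cabs_ge_Im.
Qed.

Lemma cintegral_dominated D (F : nat -> R -> Cx R) f (h : R -> \bar R) :
  measurable D ->
  (forall n, measurable_fun D (fun x => complex.Re (F n x))) ->
  (forall n, measurable_fun D (fun x => complex.Im (F n x))) ->
  measurable_fun D (fun x => complex.Re (f x)) ->
  measurable_fun D (fun x => complex.Im (f x)) ->
  mu.-integrable D h ->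
  (forall n x, D x -> (cabs (F n x))%:E <= h x)%E ->
  (forall x, D x -> F n x @[n --> \oo] --> f x) ->
  cintegral D (F n) @[n --> \oo] --> cintegral D f.
Proof.
move=> mD m1 m2 m3 m4 hi Fh Ff.
have S (p : Cx R -> R) :
   (forall z, `|p z| <= cabs z) -> (forall n, measurable_fun D (fun x => p (F n x))) ->
   measurable_fun D (fun x => p (f x)) ->
   (forall x, D x -> p (F n x) @[n --> \oo] --> p (f x)) ->
   Rintegral mu D (fun x => p (F n x)) @[n --> \oo] --> Rintegral mu D (fun x => p (f x)).
  move=> pz mF mf cF.
  have [i1 _ H] := @dominated_convergence _ _ _ mu D mD (fun n x => (p (F n x))%:E)
    (fun x => (p (f x))%:E) h ltac:(by move=> n; exact/measurable_EFinP)
    ltac:(exact/measurable_EFinP)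
    ltac:(by apply: aeW => x Dx; apply/fine_cvgP; split; [exact: nearW|exact: cF]) hi
    ltac:(by apply: aeW => x n Dx; rewrite (le_trans _ (Fh n x Dx)) // lee_fin).
  have H2 : (\int[mu]_(x in D) (p (F n x))%:E @[n --> \oo] --> (Rintegral mu D (fun x => p (f x)))%:E)%E.
    by rewrite /Rintegral fineK //; exact: integrable_fin_num.
  by move/fine_cvgP: H2 => [_].
apply: cvg_CReIm => /=.
  apply: S => // [z|x Dx]; first exact: cabs_ge_Re.
  by apply: cvg_ReC; exact: Ff.
apply: S => // [z|x Dx]; first exact: cabs_ge_Im.
by apply: cvg_ImC; exact: Ff.
Qed.

End ComplexIntegral.

(** * The Cauchy formula and its consequences *)

Section Goursat.
Variable R : realType.
Implicit Types (x y e : R) (z w : Cx R).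

(** A primitive in [w] of the affine function [al + be * (w - w0)], which will be the first-order
    expansion of [G] at [w0]. *)
Definition quad (al be w0 w : Cx R) := al * w + be * (w - w0) ^+ 2 / 2.

Lemma cdiff_quad al be w0 w : cdiff (quad al be w0) w (al + be * (w - w0)).
Proof.
have b0 : 0 < cabs be + 1 by have := cabs_ge0 be; lra.
move=> e e0; exists (e / (cabs be + 1)); first exact: divr_gt0.
move=> v hv; rewrite /quad.
have -> : al * v + be * (v - w0) ^+ 2 / 2 - (al * w + be * (w - w0) ^+ 2 / 2)
  - (al + be * (w - w0)) * (v - w) = 2^-1 * be * (v - w) * (v - w) by field.
rewrite !cabsM; apply: ler_wpM2r; first exact: cabs_ge0.
have -> : cabs (2^-1 : Cx R) = 2^-1.
  have -> : (2^-1 : Cx R) = toCx 2^-1 by rewrite toCxV toCxD.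
  by rewrite cabs_toCx ger0_norm.
move: hv; rewrite ltr_pdivlMr // => hv.
have := cabs_ge0 be; have := cabs_ge0 (v - w); nra.
Qed.

(** The pigeonhole step of the bisection: if three quarters have a small boundary integral, the
    fourth has a large one. *)
Lemma four_le (z1 z2 z3 z4 : Cx R) (t : R) : 4 * t <= cabs (z1 + z2 + z3 + z4) ->
  cabs z1 < t -> cabs z2 < t -> cabs z3 < t -> t <= cabs z4.
Proof.
have := cabsD (z1 + z2 + z3) z4; have := cabsD (z1 + z2) z3; have := cabsD z1 z2.
lra.
Qed.

Lemma cont_pullback (G : Cx R -> Cx R) (h h' : R -> Cx R) x :
  (exists d, cdiff G (h x) d) -> (exists d, rdiff h x d) -> ccont h' x ->
  ccont (fun s => G (h s) * h' s) x.
Proof.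
move=> [d Gd] [d' /rdiff_cont hc] h'c.
by apply: ccontM h'c; exact: ccont_comp hc Gd.
Qed.

(* The part of the integrand that is affine in the position integrates to the
   increment of a quadratic primitive; only the error term is left. *)
Lemma edge_estimate (a b : R) (h h' : R -> Cx R) (G : Cx R -> Cx R)
    (al be w0 : Cx R) (M C : R) : a <= b ->
  (forall x, a <= x <= b -> rdiff h x (h' x)) ->
  (forall x, a <= x <= b -> ccont h' x) ->
  (forall x, a <= x <= b -> cabs (h' x) <= C) ->
  (forall x, a <= x <= b -> exists d, cdiff G (h x) d) ->
  (forall x, a <= x <= b -> cabs (G (h x) - (al + be * (h x - w0))) <= M) ->
  cabs (cintegral `[a, b] (fun x => G (h x) * h' x)
    - (quad al be w0 (h b) - quad al be w0 (h a))) <= M * C * (b - a).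
Proof.
move=> ab hd h'c hC Gd GM; set P := quad al be w0.
pose L w := al + be * (w - w0).
have dP w : cdiff P w (L w) := cdiff_quad al be w0 w.
have cL (s : R) : a <= s <= b -> ccont (fun s => L (h s) * h' s) s.
  move=> sab; apply: ccontM; last exact: h'c.
  apply: ccontD; first exact: ccont_cst.
  apply: ccontM; first exact: ccont_cst.
  apply: ccontD; last exact: ccont_cst.
  exact: (rdiff_cont (hd s sab)).
rewrite -(@cintegral_FTC _ a b (P \o h) (fun s => L (h s) * h' s)) //; last first.
  by move=> x xab; apply: rdiff_comp; [exact: hd|exact: dP].
have cG (s : R) : a <= s <= b -> ccont (fun s => G (h s) * h' s) s.
  move=> sab; apply: cont_pullback; [exact: Gd| |exact: h'c].
  by exists (h' s); exact: hd.
have iG := cintegrable_cont cG; have iL := cintegrable_cont cL.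
have mab : measurable (`[a, b] : set (measurableTypeR R)) by [].
rewrite -(cintegralB mab iG iL).
apply: cabs_cintegral_itv => //; first exact: cintegrableB.
move=> x xab; rewrite -mulrBl cabsM.
by apply: ler_pM; rewrite ?cabs_ge0 ?GM ?hC.
Qed.

Variables (a b c d : R) (H Hx Hy : R -> R -> Cx R) (G : Cx R -> Cx R) (C : R).
Hypothesis ab : a <= b.
Hypothesis cd : c <= d.
Let inQ x y := (a <= x <= b) && (c <= y <= d).
Hypothesis Hxd : forall x y, inQ x y -> rdiff (H^~ y) x (Hx x y).
Hypothesis Hyd : forall x y, inQ x y -> rdiff (H x) y (Hy x y).
Hypothesis Hxc : forall x y, inQ x y -> ccont (Hx^~ y) x.
Hypothesis Hyc : forall x y, inQ x y -> ccont (Hy x) y.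
Hypothesis HxC : forall x y, inQ x y -> cabs (Hx x y) <= C.
Hypothesis HyC : forall x y, inQ x y -> cabs (Hy x y) <= C.
Hypothesis Gd : forall x y, inQ x y -> exists k, cdiff G (H x y) k.

Let Ix p q y := cintegral `[p, q] (fun x => G (H x y) * Hx x y).
Let Iy x p q := cintegral `[p, q] (fun y => G (H x y) * Hy x y).
(** The integral of [G] along the image under [H] of the boundary of the rectangle [p, q] x [r, s],
    run counterclockwise. *)
Let Phi p q r s := Ix p q r + Iy q r s - Ix p q s - Iy p r s.

Let IxS p m q y : a <= p -> p <= m -> m <= q -> q <= b -> c <= y -> y <= d ->
  Ix p q y = Ix p m y + Ix m q y.
Proof.
move=> ap pm mq qb cy yd; apply: cintegral_split; rewrite ?pm //.
apply: cintegrable_cont => x /andP[px xq].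
have xy : inQ x y by apply/andP; split; apply/andP; split; lra.
apply: cont_pullback; [exact: Gd| |exact: Hxc].
by exists (Hx x y); exact: Hxd.
Qed.

Let IyS x p m q : c <= p -> p <= m -> m <= q -> q <= d -> a <= x -> x <= b ->
  Iy x p q = Iy x p m + Iy x m q.
Proof.
move=> ap pm mq qb cy yd; apply: cintegral_split; rewrite ?pm //.
apply: cintegrable_cont => y /andP[px xq].
have xy : inQ x y by apply/andP; split; apply/andP; split; lra.
apply: cont_pullback; [exact: Gd| |exact: Hyc].
by exists (Hy x y); exact: Hyd.
Qed.

Let PhiS p m q r n s : a <= p -> p <= m -> m <= q -> q <= b ->
  c <= r -> r <= n -> n <= s -> s <= d ->
  Phi p q r s = Phi p m r n + Phi m q r n + Phi p m n s + Phi m q n s.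
Proof.
move=> ap pm mq qb cr rn ns sd.
have pq := le_trans pm mq; have rs := le_trans rn ns.
have h1 := le_trans ap pq; have h2 := le_trans cr rs.
have h3 := le_trans pq qb; have h4 := le_trans rs sd.
rewrite /Phi (IxS ap pm mq qb cr) // (IxS ap pm mq qb h2) //.
rewrite (IyS cr rn ns sd h1) // (IyS cr rn ns sd ap h3).
by ring.
Qed.

Let C0 : 0 <= C.
Proof. by rewrite (le_trans (cabs_ge0 (Hx a c))) // HxC // /inQ !lexx ab cd. Qed.

(** The derivative bound [C] is integrated along a horizontal and then a vertical segment. *)
Let Hlip x y x' y' : inQ x y -> inQ x' y' ->
  cabs (H x' y' - H x y) <= C * (`|x' - x| + `|y' - y|).
Proof.
have L (p q : R) (f f' : R -> Cx R) : (forall t, p <= t <= q -> rdiff f t (f' t)) ->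
   (forall t, p <= t <= q -> ccont f' t) ->
   (forall t, p <= t <= q -> cabs (f' t) <= C) ->
   forall s t, p <= s <= q -> p <= t <= q -> cabs (f t - f s) <= C * `|t - s|.
  move=> fd fc fC s t.
  wlog st : s t / s <= t.
    move=> W hs ht; have [st|ts] := leP s t; first exact: W.
    by rewrite cabsBC distrC; apply: W => //; exact: ltW.
  move=> /andP[ps sq] /andP[pt tq].
  have I v : s <= v <= t -> p <= v <= q.
    by move=> /andP[sv vt]; rewrite (le_trans ps) ?(le_trans vt).
  rewrite -(@cintegral_FTC _ s t f f') //; last 2 first.
  - by move=> v /I; exact: fd.
  - by move=> v /I; exact: fc.
  rewrite ger0_norm ?subr_ge0 //; apply: cabs_cintegral_itv => //.
    by apply: cintegrable_cont => v /I; exact: fc.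
  by move=> v /I; exact: fC.
move=> /andP[hx hy] /andP[hx' hy'].
have -> : H x' y' - H x y = (H x' y' - H x y') + (H x y' - H x y) by ring.
rewrite (le_trans (cabsD _ _)) // mulrDr lerD //.
  apply: (L a b (H^~ y') (Hx^~ y')) => // t ht.
  - by apply: Hxd; rewrite /inQ ht hy'.
  - by apply: Hxc; rewrite /inQ ht hy'.
  - by apply: HxC; rewrite /inQ ht hy'.
apply: (L c d (H x) (Hy x)) => // t ht.
- by apply: Hyd; rewrite /inQ hx ht.
- by apply: Hyc; rewrite /inQ hx ht.
- by apply: HyC; rewrite /inQ hx ht.
Qed.

(** The affine part of [G] at [H x0 y0] has a primitive and contributes nothing around a closed
    path. What remains is small compared with the size of the rectangle and is integrated over a
    path of comparable length, hence the square. *)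
Let Phi_small x0 y0 e : inQ x0 y0 -> 0 < e -> exists2 dl, 0 < dl &
  forall p q r s, a <= p -> p <= x0 <= q -> q <= b ->
    c <= r -> r <= y0 <= s -> s <= d -> (q - p) + (s - r) < dl ->
    cabs (Phi p q r s) <= e * ((q - p) + (s - r)) ^+ 2.
Proof.
move=> Q0 e0; have [k Gk] := Gd Q0.
set w0 := H x0 y0 in Gk *.
have C10 : 0 < C + 1 by move: C0; lra.
(* On each edge the integrand errs by at most [e' * (C * l)]. The derivative bound [C] and the total
   edge length [2 * l] turn this into [2 * e' * C ^+ 2 * l ^+ 2]. Using [C + 1] avoids division by
   zero. *)
pose e' := e / (2 * (C + 1) ^+ 2).
have e'0 : 0 < e' by rewrite divr_gt0 // mulr_gt0 // exprn_gt0.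
have [dl dl0 hdl] := Gk e' e'0.
exists (dl / (C + 1)); first by rewrite divr_gt0.
move=> p q r s ap /andP[px xq] qb cr /andP[ry ys] sd small.
set l := q - p + (s - r) in small *.
have pq := le_trans px xq; have rs := le_trans ry ys.
have l0 : 0 <= l by rewrite /l addr_ge0 // subr_ge0.
have inS x y : p <= x <= q -> r <= y <= s -> inQ x y.
  move=> /andP[? ?] /andP[? ?]; rewrite /inQ.
  by apply/andP; split; apply/andP; split; lra.
have Hl x y : p <= x <= q -> r <= y <= s -> cabs (H x y - w0) <= C * l.
  move=> hx hy; rewrite (le_trans (Hlip Q0 (inS _ _ hx hy))) // ler_wpM2l //.
  rewrite /l lerD // ler_norml; apply/andP; move/andP: hx => [? ?]; move/andP: hy => [? ?];
  split; lra.
pose M := e' * (C * l).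
have GM x y : p <= x <= q -> r <= y <= s ->
    cabs (G (H x y) - (G w0 + k * (H x y - w0))) <= M.
  move=> hx hy; rewrite opprD addrA (le_trans (hdl _ _)) //.
    rewrite (le_lt_trans (Hl _ _ hx hy)) //.
    move: small; rewrite ltr_pdivlMr //; have := C0; nra.
  by apply: ler_wpM2l; [exact: ltW|exact: Hl].
have pp : p <= p <= q by rewrite lexx.
have qq : p <= q <= q by rewrite lexx pq.
have rr : r <= r <= s by rewrite lexx.
have ss : r <= s <= s by rewrite lexx rs.
have EX y : r <= y <= s -> _ := fun hy => @edge_estimate p q (H^~ y) (Hx^~ y) G (G w0) k w0 M C pq
  (fun x hx => Hxd (inS _ _ hx hy)) (fun x hx => Hxc (inS _ _ hx hy))
  (fun x hx => HxC (inS _ _ hx hy)) (fun x hx => Gd (inS _ _ hx hy))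
  (fun x hx => GM _ _ hx hy).
have EY x : p <= x <= q -> _ := fun hx => @edge_estimate r s (H x) (Hy x) G (G w0) k w0 M C rs
  (fun y hy => Hyd (inS _ _ hx hy)) (fun y hy => Hyc (inS _ _ hx hy))
  (fun y hy => HyC (inS _ _ hx hy)) (fun y hy => Gd (inS _ _ hx hy))
  (fun y hy => GM _ _ hx hy).
have := EX r rr; have := EX s ss; have := EY p pp; have := EY q qq.
rewrite /= -![cintegral _ (fun x => G (H x _) * _)]/(Ix _ _ _).
rewrite -![cintegral _ (fun y => G (H _ y) * _)]/(Iy _ _ _).
set P := quad _ _ _.
move=> h1 h2 h3 h4.
(* The increments of the primitive [P] over the four edges cancel. *)
have -> : Phi p q r s = (Ix p q r - (P (H q r) - P (H p r)))
   + (Iy q r s - (P (H q s) - P (H q r)))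
   - (Ix p q s - (P (H q s) - P (H p s)))
   - (Iy p r s - (P (H p s) - P (H p r))) by rewrite /Phi; ring.
apply: (@le_trans _ _ (2 * (M * C * l))).
  rewrite (le_trans (cabsB _ _)) //.
  have := cabsB (Ix p q r - (P (H q r) - P (H p r)) + (Iy q r s - (P (H q s) - P (H q r))))
    (Ix p q s - (P (H q s) - P (H p s))).
  have := cabsD (Ix p q r - (P (H q r) - P (H p r))) (Iy q r s - (P (H q s) - P (H q r))).
  rewrite /l mulrDr; lra.
have eE : e = e' * (2 * (C + 1) ^+ 2) by rewrite /e' divfK // gt_eqF // mulr_gt0 // exprn_gt0.
have -> : 2 * (M * C * l) = e' * (2 * C ^+ 2 * l ^+ 2) by rewrite /M; ring.
have -> : e * l ^+ 2 = e' * (2 * (C + 1) ^+ 2 * l ^+ 2) by rewrite mulrA -eE.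
apply: ler_wpM2l; first exact: ltW.
apply: ler_wpM2r; first exact: sqr_ge0.
apply: ler_wpM2l => //.
by rewrite ler_sqr ?nnegrE //; [rewrite lerDl|exact: ltW].
Qed.

(** The bisection is carried out in the parameter rectangle, so the shape of the image never enters
    and the result applies directly to homotopies of curves. Separate continuity of the partial
    derivatives together with the common bound [C] is enough for this argument. *)
Lemma goursat :
  cintegral `[a, b] (fun x => G (H x c) * Hx x c)
  + cintegral `[c, d] (fun y => G (H b y) * Hy b y)
  - cintegral `[a, b] (fun x => G (H x d) * Hx x d)
  - cintegral `[c, d] (fun y => G (H a y) * Hy a y) = 0.
Proof.
rewrite -[LHS]/(Phi a b c d); apply/eqP; rewrite -cabs_eq0 eq_le cabs_ge0 andbT leNgt.
apply/negP => eta0; set eta := cabs (Phi a b c d) in eta0.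
pose wn n : R := (b - a) / 2 ^+ n; pose hn n : R := (d - c) / 2 ^+ n.
have wS n : wn n = wn n.+1 + wn n.+1.
  by rewrite /wn exprS; field; rewrite ?expf_neq0.
have hS n : hn n = hn n.+1 + hn n.+1.
  by rewrite /hn exprS; field; rewrite ?expf_neq0.
have w0 n : 0 <= wn n by rewrite divr_ge0 ?subr_ge0 ?exprn_ge0.
have h0 n : 0 <= hn n by rewrite divr_ge0 ?subr_ge0 ?exprn_ge0.
pose good n (p : R * R) := [/\ a <= p.1, p.1 + wn n <= b, c <= p.2, p.2 + hn n <= d &
  eta / 4 ^+ n <= cabs (Phi p.1 (p.1 + wn n) p.2 (p.2 + hn n))].
pose next n (p q : R * R) := [/\ p.1 <= q.1, q.1 + wn n.+1 <= p.1 + wn n,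
  p.2 <= q.2 & q.2 + hn n.+1 <= p.2 + hn n].
(* The existence is stated as an implication, with a dummy point for rectangles that are not [good],
   so that [choice] gives a total function. Quartering divides the lower bound on the boundary
   integral by 4. *)
have step (np : nat * (R * R)) : exists q, good np.1 np.2 -> good np.1.+1 q /\ next np.1 np.2 q.
  case: np => n [x y]; have [G1|nG] := pselect (good n (x, y)); last by exists (0, 0).
  case: G1; cbn [fst snd] => ax xb cy yd E.
  pose x' := x + wn n.+1; pose y' := y + hn n.+1.
  have xE : x + wn n = x' + wn n.+1 by rewrite wS addrA.
  have yE : y + hn n = y' + hn n.+1 by rewrite hS addrA.
  have xx' : x <= x' by rewrite lerDl.
  have yy' : y <= y' by rewrite lerDl.
  have x'x : x' <= x' + wn n.+1 by rewrite lerDl.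
  have y'y : y' <= y' + hn n.+1 by rewrite lerDl.
  have S : Phi x (x + wn n) y (y + hn n) = Phi x x' y y' + Phi x' (x' + wn n.+1) y y'
     + Phi x x' y' (y' + hn n.+1) + Phi x' (x' + wn n.+1) y' (y' + hn n.+1).
    by rewrite xE yE; apply: PhiS => //; rewrite -?xE -?yE.
  have E4 : eta / 4 ^+ n = 4 * (eta / 4 ^+ n.+1).
    by rewrite exprS; field; rewrite ?expf_neq0.
  move: E; rewrite S E4 => E.
  set t := eta / 4 ^+ n.+1 in E.
  have wp := w0 n.+1; have hp := h0 n.+1.
  have mk x1 y1 : x <= x1 -> x1 + wn n.+1 <= x + wn n -> y <= y1 ->
      y1 + hn n.+1 <= y + hn n ->
      t <= cabs (Phi x1 (x1 + wn n.+1) y1 (y1 + hn n.+1)) ->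
      exists q, good n (x, y) -> good n.+1 q /\ next n (x, y) q.
    move=> h1 h2 h3 h4 h5; exists (x1, y1) => _; split; split; cbn [fst snd].
    - exact: le_trans h1.
    - exact: le_trans xb.
    - exact: le_trans h3.
    - exact: le_trans yd.
    - exact: h5.
    - exact: h1.
    - exact: h2.
    - exact: h3.
    - exact: h4.
  have xl : x + wn n.+1 <= x + wn n by rewrite xE.
  have x'l : x' + wn n.+1 <= x + wn n by rewrite xE.
  have yl : y + hn n.+1 <= y + hn n by rewrite yE.
  have y'l : y' + hn n.+1 <= y + hn n by rewrite yE.
  have [K1|K1] := leP t (cabs (Phi x x' y y')).
    exact: (mk x y (lexx x) xl (lexx y) yl K1).
  have [K2|K2] := leP t (cabs (Phi x' (x' + wn n.+1) y y')).
    exact: (mk x' y xx' x'l (lexx y) yl K2).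
  have [K3|K3] := leP t (cabs (Phi x x' y' (y' + hn n.+1))).
    exact: (mk x y' (lexx x) xl yy' y'l K3).
  exact: (mk x' y' xx' x'l yy' y'l (four_le E K1 K2 K3)).
have [f fP] := choice step.
pose fix P n := if n is m.+1 then f (m, P m) else (a, c).
have gP n : good n (P n).
  elim: n => [|n IH]; last by have [] := fP (n, P n) IH.
  have wE : a + wn 0%N = b by rewrite /wn expr0 divr1 addrC subrK.
  have hE : c + hn 0%N = d by rewrite /hn expr0 divr1 addrC subrK.
  have -> : P 0%N = (a, c) by [].
  by split; cbn [fst snd]; rewrite ?wE ?hE ?expr0 ?divr1.
have nP n : next n (P n) (P n.+1) by have [] := fP (n, P n) (gP n).
(* Nested closed intervals share a point: the supremum of their left ends. *)
have lim (x_ l_ : nat -> R) : (forall n, x_ n <= x_ n.+1) ->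
    (forall n, x_ n.+1 + l_ n.+1 <= x_ n + l_ n) -> (forall n, 0 <= l_ n) ->
    exists X, forall n, x_ n <= X <= x_ n + l_ n.
  move=> xi xd l0.
  have mi m k : x_ m <= x_ (m + k)%N.
    by elim: k => [|k IH]; rewrite ?addn0 // addnS (le_trans IH).
  have md m k : x_ (m + k)%N + l_ (m + k)%N <= x_ m + l_ m.
    by elim: k => [|k IH]; rewrite ?addn0 // addnS (le_trans _ IH).
  have ub n m : x_ m <= x_ n + l_ n.
    have [mn|/ltnW nm] := leqP m n.
      by rewrite -(subnKC mn) (le_trans (mi m (n - m)%N)) // lerDl.
    by rewrite -(subnKC nm) (le_trans _ (md n (m - n)%N)) // lerDl.
  exists (sup (range x_)) => n; apply/andP; split.
    apply: sup_upper_bound; last by exists n.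
    split; first by exists (x_ 0%N); exists 0%N.
    by exists (x_ 0%N + l_ 0%N) => _ [m _ <-].
  apply: ge_sup; first by exists (x_ 0%N); exists 0%N.
  by move=> _ [m _ <-].
have [X XP] := lim (fun n => (P n).1) wn (fun n => let: And4 h _ _ _ := nP n in h)
  (fun n => let: And4 _ h _ _ := nP n in h) w0.
have [Y YP] := lim (fun n => (P n).2) hn (fun n => let: And4 _ _ h _ := nP n in h)
  (fun n => let: And4 _ _ _ h := nP n in h) h0.
have Q0 : inQ X Y.
  have := XP 0%N; have := YP 0%N; rewrite /inQ /= /wn /hn !expr0 !divr1.
  by rewrite ![_ + (_ - _)]addrC !subrK => -> ->.
pose L := (b - a) + (d - c).
have L0 : 0 <= L by rewrite addr_ge0 // subr_ge0.
(* This gives [e * L ^+ 2 < eta], which contradicts the lower bound [eta / 4 ^+ n] for the n-th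
   rectangle, of half-perimeter [L / 2 ^+ n]. The 1 covers [L = 0]. *)
pose e := eta / (2 * (L ^+ 2 + 1)).
have D0 : 0 < 2 * (L ^+ 2 + 1) by rewrite mulr_gt0 // ltr_wpDl ?sqr_ge0.
have e0 : 0 < e by rewrite divr_gt0.
have [dl dl0 hdl] := Phi_small Q0 e0.
have [n Hn] : exists n, L / 2 ^+ n < dl.
  have : L / 2 ^+ n @[n --> \oo] --> L * 0.
    apply: cvgM; first exact: cvg_cst.
    have -> : (fun n => (2 ^+ n)^-1 : R) = (fun n => (2^-1) ^+ n).
      by apply/funext => n; rewrite exprVn.
    by apply: cvg_expr; rewrite ger0_norm ?invr_ge0 // invf_lt1 // ltr1n.
  rewrite mulr0 => /cvgrPdist_lt /(_ dl dl0)[n _ /(_ n (leqnn n))] /=.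
  by rewrite sub0r normrN => /ltr_normlW; exists n.
have [a1 a2 a3 a4 a5] := gP n.
have LE : (P n).1 + wn n - (P n).1 + ((P n).2 + hn n - (P n).2) = L / 2 ^+ n.
  by rewrite /wn /hn /L; field; rewrite expf_neq0.
have := hdl (P n).1 ((P n).1 + wn n) (P n).2 ((P n).2 + hn n) a1 (XP n) a2 a3 (YP n) a4.
rewrite LE => /(_ Hn) /(le_trans a5).
have -> : e * (L / 2 ^+ n) ^+ 2 = e * L ^+ 2 / 4 ^+ n.
  have -> : 4 ^+ n = (2 ^+ n) ^+ 2 :> R by rewrite -exprM mulnC exprM expr2 -natrM.
  by field; rewrite expf_neq0.
rewrite ler_pM2r ?invr_gt0 ?exprn_gt0 // /e mulrAC ler_pdivlMr //.
have := sqr_ge0 L; nra.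
Qed.

End Goursat.

(** * Cauchy's formula in terms of means over circles *)

Section Cauchy.
Variable R : realType.
Implicit Types (x y e s : R) (z w : Cx R) (f g : Cx R -> Cx R).

Definition cdb f z := exists d, cdiff f z d.

Lemma cdbP f z : derivable f z 1 <-> cdb f z.
Proof. exact: derivable_cdiff. Qed.

Lemma analyticP f : analytic_disc f <-> forall z, disc R z -> cdb f z.
Proof. by split=> h z /h /cdbP. Qed.

Lemma cdb_cst (k : Cx R) z : cdb (fun=> k) z.
Proof. by apply/cdbP; exact: derivable_cst. Qed.

Lemma cdb_id z : cdb (fun w => w) z.
Proof. by apply/cdbP; exact: derivable_id. Qed.

Lemma cdbD f g z : cdb f z -> cdb g z -> cdb (fun w => f w + g w) z.
Proof. by move=> /cdbP fd /cdbP gd; apply/cdbP; exact: derivableD. Qed.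

Lemma cdbM f g z : cdb f z -> cdb g z -> cdb (fun w => f w * g w) z.
Proof. by move=> /cdbP fd /cdbP gd; apply/cdbP; exact: derivableM. Qed.

Lemma cdbB f g z : cdb f z -> cdb g z -> cdb (fun w => f w - g w) z.
Proof. by move=> /cdbP fd /cdbP gd; apply/cdbP; exact: derivableB. Qed.

Lemma cdbV f z : f z != 0 -> cdb f z -> cdb (fun w => (f w)^-1) z.
Proof. by move=> f0 /cdbP fd; apply/cdbP; exact: derivableV. Qed.

Lemma cdbX f z n : cdb f z -> cdb (fun w => f w ^+ n) z.
Proof.
move=> fd; elim: n => [|n IH]; first by apply: cdb_cst.
have -> : (fun w => f w ^+ n.+1) = (fun w => f w * f w ^+ n).
  by apply/funext => w; rewrite exprS.
exact: cdbM.
Qed.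

Lemma cdb_sum (I : Type) (r : seq I) (F : I -> Cx R -> Cx R) z :
  (forall i, cdb (F i) z) -> cdb (fun w => \sum_(i <- r) F i w) z.
Proof.
move=> Fd; elim: r => [|i r IH].
  have -> : (fun w => \sum_(i <- [::]) F i w) = (fun=> 0).
    by apply/funext => w; rewrite big_nil.
  exact: cdb_cst.
have -> : (fun w => \sum_(j <- i :: r) F j w) = (fun w => F i w + \sum_(j <- r) F j w).
  by apply/funext => w; rewrite big_cons.
exact: cdbD.
Qed.

Lemma cdb_comp f g z : cdb g z -> cdb f (g z) -> cdb (fun w => f (g w)) z.
Proof.
move=> /cdbP/derivable1_diffP gd /cdbP/derivable1_diffP fd; apply/cdbP/derivable1_diffP.
exact: (@differentiable_comp (Cx R) (Cx R) (Cx R) (Cx R) g f z gd fd).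
Qed.

Lemma rdiff_real (f : R -> R) x (d : R) : is_derive x (1 : R) f d ->
  rdiff (fun y => toCx (f y)) x (toCx d).
Proof.
move=> [df fd] e e0.
have : (fun h : R => h^-1 *: ((f \o shift x) (h *: 1) - f x)) @ 0^' --> d.
  by rewrite -fd.
move=> /cvgrPdist_lt /(_ e e0).
rewrite /dnbhs near_withinE => /nbhs_ballP[dl /= dl0 h]; exists dl => // y hy.
have [->|yx] := eqVneq y x.
  by rewrite !subrr -toCxM mulr0 toCx0 subrr cabs0 normr0 mulr0.
have yx0 : y - x != 0 by rewrite subr_eq0.
have := h (y - x).
rewrite /ball /= sub0r normrN => /(_ hy yx0).
rewrite [_ *: 1]mulr1 subrK [_ *: _]/(_ * _) => H.
rewrite -toCxM -!toCxB cabs_toCx -ler_pdivrMr ?normr_gt0 // -normfV -normrM.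
rewrite mulrC mulrBr mulrCA mulVf // mulr1 distrC; exact: ltW.
Qed.

Lemma rdiff_cst (k : Cx R) x : rdiff (fun=> k) x 0.
Proof.
move=> e e0; exists 1 => // y _.
by rewrite subrr mul0r subrr cabs0 mulr_ge0 // ltW.
Qed.

Lemma rdiffD (f g : R -> Cx R) x d d' : rdiff f x d -> rdiff g x d' ->
  rdiff (fun y => f y + g y) x (d + d').
Proof.
move=> fd gd e e0.
have [d1 d10 h1] := fd (e / 2) ltac:(lra).
have [d2 d20 h2] := gd (e / 2) ltac:(lra).
exists (Num.min d1 d2); first by rewrite lt_min d10.
move=> y; rewrite lt_min => /andP[/h1 {}h1 /h2 {}h2].
have -> : f y + g y - (f x + g x) - (d + d') * toCx (y - x) =
  (f y - f x - d * toCx (y - x)) + (g y - g x - d' * toCx (y - x)) by ring.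
rewrite (le_trans (cabsD _ _)) //; lra.
Qed.

Lemma rdiffZ (f : R -> Cx R) x d k : rdiff f x d -> rdiff (fun y => k * f y) x (k * d).
Proof.
move=> fd; apply: (@rdiff_comp _ (fun w => k * w) f x d k fd).
move=> e e0; exists 1 => // w _.
have -> : k * w - k * f x - k * (w - f x) = 0 by ring.
by rewrite cabs0 mulr_ge0 ?cabs_ge0 // ltW.
Qed.

Lemma rdiff_toCx x : rdiff (@toCx R) x 1.
Proof.
move=> e e0; exists 1 => // y _.
by rewrite -toCxB mul1r subrr cabs0 mulr_ge0 // ltW.
Qed.

Definition cexp (y : R) : Cx R := toCx (cos y) + 'i * toCx (sin y).

Lemma rdiff_cexp y : rdiff cexp y ('i * cexp y).
Proof.
have -> : 'i * cexp y = toCx (- sin y) + 'i * toCx (cos y).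
  by rewrite /cexp mulrDr mulrA -expr2 sqr_i mulN1r toCxN addrC.
apply: rdiffD; first exact: rdiff_real (is_derive_cos y).
exact: rdiffZ (rdiff_real (is_derive_sin y)).
Qed.

Lemma cabs_cexp y : cabs (cexp y) = 1.
Proof.
apply/eqP; rewrite -(@eqrXn2 _ 2) ?cabs_ge0 // cabs_sqr expr1n.
by rewrite /cexp cReD cImD cReM cImM /= !(mul0r, mul1r, mulr0, subr0, addr0, add0r) cos2Dsin2.
Qed.

Lemma cexp0 : cexp 0 = 1.
Proof. by rewrite /cexp cos0 sin0 mulr0 addr0. Qed.

Lemma cexp2pi : cexp (pi *+ 2) = 1.
Proof. by rewrite /cexp cos2pi sin2pi mulr0 addr0. Qed.

Definition circ s y : Cx R := toCx s * cexp y.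

Lemma cabs_circ s y : 0 <= s -> cabs (circ s y) = s.
Proof. by move=> s0; rewrite /circ cabsM cabs_cexp mulr1 cabs_toCx ger0_norm. Qed.

Lemma ccont_circ s y : ccont (circ s) y.
Proof. exact: rdiff_cont (rdiffZ _ (rdiff_cexp y)). Qed.

(** The contour integral of f(w) dw / (2 pi i w) over |w| = s. In this normalisation the Cauchy
    kernel becomes the factor w / (w - z). *)
Definition cmean f s : Cx R :=
  toCx (pi *+ 2)^-1 * cintegral `[0, pi *+ 2] (fun y => f (circ s y)).

Let pi20 : 0 < pi *+ 2 :> R.
Proof. by rewrite mulrn_wgt0 // pi_gt0. Qed.

Definition circle_cont f s := forall y, ccont (fun t => f (circ s t)) y.

Lemma circle_cont_cdb f s : 0 <= s -> (forall w, cabs w = s -> cdb f w) -> circle_cont f s.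
Proof.
move=> s0 fd y; have [d fd'] := fd _ (cabs_circ y s0).
exact: (@ccont_comp _ f (circ s) y d (@ccont_circ s y) fd').
Qed.

Lemma cabs_cmean f s (M : R) : 0 <= s -> circle_cont f s ->
  (forall w, cabs w = s -> cabs (f w) <= M) -> cabs (cmean f s) <= M.
Proof.
move=> s0 fc fM; rewrite /cmean cabsM cabs_toCx ger0_norm ?invr_ge0 ?(ltW pi20) //.
rewrite ler_pdivrMl // mulrC.
have := @cabs_cintegral_itv R 0 (pi *+ 2) (fun y => f (circ s y)) M (ltW pi20).
rewrite subr0; apply; first by apply: cintegrable_cont => y _; exact: fc.
by move=> y _; apply: fM; rewrite cabs_circ.
Qed.

Lemma cmean_cst k s : cmean (fun=> k) s = k.
Proof.
rewrite /cmean cintegral_cst ?(ltW pi20) // subr0 mulrCA -toCxM mulVf ?mulr1 //.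
by rewrite gt_eqF.
Qed.

Lemma cmeanD f g s : circle_cont f s -> circle_cont g s ->
  cmean (fun w => f w + g w) s = cmean f s + cmean g s.
Proof.
move=> fc gc; rewrite /cmean cintegralD //; first by rewrite mulrDr.
  by apply: cintegrable_cont => y _; exact: fc.
by apply: cintegrable_cont => y _; exact: gc.
Qed.

Lemma cmeanZ f s k : circle_cont f s -> cmean (fun w => k * f w) s = k * cmean f s.
Proof.
move=> fc; rewrite /cmean cintegralZ //; first by rewrite mulrCA.
by apply: cintegrable_cont => y _; exact: fc.
Qed.

Lemma eq_cmean f g s : 0 <= s -> (forall w, cabs w = s -> f w = g w) ->
  cmean f s = cmean g s.
Proof.
move=> s0 fg; rewrite /cmean; congr (_ * _); apply: eq_cintegral => y _.
by apply: fg; rewrite cabs_circ.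
Qed.

Lemma circle_contD f g s : circle_cont f s -> circle_cont g s ->
  circle_cont (fun w => f w + g w) s.
Proof. by move=> fc gc y; exact: ccontD (fc y) (gc y). Qed.

Lemma circle_contM f g s : circle_cont f s -> circle_cont g s ->
  circle_cont (fun w => f w * g w) s.
Proof. by move=> fc gc y; exact: ccontM (fc y) (gc y). Qed.

Lemma circle_cont_cst k s : circle_cont (fun=> k) s.
Proof. by move=> y; exact: ccont_cst. Qed.

(* The circle [|w| = s] is deformed into [|w - z| = e] through the circles of
   centre [x z] and radius [s + x (e - s)], which avoid [z]. *)
Lemma cauchy_formula f z s : cabs z < s -> s < 1 -> (forall w, disc R w -> cdb f w) ->
  cmean (fun w => f w * (w / (w - z))) s = f z.
Proof.
move=> zs s1 fd.
have s0 : 0 < s := le_lt_trans (cabs_ge0 z) zs.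
have z1 : cabs z < 1 := lt_trans zs s1.
have def e : 0 < e -> e < 1 - cabs z ->
    cmean (fun w => f w * (w / (w - z))) s = 
    toCx (pi *+ 2)^-1 * cintegral `[0, pi *+ 2] (fun y => f (z + circ e y)).
  move=> e0 e1.
  pose rho x := s + x * (e - s).
  pose H x y := toCx x * z + toCx (rho x) * cexp y.
  pose Hx x y := z + toCx (e - s) * cexp y.
  pose Hy x y := toCx (rho x) * ('i * cexp y).
  pose G w := f w / (w - z).
  have rho0 x : 0 <= x <= 1 -> 0 < rho x.
    move=> /andP[x0 x1]; rewrite /rho.
    have -> : s + x * (e - s) = (1 - x) * s + x * e by ring.
    have [->|x10] := eqVneq x 1; first by rewrite subrr mul0r add0r mul1r.
    rewrite ltr_wpDr ?mulr_ge0 ?(ltW e0) // mulr_gt0 // subr_gt0 lt_def x1 andbT.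
    by rewrite eq_sym.
  have Hne x y : 0 <= x <= 1 -> H x y - z != 0.
    move=> x01; have r0 := rho0 x x01; move/andP: x01 => [x0 x1].
    rewrite -cabs_gt0 /H.
    (* The distance from [H x y] to [z] is at least [rho x - (1 - x) * cabs z], which equals (1 -
       x)(s - |z|) + x e and is positive. *)
    have -> : toCx x * z + toCx (rho x) * cexp y - z =
      toCx (rho x) * cexp y - toCx (1 - x) * z by rewrite toCxB; ring.
    apply: (lt_le_trans _ (cabs_dist _ _)).
    rewrite !cabsM cabs_cexp mulr1 !cabs_toCx ger0_norm ?(ltW r0) // ger0_norm ?subr_ge0 //.
    rewrite /rho subr_gt0.
    have [->|x10] := eqVneq x 1; first by rewrite subrr mul0r; lra.
    have : 0 < 1 - x by rewrite subr_gt0 lt_def x1 andbT eq_sym.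
    nra.
  have Hd x y : 0 <= x <= 1 -> disc R (H x y).
    move=> x01; have r0 := rho0 x x01; move/andP: x01 => [x0 x1].
    rewrite /disc /= /H; apply: (le_lt_trans (cabsD _ _)).
    rewrite !cabsM cabs_cexp mulr1 !cabs_toCx !ger0_norm ?(ltW r0) // /rho.
    have [->|x10] := eqVneq x 1; first by lra.
    have : 0 < 1 - x by rewrite subr_gt0 lt_def x1 andbT eq_sym.
    nra.
  have rho1E : rho 1 = e by rewrite /rho mul1r addrC subrK.
  have rho0E : rho 0 = s by rewrite /rho mul0r addr0.
  have H1 y : H 1 y = z + circ e y by rewrite /H rho1E toCx1 mul1r.
  have H0 y : H 0 y = circ s y by rewrite /H rho0E toCx0 mul0r add0r.
  have Hxd x y : rdiff (H^~ y) x (Hx x y).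
    have -> : (H^~ y) = (fun t => (toCx s * cexp y) + (z + toCx (e - s) * cexp y) * toCx t).
      by apply/funext => t; rewrite /H /rho !(toCxD, toCxM); ring.
    rewrite -[Hx x y]add0r -[Hx x y]mulr1; apply: rdiffD; first exact: rdiff_cst.
    exact/rdiffZ/rdiff_toCx.
  have Hyd x y : rdiff (H x) y (Hy x y).
    rewrite -[Hy x y]add0r; apply: rdiffD; first exact: rdiff_cst.
    exact/rdiffZ/rdiff_cexp.
  have Hyc x y : ccont (Hy x) y.
    apply: ccontM; first exact: ccont_cst.
    apply: ccontM; first exact: ccont_cst.
    exact: rdiff_cont (rdiff_cexp y).
  have Hxc x y : ccont (Hx^~ y) x by exact: ccont_cst.
  have HxC x y : cabs (Hx x y) <= 3.
    rewrite /Hx (le_trans (cabsD _ _)) // cabsM cabs_cexp mulr1 cabs_toCx.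
    have z0 := cabs_ge0 z; have : `|e - s| <= 1 by rewrite ler_norml; apply/andP; split; lra.
    lra.
  have HyC x y : 0 <= x <= 1 -> cabs (Hy x y) <= 3.
    move=> x01; have r0 := rho0 x x01; move/andP: x01 => [x0 x1].
    rewrite /Hy !cabsM cabs_cexp mulr1 cabs_toCx ger0_norm ?(ltW r0) //.
    have -> : cabs ('i : Cx R) = 1.
      by rewrite /cabs normc_def /= expr0n expr1n add0r sqrtr1.
    rewrite !mulr1 /rho; have := cabs_ge0 z; nra.
  have Gd x y : 0 <= x <= 1 -> exists k, cdiff G (H x y) k.
    move=> x01; apply: cdbM; first exact/fd/Hd.
    apply: cdbV; first exact: Hne.
    by apply: cdbB; [exact: cdb_id|exact: cdb_cst].
  have := @goursat R 0 1 0 (pi *+ 2) H Hx Hy G 3 ler01 (ltW pi20)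
     (fun x y _ => Hxd x y) (fun x y _ => Hyd x y) (fun x y _ => Hxc x y)
     (fun x y _ => Hyc x y) (fun x y _ => HxC x y)
     (fun x y h => HyC x y (proj1 (andP h))) (fun x y h => Gd x y (proj1 (andP h))).
  (* By periodicity the edges [y = 0] and [y = 2 pi] carry the same integral and cancel. The
     equality of the two circle integrals is what is left. *)
  have -> : (fun x => G (H x (pi *+ 2)) * Hx x (pi *+ 2)) = (fun x => G (H x 0) * Hx x 0).
    by apply/funext => x; rewrite /H /Hx cexp0 cexp2pi.
  have T (p q r : Cx R) : p + q - p - r = q - r by ring.
  rewrite T => /eqP; rewrite subr_eq0 => /eqP E.
  rewrite /cmean; congr (_ * _).
  have i0 : 'i != 0 :> Cx R by rewrite eq_complex /= oner_eq0 andbF.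
  apply: (mulfI i0).
  have z1x : (0 : R) <= 1 <= (1 : R) by rewrite ler01 lexx.
  have z0x : (0 : R) <= 0 <= (1 : R) by rewrite ler01 lexx.
  have mI : measurable (`[0, pi *+ 2] : set (measurableTypeR R)) by [].
  have i1 : cintegrable `[0, pi *+ 2] (fun y => f (z + circ e y)).
    apply: cintegrable_cont => y _; have := Hd 1 y z1x; rewrite H1 => /fd[k hk]; apply: (@ccont_comp _ f (fun t => z + circ e t) y k _ hk).
    by apply: ccontD; [exact: ccont_cst|exact: ccont_circ].
  have i2 : cintegrable `[0, pi *+ 2] (fun y => f (circ s y) * (circ s y / (circ s y - z))).
    apply: cintegrable_cont => y _.
    have dw : cdb (fun w => f w * (w / (w - z))) (circ s y).
      have := Hd 0 y z0x; have := Hne 0 y z0x; rewrite H0 => n0 dd; apply: cdbM; first exact: fd.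
      apply: cdbM; first exact: cdb_id.
      apply: cdbV => //.
      by apply: cdbB; [exact: cdb_id|exact: cdb_cst].
    have [k hk] := dw.
    exact: (@ccont_comp _ (fun w => f w * (w / (w - z))) (circ s) y k (@ccont_circ s y) hk).
  rewrite -(cintegralZ 'i mI i1) -(cintegralZ 'i mI i2).
  transitivity (cintegral `[0, pi *+ 2] (fun y => G (H 0 y) * Hy 0 y)).
    apply: eq_cintegral => y _; rewrite /G /Hy H0 rho0E.
    by rewrite [toCx s * ('i * _)]mulrCA -/(circ s y); ring.
  rewrite -E; apply: eq_cintegral => y _.
  have := Hne 1 y z1x; rewrite /G /Hy H1 rho1E [toCx e * ('i * _)]mulrCA -/(circ e y) addrAC subrr add0r => n0.
  by rewrite mulrCA divfK.
have fz : cdb f z by exact: fd.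
set I := cmean _ _ in def *.
apply/eqP; rewrite -subr_eq0 -cabs_eq0 eq_le cabs_ge0 andbT.
apply/ler_addgt0Pr => k k0; rewrite add0r.
have [d /cdiff_lip[dl dl0 hdl]] := fz.
have d0 : 0 < cabs d + 1 by have := cabs_ge0 d; lra.
(* The mean of [f] over the circle of radius [e] about [z] differs from [f z] by at most
   [(cabs d + 1) * e], which the last entry makes at most [k]. The other entries keep the circle in
   the disc and within reach of the Lipschitz bound. *)
pose e := Num.min ((1 - cabs z) / 2) (Num.min (dl / 2) (k / (cabs d + 1))).
have e0 : 0 < e by rewrite !lt_min !divr_gt0 // subr_gt0.
have e1 : e < 1 - cabs z.
  by rewrite /e gt_min; apply/orP; left; lra.
have e2 : e < dl.
  by rewrite /e !gt_min; apply/orP; right; apply/orP; left; lra.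
have e3 : (cabs d + 1) * e <= k.
  by rewrite mulrC -ler_pdivlMr // /e !ge_min lexx !orbT.
rewrite (def e e0 e1).
have fcont y : ccont (fun t => f (z + circ e t)) y.
  have [k' hk] : cdb f (z + circ e y).
    apply: fd; rewrite /disc /=; apply: (le_lt_trans (cabsD _ _)).
    by rewrite cabs_circ ?(ltW e0) //; lra.
  apply: (@ccont_comp _ f (fun t => z + circ e t) y k' _ hk); apply: ccontD; [exact: ccont_cst|exact: ccont_circ].
have -> : f z = toCx (pi *+ 2)^-1 * cintegral `[0, pi *+ 2] (fun=> f z).
  by rewrite -[LHS](cmean_cst _ 1).
rewrite -mulrBr -cintegralB //; last 2 first.
- by apply: cintegrable_cont => y _.
- by apply: cintegrable_cont => y _; exact: ccont_cst.
rewrite cabsM cabs_toCx ger0_norm ?invr_ge0 ?(ltW pi20) // ler_pdivrMl // mulrC.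
rewrite -[X in _ <= _ * X]subr0; apply: cabs_cintegral_itv; first exact: ltW.
  apply: cintegrable_cont => y _; apply: ccontB => //; exact: ccont_cst.
move=> y _; have := hdl (z + circ e y).
have -> : z + circ e y - z = circ e y by ring.
rewrite cabs_circ ?(ltW e0) // => /(_ e2) /le_trans; exact.
Qed.

End Cauchy.

(** * Cauchy estimates, maximum principle and Taylor remainders *)

Section CauchyEstimates.
Variable R : realType.
Implicit Types (x y e s r rho M : R) (z w : Cx R) (f g : Cx R -> Cx R).

Definition holo f := forall w, disc R w -> cdb f w.

(** If [b < a], then [k * (b / a) ^+ n] would tend to 0 while staying at least 1. *)
Lemma ler_expn_const (a b k : R) : 0 <= a -> 0 <= b ->
  (forall n, a ^+ n <= k * b ^+ n) -> a <= b.
Proof.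
move=> a0 b0 H; rewrite leNgt; apply/negP => ba.
have a_gt0 : 0 < a := le_lt_trans b0 ba.
have : k * (b / a) ^+ n @[n --> \oo] --> k * 0.
  apply: cvgM; first exact: cvg_cst.
  by apply: cvg_expr; rewrite ger0_norm ?divr_ge0 // ltr_pdivrMr // mul1r.
rewrite mulr0 => /cvgrPdist_lt /(_ 1 ltr01)[n _ /(_ n (leqnn n))] /=.
rewrite sub0r normrN => /ltr_normlW; apply/negP; rewrite -leNgt.
by rewrite exprMn exprVn mulrA ler_pdivlMr ?exprn_gt0 // mul1r.
Qed.

Lemma circle_cont_holo f s : 0 <= s -> s < 1 -> holo f -> circle_cont f s.
Proof. by move=> s0 s1 fd; apply: circle_cont_cdb => // w ws; apply: fd; rewrite /disc /= ws. Qed.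

Lemma circle_sub_neq0 z w s : cabs z < s -> cabs w = s -> w - z != 0.
Proof.
move=> zs ws; rewrite -cabs_gt0; apply: (lt_le_trans _ (cabs_dist _ _)).
by rewrite ws subr_gt0.
Qed.

Lemma circle_cont_cauchy z s : cabs z < s -> circle_cont (fun w => w / (w - z)) s.
Proof.
move=> zs; apply: circle_cont_cdb => [|w ws]; first exact: ltW (le_lt_trans (cabs_ge0 _) zs).
apply: cdbM; first exact: cdb_id.
apply: cdbV; first exact: circle_sub_neq0 zs ws.
by apply: cdbB; [exact: cdb_id|exact: cdb_cst].
Qed.

Lemma cauchy_le f z s M : holo f -> cabs z < s -> s < 1 ->
  (forall w, cabs w = s -> cabs (f w) <= M) -> cabs (f z) <= s / (s - cabs z) * M.
Proof.
move=> fd zs s1 fM.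
have s0 : 0 < s := le_lt_trans (cabs_ge0 z) zs.
rewrite -(cauchy_formula zs s1 fd); apply: cabs_cmean; first exact: ltW.
  apply: circle_contM; first by apply: circle_cont_holo => //; exact: ltW.
  exact: circle_cont_cauchy.
move=> w ws; rewrite !cabsM cabsV ws mulrC.
have d0 : 0 < s - cabs z by rewrite subr_gt0.
have h : s - cabs z <= cabs (w - z) by rewrite -{1}ws cabs_dist.
apply: ler_pM; rewrite ?cabs_ge0 ?fM //.
  by rewrite divr_ge0 ?cabs_ge0 // ltW.
by rewrite ler_wpM2l ?(ltW s0) // lef_pV2 // posrE (lt_le_trans d0).
Qed.

(* The constant in the Cauchy estimate disappears when it is applied to the
   powers of [f]. *)
Lemma max_principle f z s M : holo f -> cabs z <= s -> s < 1 ->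
  (forall w, cabs w = s -> cabs (f w) <= M) -> cabs (f z) <= M.
Proof.
move=> fd; rewrite le_eqVlt => /predU1P[<- _|zs s1 fM]; first by apply.
have s0 : 0 < s := le_lt_trans (cabs_ge0 z) zs.
have M0 : 0 <= M.
  apply: le_trans (cabs_ge0 _) (fM (toCx s) _); by rewrite cabs_toCx ger0_norm ?ltW.
apply: (@ler_expn_const _ _ (s / (s - cabs z))); rewrite ?cabs_ge0 // => n.
rewrite -cabsX; apply: (@cauchy_le (fun w => f w ^+ n) z s (M ^+ n)) => //.
  by move=> w dw; apply: cdbX; exact: fd.
by move=> w ws; rewrite cabsX; apply: lerXn2r; rewrite ?nnegrE ?cabs_ge0 ?fM.
Qed.

(** The difference of the Cauchy kernels at [w] and at [r w] contains the factor 1 - r. Hence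
    dilations with r near 1 are close to [f] on |w| <= rho, uniformly over a family bounded by [M]
    on |v| = s. *)
Lemma cauchy_lip f w r rho s M : holo f -> cabs w <= rho -> rho < s -> s < 1 ->
  0 <= r -> r <= 1 -> (forall v, cabs v = s -> cabs (f v) <= M) ->
  cabs (f w - f (toCx r * w)) <= M * ((1 - r) / (s - rho) ^+ 2).
Proof.
move=> fd wrho rhos s1 r0 r1 fM.
have s0 : 0 < s := le_lt_trans (cabs_ge0 w) (le_lt_trans wrho rhos).
have ws : cabs w < s := le_lt_trans wrho rhos.
have rw : cabs (toCx r * w) <= cabs w.
  by rewrite cabsM cabs_toCx ger0_norm // ler_piMl ?cabs_ge0.
have rws : cabs (toCx r * w) < s := le_lt_trans rw ws.
have fc := circle_cont_holo (ltW s0) s1 fd.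
have c1 := circle_contM fc (circle_cont_cauchy ws).
have c2 := circle_contM fc (circle_cont_cauchy rws).
rewrite -(cauchy_formula ws s1 fd) -(cauchy_formula rws s1 fd) -[X in _ + X]mulN1r -(cmeanZ _ c2) -(cmeanD c1); last first.
  by apply: circle_contM; [exact: circle_cont_cst|exact: c2].
apply: cabs_cmean; first exact: ltW.
  by apply: (circle_contD c1); apply: circle_contM; [exact: circle_cont_cst|exact: c2].
move=> v vs; have n1 := circle_sub_neq0 ws vs; have n2 := circle_sub_neq0 rws vs.
have -> : f v * (v / (v - w)) + -1 * (f v * (v / (v - toCx r * w))) =
  f v * (toCx (1 - r) * (v * w / ((v - w) * (v - toCx r * w)))).
  by rewrite toCxB toCx1; field; rewrite n1 n2.
rewrite cabsM; apply: ler_pM; rewrite ?cabs_ge0 ?fM // cabsM cabs_toCx.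
rewrite ger0_norm ?subr_ge0 //; apply: ler_wpM2l; first by rewrite subr_ge0.
rewrite !cabsM cabsV cabsM.
have d0 : 0 < s - rho by rewrite subr_gt0.
have h1 : s - rho <= cabs (v - w).
  by apply: le_trans (cabs_dist _ _); rewrite vs; lra.
have h2 : s - rho <= cabs (v - toCx r * w).
  by apply: le_trans (cabs_dist _ _); rewrite vs; lra.
rewrite -[X in _ <= X]mul1r; apply: ler_pM.
- by rewrite mulr_ge0 ?cabs_ge0.
- by rewrite invr_ge0 mulr_ge0 ?cabs_ge0.
- by rewrite vs; have := cabs_ge0 w; nra.
- rewrite lef_pV2 ?posrE ?exprn_gt0 //; last by rewrite mulr_gt0 // (lt_le_trans d0).
  by rewrite expr2; apply: ler_pM => //; exact: ltW.
Qed.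

Definition taylor_coef s k f : Cx R := cmean (fun w => w ^- k * f w) s.

Lemma taylor_cont s k f : 0 < s -> s < 1 -> holo f -> circle_cont (fun w => w ^- k * f w) s.
Proof.
move=> s0 s1 fd; apply: circle_cont_cdb => [|w ws]; first exact: ltW.
apply: cdbM; last by apply: fd; rewrite /disc /= ws.
apply: cdbV; last exact/cdbX/cdb_id.
by rewrite expf_neq0 // -cabs_gt0 ws.
Qed.

Lemma taylor_coef_linear s k (a : Cx R) f g : 0 < s -> s < 1 -> holo f -> holo g ->
  taylor_coef s k (fun w => a * f w + g w) = a * taylor_coef s k f + taylor_coef s k g.
Proof.
move=> s0 s1 fd gd; rewrite /taylor_coef.
have cf := @taylor_cont s k f s0 s1 fd; have cg := @taylor_cont s k g s0 s1 gd.
rewrite -(cmeanZ _ cf) -cmeanD; [|by apply: circle_contM; [exact: circle_cont_cst|exact: cf]|exact: cg].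
apply: eq_cmean; first exact: ltW.
by move=> w _; rewrite mulrDr mulrCA.
Qed.

Lemma taylor_coef_le s k f M : 0 < s -> s < 1 -> holo f ->
  (forall v, cabs v = s -> cabs (f v) <= M) -> cabs (taylor_coef s k f) <= s ^- k * M.
Proof.
move=> s0 s1 fd fM; apply: cabs_cmean; [exact: ltW|exact: taylor_cont|].
move=> w ws; rewrite cabsM cabsV cabsX ws; apply: ler_wpM2l; last exact: fM.
by rewrite invr_ge0 exprn_ge0 // ltW.
Qed.

(** The Cauchy kernel w / (w - z) is the sum of (z / w)^k for k < m plus (z / w)^m w / (w - z). The
    remainder is the mean of [f] against the last term, and the induction on [m] splits off one
    power at a time. *)
Lemma taylor_remainder f z rho s M m : holo f -> cabs z <= rho -> rho < s -> s < 1 ->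
  (forall v, cabs v = s -> cabs (f v) <= M) ->
  cabs (f z - \sum_(k < m) taylor_coef s k f * z ^+ k) <= M * ((rho / s) ^+ m / (s - rho)).
Proof.
move=> fd zrho rhos s1 fM.
have zs : cabs z < s := le_lt_trans zrho rhos.
have s0 : 0 < s := le_lt_trans (cabs_ge0 z) zs.
have fc := circle_cont_holo (ltW s0) s1 fd.
have nz w : cabs w = s -> w != 0 by move=> ws; rewrite -cabs_gt0 ws.
have remc : circle_cont (fun w => f w * ((z / w) ^+ m * (w / (w - z)))) s.
  apply: (circle_contM fc); apply: circle_contM; last exact: circle_cont_cauchy.
  apply: circle_cont_cdb => [|w ws]; first exact: ltW.
  apply: cdbX; apply: cdbM; first exact: cdb_cst.
  by apply: cdbV; [exact: nz|exact: cdb_id].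
suff E : f z - \sum_(k < m) taylor_coef s k f * z ^+ k =
    cmean (fun w => f w * ((z / w) ^+ m * (w / (w - z)))) s.
  rewrite E; apply: cabs_cmean => [||w ws]; [exact: ltW|exact: remc|].
  rewrite cabsM; apply: ler_pM; rewrite ?cabs_ge0 ?fM //.
  have d0 : 0 < s - rho by rewrite subr_gt0.
  have h : s - rho <= cabs (w - z).
    by apply: le_trans (cabs_dist _ _); rewrite ws; lra.
  rewrite cabsM; apply: ler_pM; rewrite ?cabs_ge0 //.
    rewrite cabsX cabsM cabsV ws; apply: lerXn2r; rewrite ?nnegrE ?mulr_ge0 ?cabs_ge0 //.
    - by rewrite invr_ge0 ltW.
    - exact: le_trans (cabs_ge0 _) zrho.
    - by rewrite invr_ge0 ltW.
    - by apply: ler_wpM2r => //; rewrite invr_ge0 ltW.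
  rewrite cabsM cabsV ws -[X in _ <= X]mul1r; apply: ler_pM.
  - exact: ltW.
  - by rewrite invr_ge0 cabs_ge0.
  - exact: ltW.
  - by rewrite lef_pV2 // posrE (lt_le_trans d0).
apply/eqP; rewrite subr_eq; apply/eqP.
elim: m remc => [|m IH] remc.
  rewrite big_ord0 addr0 -[LHS](cauchy_formula zs s1 fd); apply: eq_cmean; first exact: ltW.
  by move=> w ws; rewrite expr0 mul1r.
have remc' : circle_cont (fun w => f w * ((z / w) ^+ m * (w / (w - z)))) s.
  apply: (circle_contM fc); apply: circle_contM; last exact: circle_cont_cauchy.
  apply: circle_cont_cdb => [|w ws]; first exact: ltW.
  apply: cdbX; apply: cdbM; first exact: cdb_cst.
  by apply: cdbV; [exact: nz|exact: cdb_id].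
rewrite {1}(IH remc') big_ord_recr /= [\sum_(k < m) _ + _]addrC addrA; congr (_ + _).
rewrite mulrC /taylor_coef -cmeanZ; last exact: taylor_cont.
rewrite -(cmeanD remc); last first.
  by apply: circle_contM; [exact: circle_cont_cst|exact: taylor_cont].
apply: eq_cmean; first exact: ltW.
move=> w ws; have w0 := nz w ws; have n1 := circle_sub_neq0 zs ws.
have -> : z ^+ m * (w ^- m * f w) = f w * (z / w) ^+ m.
  by rewrite exprMn exprVn mulrA mulrC.
rewrite exprSr -mulrA -mulrDr; congr (_ * _).
by rewrite -mulrA -[X in _ = _ + X]mulr1 -mulrDr; congr (_ * _); field; rewrite w0 n1.
Qed.

End CauchyEstimates.

(** * Deformation of the path of integration *)

Section Phi.
Variable R : realType.
Implicit Types (x y e s r t rho M : R) (z w : Cx R) (f g : Cx R -> Cx R).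

(** The quantity [phi t (s z)] is a fractional linear function of [t] and also of [s], so this
    computation gives both partial derivatives of the homotopy. *)
Lemma cdiff_moebius (al be ga de w : Cx R) : ga * w + de != 0 ->
  cdiff (fun v => (al * v + be) / (ga * v + de)) w
    ((al * de - be * ga) / (ga * w + de) ^+ 2).
Proof.
set q := ga * w + de => q0 e e0.
have cq0 : 0 < cabs q by rewrite cabs_gt0.
have g0 : 0 < cabs ga + 1 by have := cabs_ge0 ga; lra.
pose A := (al * de - be * ga) * ga / q ^+ 3.
have kk := cabs_ge0 A.
have k0 : 0 < cabs A + 1 by lra.
(* The first radius keeps the denominator at [v] above half of [cabs q], so its quotient with [q]
   costs a factor 2. The second absorbs this factor and [cabs A]. *)
exists (Num.min (cabs q / (2 * (cabs ga + 1))) (e / (2 * (cabs A + 1)))).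
  by rewrite lt_min !divr_gt0 // mulr_gt0.
move=> v; rewrite lt_min => /andP[v1 v2].
have hq : ga * v + de = q + ga * (v - w) by rewrite /q; ring.
have B : cabs (ga * (v - w)) <= cabs q / 2.
  rewrite cabsM; move: v1; rewrite ltr_pdivlMr ?mulr_gt0 // => v1.
  have := cabs_ge0 (v - w); nra.
have lq : cabs q / 2 <= cabs (ga * v + de).
  rewrite hq; have := cabs_dist q (- (ga * (v - w))); rewrite cabsN opprK.
  lra.
have qv : ga * v + de != 0.
  by rewrite -cabs_gt0 (lt_le_trans _ lq) // divr_gt0.
have -> : (al * v + be) / (ga * v + de) - (al * w + be) / q
   - (al * de - be * ga) / q ^+ 2 * (v - w) =
   - A * (q / (ga * v + de)) * (v - w) * (v - w).
  by rewrite /A /q in q0 *; field; rewrite q0 qv.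
have gen (A1 B1 D1 : Cx R) : cabs (- A1 * B1 * D1 * D1) = cabs A1 * cabs B1 * cabs D1 * cabs D1.
  by rewrite !cabsM cabsN.
rewrite gen; apply: ler_wpM2r; first exact: cabs_ge0.
have Q : cabs (q / (ga * v + de)) <= 2.
  rewrite cabsM cabsV ler_pdivrMr ?cabs_gt0 //; lra.
have Q0 := cabs_ge0 (q / (ga * v + de)).
move: v2; rewrite ltr_pdivlMr ?mulr_gt0 // => v2.
have v0 := cabs_ge0 (v - w).
have := ler_pM kk Q0 (lexx (cabs A)) Q; nra.
Qed.

Definition phiq (t : R) (z : Cx R) : Cx R := (toCx t - 1) * z + 1.

Definition dphi t z : Cx R := (1 - z) / phiq t z ^+ 2.

Lemma TtE K t z : Tt K t z = K z (phi t z) * dphi t z.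
Proof. by []. Qed.

Lemma cabs_phiq_ge t z : 0 <= t -> t <= 1 -> 1 - (1 - t) * cabs z <= cabs (phiq t z).
Proof.
move=> t0 t1; rewrite /phiq.
have -> : (toCx t - 1) * z + 1 = 1 - toCx (1 - t) * z by rewrite toCxB toCx1; ring.
apply: le_trans (cabs_dist _ _).
by rewrite cabs1 cabsM cabs_toCx ger0_norm ?subr_ge0.
Qed.

Lemma cabs_phiq_gt t z : 0 <= t -> t <= 1 -> cabs z < 1 -> 0 < cabs (phiq t z).
Proof.
move=> t0 t1 z1; apply: lt_le_trans (cabs_phiq_ge z t0 t1).
by have := cabs_ge0 z; nra.
Qed.

Lemma phiq_neq0 t z : 0 <= t -> t <= 1 -> cabs z < 1 -> phiq t z != 0.
Proof. by move=> t0 t1 z1; rewrite -cabs_gt0 cabs_phiq_gt. Qed.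

Lemma cabs_phiE t z : 0 <= t -> cabs (phi t z) = t / cabs (phiq t z).
Proof. by move=> t0; rewrite /phi cabsM cabsV cabs_toCx ger0_norm. Qed.

Lemma cabs_phi_le1 t z : 0 <= t -> t <= 1 -> cabs z < 1 -> cabs (phi t z) <= 1.
Proof.
move=> t0 t1 z1; rewrite cabs_phiE // ler_pdivrMr ?cabs_phiq_gt // mul1r.
apply: le_trans (cabs_phiq_ge z t0 t1); have := cabs_ge0 z; nra.
Qed.

Lemma disc_phi t z : 0 < t -> t < 1 -> disc R z -> disc R (phi t z).
Proof.
move=> t0 t1 z1; have z0 := cabs_ge0 z; rewrite /disc /= in z1 *.
rewrite cabs_phiE ?ltW // ltr_pdivrMr ?cabs_phiq_gt ?(ltW t0) ?(ltW t1) // mul1r.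
apply: lt_le_trans (cabs_phiq_ge z (ltW t0) (ltW t1)); nra.
Qed.

Lemma rdiff_phi z t : phiq t z != 0 -> rdiff (fun s => phi s z) t (dphi t z).
Proof.
move=> q0.
have E : z * toCx t + (1 - z) = phiq t z by rewrite /phiq; ring.
have := @cdiff_moebius 1 0 z (1 - z) (toCx t); rewrite E => /(_ q0) /cdiff_rdiff.
rewrite mul1r mul0r subr0.
congr (rdiff _ _ _); apply/funext => s; rewrite /comp mul1r addr0 /phi; congr (_ / _); ring.
Qed.

Lemma rdiff_phi_ray z t s : phiq t (toCx s * z) != 0 ->
  rdiff (fun s => phi t (toCx s * z)) s (toCx t * (1 - toCx t) * z / phiq t (toCx s * z) ^+ 2).
Proof.
move=> q0.
have E : (toCx t - 1) * z * toCx s + 1 = phiq t (toCx s * z) by rewrite /phiq; ring.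
have := @cdiff_moebius 0 (toCx t) ((toCx t - 1) * z) 1 (toCx s); rewrite E => /(_ q0) /cdiff_rdiff.
have -> : 0 * 1 - toCx t * ((toCx t - 1) * z) = toCx t * (1 - toCx t) * z by ring.
congr (rdiff _ _ _); apply/funext => v; rewrite /comp mul0r add0r /phi; congr (_ / _); ring.
Qed.

Lemma ccont_phiq z t : ccont (phiq^~ z) t.
Proof.
apply: rdiff_cont (_ : rdiff _ _ (z * 1 + 0)).
have -> : phiq^~ z = (fun s => z * toCx s + (1 - z)).
  by apply/funext => s; rewrite /phiq; ring.
by apply: rdiffD; [exact/rdiffZ/rdiff_toCx|exact: rdiff_cst].
Qed.

Lemma ccont_toCx x : ccont (@toCx R) x.
Proof. exact: rdiff_cont (rdiff_toCx x). Qed.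

Lemma ccontV (f : R -> Cx R) x : f x != 0 -> ccont f x -> ccont (fun s => (f s)^-1) x.
Proof.
move=> f0 fc.
have [d hd] : cdb (fun w => w^-1) (f x) by apply: cdbV => //; exact: cdb_id.
exact: (@ccont_comp _ (fun w => w^-1) f x d fc hd).
Qed.

Lemma ccont_dphi z t : phiq t z != 0 -> ccont (fun s => dphi s z) t.
Proof.
move=> q0; apply: ccontM; first exact: ccont_cst.
apply: (@ccontV (fun s => phiq s z ^+ 2)); first by rewrite expf_neq0.
have -> : (fun s => phiq s z ^+ 2) = (fun s => phiq s z * phiq s z).
  by apply/funext => s; rewrite expr2.
by apply: ccontM; exact: ccont_phiq.
Qed.

Lemma ccont_measurable (f : R -> Cx R) (a b : R) :
  (forall x, a < x < b -> ccont f x) ->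
  measurable_fun (`]a, b[ : set (measurableTypeR R)) (fun x => complex.Re (f x)) /\
  measurable_fun (`]a, b[ : set (measurableTypeR R)) (fun x => complex.Im (f x)).
Proof.
move=> fc; split; apply: open_continuous_measurable_fun; try exact: interval_open.
  by move=> x; rewrite inE /= in_itv /= => /fc fx; exact: cvg_ReC.
by move=> x; rewrite inE /= in_itv /= => /fc fx; exact: cvg_ImC.
Qed.

Lemma cintegral_dominated_cont (a b : R) (F : nat -> R -> Cx R) (f : R -> Cx R)
    (h : R -> \bar R) :
  (forall n t, a < t < b -> ccont (F n) t) -> (forall t, a < t < b -> ccont f t) ->
  (@lebesgue_measure R).-integrable `]a, b[ h ->
  (forall n t, a < t < b -> ((cabs (F n t))%:E <= h t)%E) ->
  (forall t, a < t < b -> F n t @[n --> \oo] --> f t) ->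
  cintegral `]a, b[ (F n) @[n --> \oo] --> cintegral `]a, b[ f.
Proof.
move=> Fc fc hi Fh Ff.
have mI : measurable (`]a, b[ : set (measurableTypeR R)) by [].
have m1 n := ccont_measurable (Fc n).
have m2 := ccont_measurable fc.
apply: (@cintegral_dominated R `]a, b[ F f h mI (fun n => (m1 n).1) (fun n => (m1 n).2)
  m2.1 m2.2 hi).
  by move=> n t; rewrite /= in_itv /=; exact: Fh.
by move=> t; rewrite /= in_itv /=; exact: Ff.
Qed.

Lemma cintegral_oo_cc (a b : R) (f : R -> Cx R) : cintegrable `[a, b] f ->
  cintegral `]a, b[ f = cintegral `[a, b] f.
Proof.
move=> [f1 f2].
have S (g : R -> R) : (@lebesgue_measure R).-integrable `[a, b] (fun x => (g x)%:E) ->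
    Rintegral (@lebesgue_measure R) `]a, b[ g = Rintegral (@lebesgue_measure R) `[a, b] g.
  move=> gi.
  rewrite -(@Rintegral_itv_obnd_cbnd _ a (BRight b)) /=; last first.
    by apply: integrableS gi => //; exact: subset_itv_oc_cc.
  rewrite -(@Rintegral_itv_bndo_bndc _ (BRight a)) //=.
  by apply: integrableS gi => //; exact: subset_itv_oo_cc.
by apply: CxP => /=; apply: S.
Qed.

Lemma integrable_cst01 (M : R) :
  (@lebesgue_measure R).-integrable `]0%R, 1%R[ (fun=> M%:E).
Proof.
apply: (@integrableS _ _ R (@lebesgue_measure R) `[0%R, 1%R] `]0%R, 1%R[ (fun=> M%:E)) => //.
  exact: subset_itv_oo_cc.
apply: continuous_compact_integrable; first exact: segment_compact.
by apply: continuous_subspaceT => x; exact: cvg_cst.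
Qed.

Lemma cabs_dphi_le z t : 0 <= t -> t <= 1 -> disc R z ->
  cabs (dphi t z) <= 2 / (1 - cabs z) ^+ 2.
Proof.
rewrite /disc /= => t0 t1 z1; rewrite /dphi cabsM cabsV cabsX.
have z0 := cabs_ge0 z.
have q1 : 1 - cabs z <= cabs (phiq t z).
  by apply: le_trans (cabs_phiq_ge z t0 t1); nra.
apply: ler_pM; rewrite ?cabs_ge0 ?invr_ge0 ?exprn_ge0 ?cabs_ge0 //.
  by apply: le_trans (cabsB _ _) _; rewrite cabs1; lra.
rewrite lef_pV2 ?posrE ?exprn_gt0 ?subr_gt0 ?cabs_phiq_gt //.
by apply: lerXn2r; rewrite ?nnegrE ?cabs_ge0 // subr_ge0 ltW.
Qed.

(* The segment is deformed into the curve [phi t z] through [phi t (s z)];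
   the end points are fixed. *)
Lemma deform_in G z : disc R z -> (forall w, cabs w <= 1 -> cdb G w) ->
  cintegral `[0, 1] (fun t => G (toCx t)) =
  cintegral `[0, 1] (fun t => G (phi t z) * dphi t z).
Proof.
move=> z1 Gd.
pose H t s := phi t (toCx s * z).
pose Ht t s := dphi t (toCx s * z).
pose Hs t s := toCx t * (1 - toCx t) * z / phiq t (toCx s * z) ^+ 2.
pose inQ t s := (0 <= t <= 1) && (0 <= s <= 1) : bool.
have sz t s : inQ t s -> cabs (toCx s * z) <= cabs z.
  move=> /and3P[_ s0 s1].
  by rewrite cabsM cabs_toCx ger0_norm // ler_piMl ?cabs_ge0.
have sz1 t s : inQ t s -> disc R (toCx s * z) by move=> h; exact: le_lt_trans (sz _ _ h) z1.
have qn t s : inQ t s -> phiq t (toCx s * z) != 0.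
  by move=> h; have /andP[/andP[t0 t1] _] := h; apply: phiq_neq0 => //; exact: sz1 h.
set C := 2 / (1 - cabs z) ^+ 2.
have Hdd t s : inQ t s -> rdiff (H^~ s) t (Ht t s) by move=> /qn; exact: rdiff_phi.
have Hsd t s : inQ t s -> rdiff (H t) s (Hs t s) by move=> /qn; exact: rdiff_phi_ray.
have Htc t s : inQ t s -> ccont (Ht^~ s) t by move=> /qn; exact: ccont_dphi.
have cray t s : ccont (fun v => phiq t (toCx v * z)) s.
  apply: ccontD; last exact: ccont_cst.
  apply: ccontM; first exact: ccont_cst.
  by apply: ccontM; [exact: ccont_toCx|exact: ccont_cst].
have Hsc t s : inQ t s -> ccont (Hs t) s.
  move=> /qn q0; apply: ccontM; first exact: ccont_cst.
  apply: (@ccontV (fun v => phiq t (toCx v * z) ^+ 2)); first by rewrite expf_neq0.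
  have -> : (fun v => phiq t (toCx v * z) ^+ 2) =
     (fun v => phiq t (toCx v * z) * phiq t (toCx v * z)).
    by apply/funext => v; rewrite expr2.
  by apply: ccontM; exact: cray.
have d0 : 0 < 1 - cabs z by rewrite subr_gt0.
have HtC t s : inQ t s -> cabs (Ht t s) <= C.
  move=> h; have /andP[/andP[t0 t1] _] := h.
  apply: le_trans (cabs_dphi_le t0 t1 (sz1 _ _ h)) _.
  rewrite /C; apply: ler_wpM2l => //; have := sz _ _ h; have := sz1 _ _ h; rewrite /disc /= => h1 h2.
  rewrite lef_pV2 ?posrE ?exprn_gt0 // ?subr_gt0 //.
  by apply: lerXn2r; rewrite ?nnegrE; lra.
have HsC t s : inQ t s -> cabs (Hs t s) <= C.
  move=> h; have /andP[/andP[t0 t1] _] := h.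
  have q1 := cabs_phiq_ge (toCx s * z) t0 t1.
  have := sz _ _ h; have := sz1 _ _ h; rewrite /disc /= => h1 h2.
  have q2 : 1 - cabs z <= cabs (phiq t (toCx s * z)).
    by apply: le_trans q1; have := cabs_ge0 (toCx s * z); nra.
  rewrite /Hs /C cabsM cabsV cabsX; apply: ler_pM.
  - exact: cabs_ge0.
  - by rewrite invr_ge0 exprn_ge0 // cabs_ge0.
  - rewrite !cabsM -toCx1 -toCxB !cabs_toCx !ger0_norm ?subr_ge0 //.
    have z0 := cabs_ge0 z; have : t * (1 - t) <= 1 by nra.
    have : 0 <= t * (1 - t) by rewrite mulr_ge0 ?subr_ge0.
    rewrite /disc /= in z1; nra.
  - rewrite lef_pV2 ?posrE ?exprn_gt0 //; last by rewrite (lt_le_trans d0).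
    by apply: lerXn2r; rewrite ?nnegrE ?cabs_ge0 // ltW.
have GH t s : inQ t s -> exists k, cdiff G (H t s) k.
  move=> h; have /andP[/andP[t0 t1] _] := h.
  by apply: Gd; apply: cabs_phi_le1 => //; exact: sz1 h.
have := @goursat R 0 1 0 1 H Ht Hs G C ler01 ler01 Hdd Hsd Htc Hsc HtC HsC GH.
have e1 : (fun x => G (H x 0) * Ht x 0) = (fun t => G (toCx t)).
  apply/funext => t; rewrite /H /Ht /phi /dphi /phiq toCx0 mul0r mulr0 add0r subr0.
  by rewrite expr1n !divr1 mulr1.
have e2 : (fun x => G (H x 1) * Ht x 1) = (fun t => G (phi t z) * dphi t z).
  by apply/funext => t; rewrite /H /Ht toCx1 mul1r.
have e3 : (fun y => G (H 1 y) * Hs 1 y) = (fun=> 0).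
  by apply/funext => t; rewrite /Hs toCx1 subrr mulr0 !mul0r mulr0.
have e4 : (fun y => G (H 0 y) * Hs 0 y) = (fun=> 0).
  by apply/funext => t; rewrite /Hs toCx0 !mul0r mulr0.
rewrite e1 e2 e3 e4 cintegral_cst ?ler01 // mul0r addr0 subr0 => /eqP.
by rewrite subr_eq0 => /eqP.
Qed.

(** The shift by 2 keeps every term strictly between 0 and 1, including the one at [n = 0]. *)
Lemma seq_to1 (n : nat) : 0 < (1 - n.+2%:R^-1 : R) < 1.
Proof.
by rewrite subr_gt0 ltrBlDr ltrDl invr_gt0 ltr0n invf_lt1 ?ltr0n // ltr1n.
Qed.

Lemma cvg_seq_to1 : (1 - n.+2%:R^-1 : R) @[n --> \oo] --> (1 : R).
Proof.
rewrite -[X in _ --> X]subr0; apply: cvgB; first exact: cvg_cst.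
have := @cvg_harmonic R; rewrite -cvg_shiftS; exact.
Qed.

Lemma cdb_dilate f r w : cdb f (toCx r * w) -> cdb (fun v => f (toCx r * v)) w.
Proof.
move=> h; apply: (@cdb_comp _ f (fun v => toCx r * v)) => //.
by apply: cdbM; [exact: cdb_cst|exact: cdb_id].
Qed.

Lemma cvg_dilate f w : cdb f w ->
  f (toCx (1 - n.+2%:R^-1) * w) @[n --> \oo] --> f w.
Proof.
move=> [d /cdiff_cont fc].
have h : toCx (1 - n.+2%:R^-1) * w @[n --> \oo] --> w.
  rewrite -[X in _ --> X]mul1r -toCx1.
  apply: (@cvgM (Cx R)); last exact: cvg_cst.
  exact: (cvg_toCx _ cvg_seq_to1).
exact: (cvg_comp _ _ h fc).
Qed.

(** Every curve ends at 1, where [f] may be singular. The dilations of [f] are differentiable on the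
    closed disc, so [deform_in] applies to them, and [M] dominates both sides up to the bound on
    [dphi] while the radius tends to 1. *)
Lemma deform_bounded f z M : disc R z -> holo f ->
  (forall w, disc R w -> cabs (f w) <= M) ->
  cintegral `]0, 1[ (fun t => f (toCx t)) =
  cintegral `]0, 1[ (fun t => f (phi t z) * dphi t z).
Proof.
move=> z1 fd fM.
pose rho n : R := 1 - n.+2%:R^-1.
have rho_disc n w : cabs w <= 1 -> disc R (toCx (rho n) * w).
  move=> w1; have /andP[r0 r1] := seq_to1 n; rewrite /disc /= cabsM cabs_toCx ger0_norm ?ltW //.
  by rewrite -/(rho n) in r0 r1 *; have := cabs_ge0 w; nra.
have E n : cintegral `]0, 1[ (fun t => f (toCx (rho n) * toCx t)) =
    cintegral `]0, 1[ (fun t => f (toCx (rho n) * phi t z) * dphi t z).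
  pose G w := f (toCx (rho n) * w).
  have Gd w : cabs w <= 1 -> cdb G w by move=> w1; exact/cdb_dilate/fd/rho_disc.
  have := deform_in z1 Gd.
  rewrite -!cintegral_oo_cc //.
    apply: cintegrable_cont => t /andP[t0 t1].
    have q0 := phiq_neq0 t0 t1 z1.
    apply: cont_pullback; [apply: Gd; exact: cabs_phi_le1| |exact: ccont_dphi].
    by exists (dphi t z); exact: rdiff_phi.
  apply: cintegrable_cont => t /andP[t0 t1].
  have [k hk] : cdb G (toCx t) by apply: Gd; rewrite cabs_toCx ger0_norm.
  exact: (@ccont_comp _ G (@toCx R) t k (@ccont_toCx t) hk).
have dt t : 0 < t < 1 -> disc R (toCx t).
  by move=> /andP[t0 t1]; rewrite /disc /= cabs_toCx ger0_norm // ltW.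
have dphit t : 0 < t < 1 -> disc R (phi t z) by move=> /andP[t0 t1]; exact: disc_phi.
have q0 t : 0 < t < 1 -> phiq t z != 0 by move=> /andP[/ltW t0 /ltW t1]; exact: phiq_neq0.
have cf g t : cdb g (toCx t) -> ccont (fun s => g (toCx s)) t.
  by move=> [k hk]; exact: (@ccont_comp _ g (@toCx R) t k (@ccont_toCx t) hk).
have cg g t : 0 < t < 1 -> cdb g (phi t z) -> ccont (fun s => g (phi s z) * dphi s z) t.
  move=> t01 gd; apply: cont_pullback => //; last exact: ccont_dphi (q0 t t01).
  by exists (dphi t z); exact: rdiff_phi (q0 t t01).
have fdn n w : cabs w <= 1 -> cdb (fun v => f (toCx (rho n) * v)) w.
  by move=> w1; exact/cdb_dilate/fd/rho_disc.
have M0 : 0 <= M by apply: le_trans (cabs_ge0 _) (fM 0 _); rewrite /disc /= cabs0.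
have L1 : cintegral `]0, 1[ (fun t => f (toCx (rho n) * toCx t)) @[n --> \oo] -->
    cintegral `]0, 1[ (fun t => f (toCx t)).
  apply: (cintegral_dominated_cont _ _ (integrable_cst01 M)).
  - by move=> n t h; exact: (cf _ t (fdn n _ (ltW (dt t h)))).
  - by move=> t h; exact: (cf _ t (fd _ (dt t h))).
  - move=> n t t01; rewrite lee_fin; apply: fM; apply: rho_disc; exact: ltW (dt t t01).
  - move=> t t01; apply: cvg_dilate; exact: (fd _ (dt t t01)).
have L2 : cintegral `]0, 1[ (fun t => f (toCx (rho n) * phi t z) * dphi t z) @[n --> \oo] -->
    cintegral `]0, 1[ (fun t => f (phi t z) * dphi t z).
  apply: (cintegral_dominated_cont _ _ (integrable_cst01 (M * (2 / (1 - cabs z) ^+ 2)))).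
  - by move=> n t h; exact: (cg (fun w => f (toCx (rho n) * w)) t h (fdn n _ (ltW (dphit t h)))).
  - by move=> t h; exact: (cg f t h (fd _ (dphit t h))).
  - move=> n t t01; rewrite lee_fin cabsM.
    apply: ler_pM; rewrite ?cabs_ge0 //; first by apply/fM/rho_disc/ltW/dphit.
    by case/andP: t01 => [t0 t1]; apply: cabs_dphi_le => //; exact: ltW.
  - move=> t t01; apply: (@cvgM (Cx R)); last exact: cvg_cst.
    by apply: cvg_dilate; exact/fd/dphit.
have E' : (fun n => cintegral `]0, 1[ (fun t => f (toCx (rho n) * toCx t))) =
    (fun n => cintegral `]0, 1[ (fun t => f (toCx (rho n) * phi t z) * dphi t z)).
  by apply/funext.
rewrite E' in L1.
exact: (cvg_unique _ L1 L2).
Qed.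

End Phi.

(** * Measurability of suprema and comparison of integrals *)

Section Measurability.
Variable R : realType.
Implicit Types (x y e s r t rho M : R) (z w : Cx R) (f g : Cx R -> Cx R).
Notation mu := (@lebesgue_measure R).

Definition rcont (q : R -> R) (x : R) : Prop := {for x, continuous q}.

Lemma rcont_cabs (f : R -> Cx R) x : ccont f x -> rcont (fun t => cabs (f t)) x.
Proof. exact: cvg_cabs. Qed.

Lemma rcontM (p q : R -> R) x : rcont p x -> rcont q x -> rcont (fun t => p t * q t) x.
Proof. exact: cvgM. Qed.

Lemma rcontV (p : R -> R) x : p x != 0 -> rcont p x -> rcont (fun t => (p t)^-1) x.
Proof. by move=> p0 pc; exact: cvgV. Qed.

Lemma rcont_cst (k : R) x : rcont (fun=> k) x.
Proof. exact: cvg_cst. Qed.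

Lemma open_setP (A : set R) : (forall x, A x -> nbhs x A) -> open A.
Proof. by move=> h; rewrite openE => x Ax; exact: h. Qed.

Lemma rcont_nbhs_gt (q : R -> R) x c : rcont q x -> c < q x -> nbhs x [set t | c < q t].
Proof. by move=> qc h; exact: (cvgr_gt (q x) qc c h). Qed.

Lemma rcont_nbhs_lt (q : R -> R) x c : rcont q x -> q x < c -> nbhs x [set t | q t < c].
Proof. by move=> qc h; exact: (cvgr_lt (q x) qc c h). Qed.

Lemma nbhs_itvoo (a b x : R) : a < x < b -> nbhs x [set` `]a, b[].
Proof. by move=> h; apply: near_in_itvoo; rewrite in_itv. Qed.

(* A supremum of functions with open superlevel sets is lower semicontinuous;
   the index set may be uncountable. *)
Lemma measurable_fun_sup (I : Type) (A : set I) (q : I -> R -> R) (a b : R) :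
  (forall i c, A i -> open [set t | a < t < b /\ c < q i t]) ->
  measurable_fun (`]a, b[ : set (measurableTypeR R))
    (fun t => ereal_sup [set (q i t)%:E | i in A]).
Proof.
move=> qo mI; apply: (measurability _ (ErealGenOInfty.measurableE R)) => //.
move=> /= _ [_ [c ->] <-].
rewrite preimage_itvoy.
have -> : (`]a, b[ `&` [set t | (c%:E < ereal_sup [set (q i t)%:E | i in A])%E]) =
    \bigcup_(i in A) [set t | a < t < b /\ c < q i t].
  apply/seteqP; split=> t /=; rewrite in_itv /=.
    move=> [tab /ereal_sup_gt[_ [i Ai <-]]]; rewrite lte_fin => h.
    by exists i.
  move=> [i Ai /= [tab h]]; split=> //.
  by apply: (@lt_le_trans _ _ (q i t)%:E); [rewrite lte_fin|apply: ereal_sup_ubound; exists i].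
by apply: open_measurable; apply: bigcup_open => i Ai; exact: qo.
Qed.

(** The integral of a nonnegative function is a supremum over the simple functions below it, so
    monotonicity holds without measurability. The suprema in [upper_cond1] and [upper_cond2], taken
    over index sets that vary with [t], can thus serve as upper bounds. *)
Lemma ge0_le_integral_nm (D : set (measurableTypeR R)) (f1 f2 : R -> \bar R) :
  (forall x, D x -> (0 <= f1 x)%E) -> (forall x, D x -> (f1 x <= f2 x)%E) ->
  (\int[mu]_(x in D) f1 x <= \int[mu]_(x in D) f2 x)%E.
Proof.
move=> f10 f12.
have f20 x : D x -> (0 <= f2 x)%E by move=> Dx; apply: le_trans (f10 x Dx) (f12 x Dx).
rewrite !ge0_integralE //=; apply: ereal_sup_le => _ [h hf <-].
exists h => // x; apply: le_trans (hf x) _.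
rewrite !patchE; case: ifPn => // /set_mem Dx; exact: f12.
Qed.

Lemma integrable_of_le (D : set (measurableTypeR R)) (f1 f2 : R -> \bar R) :
  measurable D -> measurable_fun D f1 ->
  (forall x, D x -> (0 <= f1 x)%E) -> (forall x, D x -> (f1 x <= f2 x)%E) ->
  (\int[mu]_(x in D) f2 x < +oo)%E -> mu.-integrable D f1.
Proof.
move=> mD mf f10 f12 fi; apply/integrableP; split => //.
have -> : (\int[mu]_(x in D) `|f1 x| = \int[mu]_(x in D) f1 x)%E.
  by apply: eq_integral => x /set_mem Dx; rewrite gee0_abs // f10.
by apply: le_lt_trans (ge0_le_integral_nm f10 f12) fi.
Qed.

End Measurability.

(** * Weighted spaces and the kernel *)

Section Weights.
Variables (R : realType) (u : Cx R -> R).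
Implicit Types (x y e s r t rho M C : R) (z w : Cx R) (f g : Cx R -> Cx R).

Definition ubd f C := forall z, disc R z -> cabs (f z) * u z <= C.

Lemma wnorm_leP f C : (wnorm u f <= C%:E)%E <-> ubd f C.
Proof.
split.
  by move=> /ereal_supP h z dz; rewrite -lee_fin; apply: h; exists z.
by move=> h; apply/ereal_supP => _ [z dz <-]; rewrite lee_fin; exact: h.
Qed.

Lemma wnorm_ub f z : disc R z -> ((cabs (f z) * u z)%:E <= wnorm u f)%E.
Proof. by move=> dz; apply: ereal_sup_ubound; exists z. Qed.

Hypothesis uw : weight u.

Let u0 := weight_gt0 uw.

Lemma disc0 : disc R 0.
Proof. by rewrite /disc /= cabs0. Qed.

Lemma wnorm_ge0 f : (0 <= wnorm u f)%E.
Proof.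
apply: le_trans (wnorm_ub f disc0).
by rewrite lee_fin mulr_ge0 ?cabs_ge0 // ltW // u0 //; exact: disc0.
Qed.

Lemma HinfP f : Hinf u f <-> holo f /\ exists2 C, 0 <= C & ubd f C.
Proof.
split.
  move=> [/analyticP fd fn]; split => //; exists (fine (wnorm u f)).
    by rewrite fine_ge0 // wnorm_ge0.
  by apply/wnorm_leP; rewrite fineK // ge0_fin_numE // wnorm_ge0.
move=> [fd [C C0 /wnorm_leP fC]]; split; first exact/analyticP.
by apply: le_lt_trans fC _; rewrite ltry.
Qed.

Lemma u_circle z s : disc R z -> cabs z = s -> u z = u (toCx s).
Proof. by move=> dz <-; exact: weight_radial. Qed.

Lemma disc_toCx s : 0 <= s -> s < 1 -> disc R (toCx s).
Proof. by move=> s0 s1; rewrite /disc /= cabs_toCx ger0_norm. Qed.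

Lemma u_real_gt0 s : 0 <= s -> s < 1 -> 0 < u (toCx s).
Proof. by move=> s0 s1; apply/u0/disc_toCx. Qed.

(** Since [u] is constant on |w| = s, the weighted bound is an unweighted one on that circle, and
    the maximum principle carries it inside. *)
Lemma ubd_growth f C s z : holo f -> ubd f C -> s < 1 -> cabs z <= s ->
  cabs (f z) <= C / u (toCx s).
Proof.
move=> fd fC s1 zs; have s0 : 0 <= s := le_trans (cabs_ge0 z) zs.
apply: (max_principle fd zs s1) => w ws.
rewrite ler_pdivlMr ?u_real_gt0 // -(@u_circle w) //; last by rewrite /disc /= ws.
by apply: fC; rewrite /disc /= ws.
Qed.

Lemma disc_dilate r z : 0 <= r -> r <= 1 -> disc R z -> disc R (toCx r * z).
Proof.
rewrite /disc /= => r0 r1 z1; rewrite cabsM cabs_toCx ger0_norm //.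
by have := cabs_ge0 z; nra.
Qed.

(** Dilations are contractions because [u] is radial: at [z] the dilated function is controlled by
    the values of [f] on the circle through [z], where the weight is the same. *)
Lemma ubd_dilate f C r : holo f -> ubd f C -> 0 <= r -> r <= 1 ->
  ubd (fun w => f (toCx r * w)) C.
Proof.
move=> fd fC r0 r1 z dz; set s := cabs z.
rewrite (u_circle dz (erefl s)) -ler_pdivlMr ?u_real_gt0 ?cabs_ge0 //.
apply: ubd_growth => //.
by rewrite cabsM cabs_toCx ger0_norm // ler_piMl ?cabs_ge0.
Qed.

Lemma holo_dilate f r : holo f -> 0 <= r -> r <= 1 -> holo (fun w => f (toCx r * w)).
Proof. by move=> fd r0 r1 z dz; apply/cdb_dilate/fd/disc_dilate. Qed.

Lemma near_left1P (P : R -> Prop) : (\forall r \near (1 : R)^'-, P r) <->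
  exists2 r0 : R, 0 <= r0 < 1 & forall r, r0 < r -> r < 1 -> P r.
Proof.
rewrite near_withinE; split.
  move=> /nbhs_ballP[e /= e0 h]; exists (Num.max 0 (1 - e)).
    by rewrite le_max lexx gt_max ltr01 /=; lra.
  move=> r; rewrite gt_max => /andP[r0 re] r1; apply: h => //.
  by rewrite /ball /= ger0_norm ?subr_ge0 ?ltW //; lra.
move=> [r0 /andP[_ r1] h]; apply/nbhs_ballP; exists (1 - r0) => /=; first by rewrite subr_gt0.
move=> r; rewrite /ball /= => hr r_lt1; apply: h => //.
by move: hr; rewrite ger0_norm ?subr_ge0 ?(ltW r_lt1) //; lra.
Qed.

Lemma disc_bdryP (A : set (Cx R)) : disc_bdry R A <->
  exists2 r0 : R, 0 <= r0 < 1 & forall z, r0 < cabs z -> disc R z -> A z.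
Proof.
rewrite /disc_bdry /=; split.
  move=> /near_left1P[r0 r01 h]; exists r0 => // z zr dz.
  exact: (h (cabs z)).
move=> [r0 r01 h]; apply/near_left1P; exists r0 => // r rr r1 z zr.
by apply: h; rewrite /disc /= zr.
Qed.

Lemma cvg_bdry0P (q : Cx R -> R) : (forall z, disc R z -> 0 <= q z) ->
  (q z @[z --> disc_bdry R] --> 0) <->
  forall e, 0 < e -> exists2 r0 : R, 0 <= r0 < 1 &
    forall z, r0 < cabs z -> disc R z -> q z < e.
Proof.
move=> q0; split.
  move=> qc e e0.
  have : nbhs (0 : R) (ball 0 e) by exact: nbhsx_ballx.
  move=> /qc /disc_bdryP[r0 r01 h]; exists r0 => // z zr dz.
  by have := h z zr dz; rewrite /ball /= sub0r normrN ger0_norm ?q0.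
move=> h A /nbhs_ballP[e /= e0 eA].
have [r0 r01 hr] := h e e0; apply/disc_bdryP; exists r0 => // z zr dz; apply: eA.
by rewrite /ball /= sub0r normrN ger0_norm ?q0 // hr.
Qed.

Lemma u_vanish e : 0 < e ->
  exists2 r0 : R, 0 <= r0 < 1 & forall z, r0 < cabs z -> disc R z -> u z < e.
Proof.
by apply: (proj1 (cvg_bdry0P (fun z dz => ltW (u0 dz)))); exact: weight_vanish.
Qed.

Lemma u_le1 z : disc R z -> u z <= 1.
Proof.
move=> dz; rewrite -lee_fin -(weight_sup uw); apply: ereal_sup_ubound; by exists z.
Qed.

Lemma HzeroP f : Hzero u f <-> Hinf u f /\ forall e, 0 < e ->
  exists2 r0 : R, 0 <= r0 < 1 & forall z, r0 < cabs z -> disc R z -> cabs (f z) * u z < e.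
Proof.
have q0 z : disc R z -> 0 <= cabs (f z) * u z.
  by move=> dz; rewrite mulr_ge0 ?cabs_ge0 // ltW // u0.
by split=> -[hf /(cvg_bdry0P q0)].
Qed.

End Weights.

(** * Dominating functions and the integral along the curves *)

Section Domination.
Variables (R : realType) (u : Cx R -> R) (K : Cx R -> Cx R -> Cx R).
Implicit Types (x y e s r t rho M C : R) (z w : Cx R) (f g : Cx R -> Cx R).
Notation mu := (@lebesgue_measure R).
Hypothesis uw : weight u.
Hypothesis Kd : analytic_disc2 K.

Let u0 := weight_gt0 uw.

Lemma kernel_holo z : disc R z -> holo (K z).
Proof.
move=> dz w dw; apply/cdbP.
have := @diff_derivable (Cx R) _ (Cx R) _ _ (0 : Cx R, 1 : Cx R) (Kd dz dw).
rewrite /derivable.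
set F1 := (fun h : Cx R => _); set F2 := (fun h : Cx R => _).
have -> // : F1 = F2.
by apply/funext => h; rewrite /F1 /F2 /= scaler0 add0r.
Qed.

Definition wratio t z := cabs (Tt K t z) * u z / u (phi t z).

Lemma wratio_ge0 t z : 0 < t < 1 -> disc R z -> 0 <= wratio t z.
Proof.
move=> /andP[t0 t1] dz; rewrite /wratio divr_ge0 ?mulr_ge0 ?cabs_ge0 ?(ltW (u0 _)) //.
exact: disc_phi.
Qed.

Lemma ccont_phi t z : 0 < t < 1 -> disc R z -> ccont (fun s => phi s z) t.
Proof.
move=> /andP[/ltW t0 /ltW t1] dz.
exact: rdiff_cont (rdiff_phi (phiq_neq0 t0 t1 dz)).
Qed.

Lemma ccont_Tt t z : 0 < t < 1 -> disc R z -> ccont (fun s => Tt K s z) t.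
Proof.
move=> t01 dz; have /andP[t0 t1] := t01.
have qn := phiq_neq0 (ltW t0) (ltW t1) dz.
apply: (cont_pullback (G := K z) (h := fun s => phi s z) (h' := fun s => dphi s z)).
- exact: (kernel_holo dz (disc_phi t0 t1 dz)).
- by exists (dphi t z); exact: rdiff_phi.
- exact: ccont_dphi.
Qed.

Lemma rcont_u_phi t z : 0 < t < 1 -> disc R z -> rcont (fun s => u (phi s z)) t.
Proof.
move=> t01 dz; have /andP[t0 t1] := t01.
have uc := weight_cont uw (disc_phi t0 t1 dz).
exact: (@continuous_comp _ _ _ (fun s => phi s z) u t (ccont_phi t01 dz) uc).
Qed.

Lemma rcont_wratio t z : 0 < t < 1 -> disc R z -> rcont (wratio^~ z) t.
Proof.
move=> t01 dz; have /andP[t0 t1] := t01.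
apply: rcontM.
  by apply: rcontM; [exact: rcont_cabs (ccont_Tt t01 dz)|exact: rcont_cst].
apply: (rcontV (p := fun s => u (phi s z))); last exact: rcont_u_phi.
by rewrite gt_eqF // u0 //; exact: disc_phi.
Qed.

(** The index set is the fixed disc, and the condition on [phi t z] is a strict inequality inside an
    [if]. Each superlevel set in [t] is then open, which [measurable_fun_sup] requires. *)
Definition gtS r t : \bar R := ereal_sup
  [set (if r < cabs (phi t z) then wratio t z else 0)%:E | z in disc R].

(** The inequality is strict for the same reason. Covering the points with [cabs (phi t z) <= r]
    therefore takes a larger radius, the [r'] of [dominated_split]. *)
Definition ltS r t : \bar R := ereal_sup
  [set (if cabs (phi t z) < r then cabs (Tt K t z) * u z else 0)%:E | z in disc R].

Lemma open_superlevel_if (b : R -> bool) (q : R -> R) (c : R) :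
  (forall t, 0 < t < 1 -> 0 <= q t) ->
  (forall t, 0 < t < 1 -> b t -> nbhs t [set s | b s]) ->
  (forall t, 0 < t < 1 -> rcont q t) ->
  open [set t | 0 < t < 1 /\ c < (if b t then q t else 0)].
Proof.
move=> q0 bo qc; apply: open_setP => t /= [t01 h].
have N01 : nbhs t [set s | 0 < s < 1].
  by apply: filterS (nbhs_itvoo t01) => s; rewrite /= in_itv.
have [c0|c0] := ltP c 0.
  apply: filterS N01 => s s01; split=> //.
  by case: ifP => // _; exact: lt_le_trans c0 (q0 _ s01).
move: h; case: ifPn => [bt h|_]; last by rewrite ltNge c0.
apply: filterS3 N01 (bo _ t01 bt) (rcont_nbhs_gt (qc _ t01) h) => s s01 /= bs h'.
by rewrite bs.
Qed.

Lemma measurable_gtS r : measurable_fun (`]0, 1[ : set (measurableTypeR R)) (gtS r).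
Proof.
apply: measurable_fun_sup => z c dz; apply: open_superlevel_if => t t01.
- exact: wratio_ge0.
- by apply: rcont_nbhs_gt; exact: rcont_cabs (ccont_phi t01 dz).
- exact: rcont_wratio.
Qed.

Lemma measurable_ltS r : measurable_fun (`]0, 1[ : set (measurableTypeR R)) (ltS r).
Proof.
apply: measurable_fun_sup => z c dz; apply: open_superlevel_if => t t01.
- by rewrite mulr_ge0 ?cabs_ge0 // ltW // u0.
- by apply: rcont_nbhs_lt; exact: rcont_cabs (ccont_phi t01 dz).
- by apply: rcontM; [exact: rcont_cabs (ccont_Tt t01 dz)|exact: rcont_cst].
Qed.

Lemma gtS_ge0 r t : 0 < t < 1 -> (0 <= gtS r t)%E.
Proof.
move=> t01; apply: le_ereal_sup_tmp.
exists (if r < cabs (phi t 0) then wratio t 0 else 0)%:E; first by exists 0 => //; exact: disc0.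
by rewrite lee_fin; case: ifP => // _; apply: wratio_ge0 => //; exact: disc0.
Qed.

Lemma ltS_ge0 r t : (0 <= ltS r t)%E.
Proof.
apply: le_ereal_sup_tmp.
exists (if cabs (phi t 0) < r then cabs (Tt K t 0) * u 0 else 0)%:E.
  by exists 0 => //; exact: disc0.
rewrite lee_fin; case: ifP => // _; rewrite mulr_ge0 ?cabs_ge0 // ltW // u0 //; exact: disc0.
Qed.

Lemma gtS_ub r t z : disc R z -> r < cabs (phi t z) -> ((wratio t z)%:E <= gtS r t)%E.
Proof. by move=> dz h; apply: ereal_sup_ubound; exists z => //; rewrite h. Qed.

Lemma ltS_ub r t z : disc R z -> cabs (phi t z) < r ->
  ((cabs (Tt K t z) * u z)%:E <= ltS r t)%E.
Proof. by move=> dz h; apply: ereal_sup_ubound; exists z => //; rewrite h. Qed.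

Lemma gtS_le r t (S : \bar R) : (0 <= S)%E ->
  (forall z, disc R z -> r < cabs (phi t z) -> ((wratio t z)%:E <= S)%E) -> (gtS r t <= S)%E.
Proof.
move=> S0 h; apply/ereal_supP => _ [z dz <-]; case: ifPn => // hz; exact: h.
Qed.

Lemma gtS_mono r r' t : 0 < t < 1 -> r <= r' -> (gtS r' t <= gtS r t)%E.
Proof.
move=> t01 rr; apply: gtS_le; first exact: gtS_ge0.
by move=> z dz h; apply: gtS_ub => //; exact: le_lt_trans h.
Qed.

Lemma preim_gtP t r z : preim_gt t r z <-> disc R z /\ r < cabs (phi t z).
Proof.
split.
  by move=> [dz [_ /negP]]; rewrite -ltNge.
move=> [dz h]; split=> //; split; first by exists z.
by apply/negP; rewrite -ltNge.
Qed.

Lemma preim_leP t r z : preim_le t r z <-> disc R z /\ cabs (phi t z) <= r.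
Proof. by split=> [[dz [_ h]]|[dz h]]; split=> //; split=> //; exists z. Qed.

(* Along the positive radius [phi t s] tends to 1. *)
Lemma phi_radius r t : 0 < t < 1 -> r < 1 ->
  exists2 z, disc R z & r < cabs (phi t z).
Proof.
move=> /andP[t0 t1] r1.
pose s := Num.max 0 (1 - (1 - r) * t / 2).
have s0 : 0 <= s by rewrite le_max lexx.
have s1 : s < 1 by rewrite gt_max ltr01 /=; nra.
exists (toCx s); first by rewrite /disc /= cabs_toCx ger0_norm.
rewrite cabs_phiE ?ltW //.
have -> : phiq t (toCx s) = toCx ((t - 1) * s + 1).
  by rewrite /phiq toCxD toCxM toCxB toCx1.
have q0 : 0 < (t - 1) * s + 1 by nra.
rewrite cabs_toCx ger0_norm ?ltW // ltr_pdivlMr //.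
have : 1 - (1 - r) * t / 2 <= s by rewrite le_max lexx orbT.
have [rn|rp] := leP r 0; first by nra.
set d := (1 - r) * t => h.
have d0 : 0 < d by rewrite mulr_gt0 ?subr_gt0.
have A : (t - 1) * s + 1 <= t + (1 - t) * (d / 2) by nra.
have B : r * (1 - t) < 1 by nra.
have A' : r * ((t - 1) * s + 1) <= r * (t + (1 - t) * (d / 2)) by rewrite ler_pM2l.
apply: le_lt_trans A' _.
suff : r * (t + (1 - t) * (d / 2)) < r * t + d.
  by have -> : r * t + d = t by rewrite /d; ring.
have -> : r * (t + (1 - t) * (d / 2)) = r * t + r * (1 - t) * (d / 2) by ring.
rewrite ltrD2l; nra.
Qed.

Lemma integrable_gtS : upper_cond1 u K ->
  exists2 r : R, 0 < r < 1 & mu.-integrable `]0%R, 1%R[ (gtS r).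
Proof.
move=> [r [r01 H]]; exists r => //.
apply: (integrable_of_le _ (measurable_gtS r) _ _ H) => // t.
  by rewrite /= in_itv /=; exact: gtS_ge0.
rewrite /= in_itv /= => t01; have /andP[_ r1] := r01.
apply: gtS_le.
  (* A point with [r < cabs (phi t z)] is needed because the supremum over an empty set would be
     -oo, whereas [gtS] is at least 0. *)
  have [z dz hz] := phi_radius t01 r1.
  apply: le_ereal_sup_tmp; exists (wratio t z)%:E; last by rewrite lee_fin wratio_ge0.
  by exists z => //; apply/preim_gtP.
move=> z dz hz; apply: ereal_sup_ubound; exists z => //.
exact/preim_gtP.
Qed.

Lemma integrable_ltS r : upper_cond2 u K -> 0 < r < 1 ->
  mu.-integrable `]0%R, 1%R[ (ltS r).
Proof.
move=> H r01.
apply: (integrable_of_le _ (measurable_ltS r) _ _ (H r r01)) => // t.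
  by move=> _; exact: ltS_ge0.
move=> _; apply/ereal_supP => _ [z dz <-]; case: ifPn => hz; last exact: wnorm_ge0.
apply: le_trans (wnorm_ub _ _ dz).
rewrite lee_fin cabsM indicE.
have -> : z \in preim_le t r by apply/mem_set/preim_leP; split=> //; exact: ltW.
by rewrite toCx1 cabs1 mulr1.
Qed.

(** Where |phi_t| > r the weighted bound [C] is used, and where |phi_t| <= r the uniform bound [k].
    With [C = 1] this yields the dominating function; with [C] near 1 and [k] small it yields the
    upper bound. *)
Lemma dominated_split f C k r r' t z : 0 < t < 1 -> disc R z -> 0 <= C -> 0 <= k ->
  r < r' -> ubd u f C -> (forall w, cabs w <= r -> cabs (f w) <= k) ->
  ((cabs (f (phi t z) * Tt K t z) * u z)%:E <= C%:E * gtS r t + k%:E * ltS r' t)%E.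
Proof.
move=> t01 dz C0 k0 rr fC fk; have /andP[t0 t1] := t01.
have dp := disc_phi t0 t1 dz; rewrite cabsM -mulrA.
have TuT : 0 <= cabs (Tt K t z) * u z by rewrite mulr_ge0 ?cabs_ge0 // ltW // u0.
have [pr|rp] := leP (cabs (phi t z)) r.
  apply: (@le_trans _ _ (k%:E * ltS r' t)%E).
    apply: (@le_trans _ _ (k%:E * (cabs (Tt K t z) * u z)%:E)%E).
      by rewrite -EFinM lee_fin; apply: ler_wpM2r => //; exact: fk.
    by apply: lee_wpmul2l; [rewrite lee_fin|apply: ltS_ub => //; exact: le_lt_trans rr].
  by rewrite leeDr // mule_ge0 ?lee_fin // gtS_ge0.
apply: (@le_trans _ _ (C%:E * gtS r t)%E).
  apply: (@le_trans _ _ (C%:E * (wratio t z)%:E)%E).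
    rewrite -EFinM lee_fin /wratio.
    have -> : cabs (f (phi t z)) * (cabs (Tt K t z) * u z) =
      (cabs (f (phi t z)) * u (phi t z)) * (cabs (Tt K t z) * u z / u (phi t z)).
      by field; rewrite gt_eqF // u0.
    by apply: ler_wpM2r; [rewrite divr_ge0 // ltW // u0|exact: fC].
  by apply: lee_wpmul2l; [rewrite lee_fin|exact: gtS_ub].
by rewrite leeDl // mule_ge0 ?lee_fin // ltS_ge0.
Qed.

Hypothesis U1 : upper_cond1 u K.
Hypothesis U2 : upper_cond2 u K.

Lemma integrable_split C k r r' : 0 < r' < 1 -> mu.-integrable `]0%R, 1%R[ (gtS r) ->
  mu.-integrable `]0%R, 1%R[ (fun t => C%:E * gtS r t + k%:E * ltS r' t)%E.
Proof.
move=> r01 gi; have mI : measurable (`]0, 1[ : set (measurableTypeR R)) by [].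
exact: (integrableD mI (integrableZl mI C gi) (integrableZl mI k (integrable_ltS U2 r01))).
Qed.

(** One [h] serves the whole unit ball and all [z], since [ubd_growth] bounds all these functions on
    |w| <= r by the same constant. *)
Lemma dominating : exists2 h : R -> \bar R, mu.-integrable `]0%R, 1%R[ h &
  forall f t z, 0 < t < 1 -> disc R z -> holo f -> ubd u f 1 ->
    ((cabs (f (phi t z) * Tt K t z) * u z)%:E <= h t)%E.
Proof.
have [r /andP[r0 r1] gi] := integrable_gtS U1.
have r'01 : 0 < (1 + r) / 2 < 1 by apply/andP; split; lra.
have rr' : r < (1 + r) / 2 by lra.
exists (fun t => 1%:E * gtS r t + (1 / u (toCx r))%:E * ltS ((1 + r) / 2) t)%E.
  exact: integrable_split.
move=> f t z t01 dz fd f1; apply: dominated_split => //.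
  by rewrite divr_ge0 // ltW // (u_real_gt0 uw) // ltW.
by move=> w wr; exact: (ubd_growth uw fd f1).
Qed.

Hypothesis Kb : forall z, disc R z -> exists M, forall w, disc R w -> cabs (K z w) <= M.
Hypothesis dint : (\int[mu]_(s in `]0%R, 1%R[) delta_norm u (toCx s) < +oo)%E.

Lemma delta_ub f x : holo f -> ubd u f 1 -> ((cabs (f (toCx x)))%:E <= delta_norm u (toCx x))%E.
Proof.
move=> fd f1; apply: ereal_sup_ubound; exists f => //; split; last exact/wnorm_leP.
by apply/(HinfP uw); split => //; exists 1.
Qed.

Lemma delta_ge0 x : (0 <= delta_norm u (toCx x))%E.
Proof.
have := @delta_ub (fun=> 0) x; rewrite cabs0; apply.
  by move=> w _; exact: cdb_cst.
by move=> w dw; rewrite cabs0 mul0r.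
Qed.

Lemma disc_real t : 0 < t < 1 -> disc R (toCx t).
Proof. by move=> /andP[/ltW t0 t1]; exact: disc_toCx. Qed.

Lemma ccont_real f t : 0 < t < 1 -> holo f -> ccont (fun s => f (toCx s)) t.
Proof.
move=> t01 fd; have [k hk] := fd _ (disc_real t01).
exact: (@ccont_comp _ f (@toCx R) t k (@ccont_toCx _ t) hk).
Qed.

Lemma integrable_delta : mu.-integrable `]0%R, 1%R[ (fun s => delta_norm u (toCx s)).
Proof.
apply: (integrable_of_le _ _ _ _ dint) => //; last by move=> x _; exact: delta_ge0.
apply: (measurable_fun_sup (q := fun f t => cabs (f (toCx t)))) => f c [/(HinfP uw)[fd _] _].
have := @open_superlevel_if (fun=> true) (fun t => cabs (f (toCx t))) c.
apply => [t _|t _ _|t t01]; first exact: cabs_ge0.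
  by apply: filterS (@filterT _ (nbhs t) _) => s.
exact: rcont_cabs (ccont_real t01 fd).
Qed.

Lemma ccont_curve f z t : 0 < t < 1 -> disc R z -> holo f ->
  ccont (fun t => f (phi t z) * Tt K t z) t.
Proof.
move=> t01 dz fd; have /andP[t0 t1] := t01.
apply: ccontM; last exact: ccont_Tt.
have [k hk] := fd _ (disc_phi t0 t1 dz).
exact: (@ccont_comp _ f (fun s => phi s z) t k (ccont_phi t01 dz) hk).
Qed.

(** The dilations [F n] are bounded, so [deform_bounded] applies to their products with [K z]. Both
    sides pass to the limit, with a multiple of [delta_norm] as dominating function on the segment
    and one of [dominating] on the curve. *)
Lemma IK_curve f z : disc R z -> holo f -> ubd u f 1 ->
  IK K f z = cintegral `]0, 1[ (fun t => f (phi t z) * Tt K t z).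
Proof.
move=> dz fd f1.
have [M KM] := Kb dz; have Kh := kernel_holo dz.
have M0 : 0 <= M by apply: le_trans (cabs_ge0 _) (KM _ (@disc0 R)).
have uz0 := u0 dz.
pose rho n : R := 1 - n.+2%:R^-1.
pose F n w := f (toCx (rho n) * w).
have r01 n : 0 <= rho n /\ rho n <= 1 by have /andP[/ltW ? /ltW ?] := seq_to1 R n.
have Fd n : holo (F n) by have [r0 r1] := r01 n; exact: holo_dilate.
have F1 n : ubd u (F n) 1 by have [r0 r1] := r01 n; exact: ubd_dilate.
have E n : cintegral `]0, 1[ (fun x => F n (toCx x) * K z (toCx x)) =
    cintegral `]0, 1[ (fun t => F n (phi t z) * Tt K t z).
  have /andP[/ltW rn0 rn1] := seq_to1 R n.
  have hd : holo (fun w => F n w * K z w) by move=> w dw; apply: cdbM; [exact: Fd|exact: Kh].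
  have hM w : disc R w -> cabs (F n w * K z w) <= 1 / u (toCx (rho n)) * M.
    move=> dw; rewrite cabsM; apply: ler_pM; rewrite ?cabs_ge0 ?KM //.
    apply: (ubd_growth uw fd f1) => //.
    rewrite cabsM cabs_toCx ger0_norm //; rewrite /disc /= in dw.
    by have := cabs_ge0 w; rewrite -/(rho n) in rn0 *; nra.
  rewrite (deform_bounded dz hd hM).
  by congr (cintegral _ _); apply/funext => t; rewrite TtE mulrA.
have L1 : cintegral `]0, 1[ (fun x => F n (toCx x) * K z (toCx x)) @[n --> \oo] -->
    cintegral `]0, 1[ (fun x => f (toCx x) * K z (toCx x)).
  have mI : measurable (`]0, 1[ : set (measurableTypeR R)) by [].
  apply: (cintegral_dominated_cont _ _ (integrableZl mI M integrable_delta)).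
  - by move=> n t t01; apply: ccontM; apply: ccont_real.
  - by move=> t t01; apply: ccontM; apply: ccont_real.
  - move=> n t t01; rewrite cabsM mulrC EFinM; apply: lee_pmul; rewrite ?lee_fin ?cabs_ge0 //.
      exact/KM/disc_real.
    exact: delta_ub.
  - move=> t t01; apply: (@cvgM (Cx R)); last exact: cvg_cst.
    exact: cvg_dilate (fd _ (disc_real t01)).
have [h hi hdom] := dominating.
have L2 : cintegral `]0, 1[ (fun t => F n (phi t z) * Tt K t z) @[n --> \oo] -->
    cintegral `]0, 1[ (fun t => f (phi t z) * Tt K t z).
  have mI : measurable (`]0, 1[ : set (measurableTypeR R)) by [].
  apply: (cintegral_dominated_cont _ _ (integrableZl mI (u z)^-1 hi)).
  - by move=> n t t01; exact: ccont_curve.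
  - by move=> t t01; exact: ccont_curve.
  - move=> n t t01; have H := hdom (F n) t z t01 dz (Fd n) (F1 n).
    have -> : cabs (F n (phi t z) * Tt K t z) =
      (u z)^-1 * (cabs (F n (phi t z) * Tt K t z) * u z).
      by rewrite [RHS]mulrC mulfK // gt_eqF.
    by rewrite EFinM; apply: lee_wpmul2l => //; rewrite lee_fin invr_ge0 ltW.
  - move=> t /andP[t0 t1]; apply: (@cvgM (Cx R)); last exact: cvg_cst.
    exact: cvg_dilate (fd _ (disc_phi t0 t1 dz)).
have E' : (fun n => cintegral `]0, 1[ (fun x => F n (toCx x) * K z (toCx x))) =
    (fun n => cintegral `]0, 1[ (fun t => F n (phi t z) * Tt K t z)) by apply/funext.
rewrite E' in L1.
exact: (cvg_unique _ L1 L2).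
Qed.

Lemma cintegrable_curve f z : disc R z -> holo f -> ubd u f 1 ->
  cintegrable `]0, 1[ (fun t => f (phi t z) * Tt K t z).
Proof.
move=> dz fd f1; have [h hi hdom] := dominating.
have mI : measurable (`]0, 1[ : set (measurableTypeR R)) by [].
have uz0 := u0 dz.
have [m1 m2] := ccont_measurable (fun t t01 => @ccont_curve f z t t01 dz fd).
apply: (cintegrable_dominated mI m1 m2 (integrableZl mI (u z)^-1 hi)).
move=> t; rewrite /= in_itv /= => t01.
have -> : cabs (f (phi t z) * Tt K t z) = (u z)^-1 * (cabs (f (phi t z) * Tt K t z) * u z).
  by rewrite [RHS]mulrC mulfK // gt_eqF.
by rewrite EFinM; apply: lee_wpmul2l; [rewrite lee_fin invr_ge0 ltW|exact: hdom].
Qed.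

Lemma cintegrable_IK f z : disc R z -> holo f -> ubd u f 1 ->
  cintegrable `]0, 1[ (fun x => f (toCx x) * K z (toCx x)).
Proof.
move=> dz fd f1; have [M KM] := Kb dz; have Kh := kernel_holo dz.
have mI : measurable (`]0, 1[ : set (measurableTypeR R)) by [].
have M0 : 0 <= M by apply: le_trans (cabs_ge0 _) (KM _ (@disc0 R)).
have fc t : 0 < t < 1 -> ccont (fun x => f (toCx x) * K z (toCx x)) t.
  by move=> t01; apply: ccontM; apply: ccont_real.
have [m1 m2] := ccont_measurable fc.
apply: (cintegrable_dominated mI m1 m2 (integrableZl mI M integrable_delta)).
move=> t; rewrite /= in_itv /= => t01.
rewrite cabsM mulrC EFinM; apply: lee_pmul; rewrite ?lee_fin ?cabs_ge0 //.
  exact/KM/disc_real.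
exact: delta_ub.
Qed.

End Domination.

(** * Limits at boundary points and the behaviour of phi near 1 *)

Section DiscAt.
Variable R : realType.
Implicit Types (x y e s r t d C : R) (z w a : Cx R).

Lemma disc_atP a (A : set (Cx R)) : disc_at a A <->
  exists2 d : R, 0 < d & forall z, disc R z -> cabs (z - a) < d -> A z.
Proof.
rewrite /disc_at /within /=; split.
  by move=> /nbhsCP[d d0 h]; exists d => // z dz hz; exact: h.
by move=> [d d0 h]; apply/nbhsCP; exists d => // z hz dz; exact: h.
Qed.

Lemma limf_esup_disc_le a (q : Cx R -> R) C d : 0 < d ->
  (forall z, disc R z -> cabs (z - a) < d -> q z <= C) ->
  (limf_esup (fun z => (q z)%:E) (disc_at a) <= C%:E)%E.
Proof.
move=> d0 h; rewrite limf_esupE; apply: ge_ereal_inf.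
exists (ereal_sup ((fun z => (q z)%:E) @` [set z | disc R z /\ cabs (z - a) < d])).
  by exists [set z | disc R z /\ cabs (z - a) < d] => //; apply/disc_atP; exists d.
by apply/ereal_supP => _ [z [dz hz] <-]; rewrite lee_fin; exact: h.
Qed.

Lemma limf_esup_disc_ge a (q : Cx R -> R) C :
  (forall d, 0 < d -> exists z, [/\ disc R z, cabs (z - a) < d & C <= q z]) ->
  (C%:E <= limf_esup (fun z => (q z)%:E) (disc_at a))%E.
Proof.
move=> h; rewrite limf_esupE; apply/ereal_infP => _ [A /disc_atP[d d0 hA] <-].
have [z [dz hz Cq]] := h d d0.
apply: (@le_trans _ _ (q z)%:E); first by rewrite lee_fin.
by apply: ereal_sup_ubound; exists z => //; exact: hA.
Qed.

Lemma limf_esup_disc_lt a (q : Cx R -> R) C :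
  (limf_esup (fun z => (q z)%:E) (disc_at a) < C%:E)%E ->
  exists2 d : R, 0 < d & forall z, disc R z -> cabs (z - a) < d -> q z <= C.
Proof.
rewrite limf_esupE => /ereal_inf_lt[_ [A /disc_atP[d d0 hA] <-] h].
exists d => // z dz hz; rewrite -lee_fin; apply: le_trans (ltW h).
by apply: ereal_sup_ubound; exists z => //; exact: hA.
Qed.

Lemma limf_esup_disc_gt a (q : Cx R -> R) C :
  (C%:E < limf_esup (fun z => (q z)%:E) (disc_at a))%E ->
  forall d, 0 < d -> exists z, [/\ disc R z, cabs (z - a) < d & C < q z].
Proof.
move=> h d d0.
have [//|nex] := pselect (exists z, [/\ disc R z, cabs (z - a) < d & C < q z]).
move: h; rewrite ltNge => /negP[]; apply: (limf_esup_disc_le d0) => z dz hz.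
by rewrite leNgt; apply/negP => Cq; apply: nex; exists z.
Qed.

Lemma disc_near1 d : 0 < d -> exists z, disc R z /\ cabs (z - 1) < d.
Proof.
move=> d0; pose s := Num.max 0 (1 - d / 2).
have s0 : 0 <= s by rewrite le_max lexx.
have s1 : s < 1 by rewrite gt_max ltr01 /=; lra.
have s2 : 1 - d / 2 <= s by rewrite le_max lexx orbT.
exists (toCx s); split; first by rewrite /disc /= cabs_toCx ger0_norm.
by rewrite -toCx1 -toCxB cabs_toCx ler0_norm; lra.
Qed.

(** The image of the disc under [phi t] is a smaller disc that touches the unit circle only at 1,
    the image of 1. *)
Lemma phi_to_1 t d : 0 < t < 1 -> 0 < d -> exists2 r : R, 0 < r < 1 &
  forall z, disc R z -> r < cabs (phi t z) -> cabs (z - 1) < d.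
Proof.
move=> /andP[t0 t1] d0.
(* With [phiq t z] written as t + (1 - t)(1 - z) and Re (1 - z) >= 0, its squared modulus is at
   least t^2 + (1 - t)^2 |z - 1|^2. So |phi_t(z)|^2 <= m as soon as |z - 1| >= d. *)
pose m := t ^+ 2 / (t ^+ 2 + ((1 - t) * d) ^+ 2).
have t2 : 0 < t ^+ 2 by rewrite exprn_gt0.
have td : 0 < ((1 - t) * d) ^+ 2 by rewrite exprn_gt0 // mulr_gt0 ?subr_gt0.
have D0 : 0 < t ^+ 2 + ((1 - t) * d) ^+ 2 by rewrite addr_gt0.
have m0 : 0 < m by rewrite divr_gt0.
have m1 : m < 1 by rewrite ltr_pdivrMr // mul1r ltrDl.
(* The inequality c <= (1 + c^2) / 2 replaces the square root of [m]. *)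
exists ((1 + m) / 2); first by apply/andP; split; lra.
move=> z dz; apply: contraLR; rewrite -!leNgt => dz1.
suff h : cabs (phi t z) ^+ 2 <= m by have := sqr_ge0 (cabs (phi t z) - 1); nra.
have q0 : 0 < cabs (phiq t z) by apply: cabs_phiq_gt => //; exact: ltW.
rewrite (cabs_phiE _ (ltW t0)) exprMn exprVn /m; apply: ler_wpM2l; first exact: ltW.
rewrite lef_pV2 ?posrE ?exprn_gt0 // cabs_sqr /phiq.
have z1 : complex.Re z <= 1.
  have := cabs_ge_Re z; have := ler_norm (complex.Re z); rewrite /disc /= in dz; lra.
have : d ^+ 2 <= cabs (z - 1) ^+ 2 by apply: lerXn2r; rewrite ?nnegrE ?cabs_ge0 // ltW.
rewrite cabs_sqr !cReD !cImD !cReM !cImM !cReD !cImD !cReN !cImN /=.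
move: z1; move: (complex.Re z) (complex.Im z) => p q p1.
rewrite !(mul0r, mulr0, subr0, oppr0, addr0).
have : 0 < 1 - t by rewrite subr_gt0.
move=> t1' dd.
have A : (1 - t) ^+ 2 * d ^+ 2 <= (1 - t) ^+ 2 * ((p - 1) ^+ 2 + q ^+ 2).
  by apply: ler_wpM2l => //; exact: sqr_ge0.
have B : 0 <= t * (1 - t) * (1 - p) by rewrite !mulr_ge0 ?subr_ge0 // ltW.
by rewrite exprMn; nra.
Qed.

Lemma phi_at_1 t r : 0 < t < 1 -> r < 1 -> exists2 d : R, 0 < d &
  forall z, disc R z -> cabs (z - 1) < d -> r < cabs (phi t z).
Proof.
(* This radius gives |phiq| <= t (2 - r), and r (2 - r) = 1 - (1 - r)^2 < 1. *)
move=> /andP[t0 t1] r1; exists (t * (1 - r)); first by rewrite mulr_gt0 ?subr_gt0.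
move=> z dz hz; rewrite cabs_phiE ?ltW //.
have q0 : 0 < cabs (phiq t z) by apply: cabs_phiq_gt => //; exact: ltW.
rewrite ltr_pdivlMr //.
have E : phiq t z = toCx t + toCx (1 - t) * (1 - z) by rewrite /phiq toCxB toCx1; ring.
have H : cabs (phiq t z) <= t + (1 - t) * cabs (z - 1).
  rewrite E; apply: le_trans (cabsD _ _) _.
  by rewrite cabsM !cabs_toCx (ger0_norm (ltW t0)) ger0_norm ?subr_ge0 ?(ltW t1) // cabsBC.
have [rn|rp] := leP r 0; first by apply: le_lt_trans t0; rewrite mulr_le0_ge0 // ltW.
have hz' : (1 - t) * cabs (z - 1) <= t * (1 - r) by have := cabs_ge0 (z - 1); nra.
have : r * cabs (phiq t z) <= r * (t + t * (1 - r)) by rewrite ler_pM2l //; lra.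
have : 0 < t * (1 - r) ^+ 2 by rewrite mulr_gt0 // exprn_gt0 // subr_gt0.
nra.
Qed.

End DiscAt.

(** * The integrand of the essential norm *)

Section Value.
Variables (R : realType) (u : Cx R -> R) (K : Cx R -> Cx R -> Cx R).
Implicit Types (x y e s r t rho M C : R) (z w : Cx R) (f g : Cx R -> Cx R).
Notation mu := (@lebesgue_measure R).
Hypothesis uw : weight u.
Hypothesis Kd : analytic_disc2 K.
Hypothesis W_fin : forall t, 0 < t < 1 -> (weight_ratio_limsup u t < +oo)%E.
Hypothesis T_lim : forall t, 0 < t < 1 ->
  exists l : R, 0 <= l /\ Tt K t z @[z --> disc_at 1] --> toCx l.

Let u0 := weight_gt0 uw.

(** Only the limit of [Tt] at 1 is known to be real, so its real part stands in for it under the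
    upper limit. *)
Definition value_integrand t : \bar R :=
  limf_esup (fun z => (u z / u (phi t z) * complex.Re (Tt K t z))%:E) (disc_at 1).

Let W t : R := fine (weight_ratio_limsup u t).

Lemma weight_ratio_ge0 t : 0 < t < 1 -> (0 <= weight_ratio_limsup u t)%E.
Proof.
move=> /andP[t0 t1]; apply: limf_esup_disc_ge => d d0.
have [z [dz hz]] := disc_near1 d0; exists z; split => //.
by rewrite divr_ge0 ?ltW ?u0 //; exact: disc_phi.
Qed.

Let WE t : 0 < t < 1 -> weight_ratio_limsup u t = (W t)%:E.
Proof. by move=> t01; rewrite fineK // ge0_fin_numE ?W_fin // weight_ratio_ge0. Qed.

Let W0 t : 0 < t < 1 -> 0 <= W t.
Proof. by move=> t01; rewrite -lee_fin -WE // weight_ratio_ge0. Qed.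

Lemma T_near t l e : 0 < e -> Tt K t z @[z --> disc_at 1] --> toCx l ->
  exists2 d : R, 0 < d & forall z, disc R z -> cabs (z - 1) < d ->
    cabs (Tt K t z - toCx l) <= e.
Proof.
move=> e0 Tl.
have : nbhs (toCx l) [set w | cabs (w - toCx l) < e] by apply/nbhsCP; exists e.
move=> /Tl /disc_atP[d d0 h]; exists d => // z dz hz; apply: ltW; exact: h.
Qed.

Lemma small_factor (k e : R) : 0 <= k -> 0 < e ->
  exists2 e' : R, 0 < e' <= 1 & e' * (k + 1) <= e.
Proof.
move=> k0 e0; have k1 : 0 < k + 1 by lra.
exists (Num.min 1 (e / (k + 1))).
  by rewrite lt_min ltr01 divr_gt0 //= ge_min lexx.
by rewrite -ler_pdivlMr // ge_min lexx orbT.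
Qed.

(** One factor converges, so the upper limit of the product is the product. The sign of [l] is what
    lets the upper limit of the other factor pass through. *)
Lemma value_integrandE t l : 0 < t < 1 -> 0 <= l ->
  Tt K t z @[z --> disc_at 1] --> toCx l -> value_integrand t = (W t * l)%:E.
Proof.
move=> t01 l0 Tl; have /andP[t0 t1] := t01; have w0 := W0 t01.
have near e : 0 < e -> exists d e' : R, [/\ 0 < d, 0 < e',
   e' * (W t + 1) + e' * l <= e, e' <= 1 &
   forall z, disc R z -> cabs (z - 1) < d ->
     [/\ 0 <= u z / u (phi t z), u z / u (phi t z) <= W t + e' &
      `|complex.Re (Tt K t z) - l| <= e']].
  move=> e0; have [e' /andP[e'0 e'1] e'e] := @small_factor (W t + l) e ltac:(lra) e0.
  have := @limf_esup_disc_lt R 1 (fun z => u z / u (phi t z)) (W t + e').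
  rewrite -/(weight_ratio_limsup u t) WE // lte_fin ltrDl => /(_ e'0)[d1 d10 h1].
  have [d2 d20 h2] := T_near e'0 Tl.
  exists (Num.min d1 d2), e'; split => //; first by rewrite lt_min d10.
    by rewrite -mulrDr; move: e'e; rewrite (_ : W t + 1 + l = W t + l + 1) //; ring.
  move=> z dz; rewrite lt_min => /andP[z1 z2]; split; last 2 first.
  - exact: h1.
  - apply: le_trans (h2 z dz z2); apply: le_trans (cabs_ge_Re _).
    by rewrite cReD cReN.
  by rewrite divr_ge0 ?ltW ?u0 //; exact: disc_phi.
apply/eqP; rewrite eq_le; apply/andP; split.
  apply/lee_addgt0Pr => e e0; rewrite -EFinD.
  have [d [e' [d0 e'0 e'e e'1 h]]] := near e e0.
  apply: (limf_esup_disc_le d0) => z dz hz; have [q0 q1 T1] := h z dz hz.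
  have T2 : complex.Re (Tt K t z) - l <= e' by apply: le_trans (ler_norm _) T1.
  have -> : u z / u (phi t z) * complex.Re (Tt K t z) =
     u z / u (phi t z) * (complex.Re (Tt K t z) - l) + u z / u (phi t z) * l by ring.
  set q := u z / u (phi t z) in q0 q1 *; set T := complex.Re _ - l in T2 *.
  have : q * T <= (W t + 1) * e'.
    have [T0|/ltW T0] := leP 0 T; first by apply: ler_pM => //; lra.
    by apply: (@le_trans _ _ 0); [rewrite mulr_ge0_le0|rewrite mulr_ge0 ?ltW //; lra].
  have : q * l <= (W t + e') * l by rewrite ler_wpM2r.
  lra.
apply/lee_subgt0Pr => e e0; rewrite -EFinB.
have [d [e' [d0 e'0 e'e e'1 h]]] := near e e0.
apply: limf_esup_disc_ge => d' d'0.
have dd0 : 0 < Num.min d d' by rewrite lt_min d0.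
have := @limf_esup_disc_gt R 1 (fun z => u z / u (phi t z)) (W t - e').
rewrite -/(weight_ratio_limsup u t) WE // lte_fin ltrBlDr ltrDl => /(_ e'0 _ dd0)[z [dz]].
rewrite lt_min => /andP[hz hz'] qz; exists z; split => //.
have [q0 q1 T1] := h z dz hz.
have T2 : - e' <= complex.Re (Tt K t z) - l by move: T1; rewrite ler_norml => /andP[].
have -> : u z / u (phi t z) * complex.Re (Tt K t z) =
   u z / u (phi t z) * (complex.Re (Tt K t z) - l) + u z / u (phi t z) * l by ring.
set q := u z / u (phi t z) in q0 q1 qz *; set T := complex.Re _ - l in T2 *.
have : q * l >= (W t - e') * l by rewrite ler_wpM2r // ltW.
have : q * T >= - ((W t + 1) * e').
  apply: (@le_trans _ _ (- (q * e'))); last by rewrite -mulrN ler_wpM2l.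
  by rewrite lerN2; apply: ler_wpM2r; [exact: ltW|lra].
lra.
Qed.

Lemma value_integrand_fin t : 0 < t < 1 -> exists2 v : R, 0 <= v & value_integrand t = v%:E.
Proof.
move=> t01; have [l [l0 Tl]] := T_lim t01; exists (W t * l).
  by rewrite mulr_ge0 // W0.
exact: value_integrandE.
Qed.

Lemma value_le_gtS t r : 0 < t < 1 -> r < 1 -> (value_integrand t <= gtS u K r t)%E.
Proof.
move=> t01 r1; have /andP[t0 t1] := t01.
have [d d0 h] := phi_at_1 t01 r1.
rewrite /value_integrand limf_esupE; apply: ge_ereal_inf.
exists (ereal_sup ((fun z => (u z / u (phi t z) * complex.Re (Tt K t z))%:E) @`
   [set z | disc R z /\ cabs (z - 1) < d])).
  by exists [set z | disc R z /\ cabs (z - 1) < d] => //; apply/disc_atP; exists d.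
apply/ereal_supP => _ [z [dz hz] <-].
apply: le_trans (gtS_ub u K dz (h z dz hz)).
rewrite lee_fin /wratio -[leRHS]mulrA [leRHS]mulrC; apply: ler_wpM2l.
  by rewrite divr_ge0 ?ltW ?u0 //; exact: disc_phi.
exact: le_trans (ler_norm _) (cabs_ge_Re _).
Qed.

(** By [phi_to_1], the condition |phi_t(z)| > r forces [z] close to 1 when [r] is close to 1. With
    [value_le_gtS] this identifies the limit of [gtS] as the upper limit at 1. *)
Lemma gtS_to_value t e : 0 < t < 1 -> 0 < e ->
  exists2 r : R, 0 < r < 1 & (gtS u K r t <= value_integrand t + e%:E)%E.
Proof.
move=> t01 e0; have /andP[t0 t1] := t01; have w0 := W0 t01.
have [l [l0 Tl]] := T_lim t01.
have [e' /andP[e'0 e'1] e'e] := @small_factor (W t + l) e ltac:(lra) e0.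
have := @limf_esup_disc_lt R 1 (fun z => u z / u (phi t z)) (W t + e').
rewrite -/(weight_ratio_limsup u t) WE // lte_fin ltrDl => /(_ e'0)[d1 d10 h1].
have [d2 d20 h2] := T_near e'0 Tl.
have dd0 : 0 < Num.min d1 d2 by rewrite lt_min d10.
have [r r01 hr] := phi_to_1 t01 dd0; exists r => //.
rewrite (value_integrandE t01 l0 Tl) -EFinD; apply: gtS_le.
  by rewrite lee_fin; apply: addr_ge0; [exact: mulr_ge0|exact: ltW].
move=> z dz hz; have := hr z dz hz; rewrite lt_min => /andP[z1 z2].
have q0 : 0 <= u z / u (phi t z) by rewrite divr_ge0 ?ltW ?u0 //; exact: disc_phi.
have q1 := h1 z dz z1; have T1 := h2 z dz z2.
have T2 : cabs (Tt K t z) <= l + e'.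
  have := cabs_dist (Tt K t z) (toCx l); rewrite cabs_toCx (ger0_norm l0); lra.
rewrite lee_fin /wratio -[leLHS]mulrA [leLHS]mulrC.
apply: (@le_trans _ _ ((W t + e') * (l + e'))).
  by apply: ler_pM; rewrite ?cabs_ge0.
have : e' * e' <= e' by nra.
nra.
Qed.

Hypothesis U1 : upper_cond1 u K.

Lemma value_integrable : mu.-integrable `]0%R, 1%R[ value_integrand /\
  forall e, 0 < e -> exists r, [/\ 0 < r < 1, mu.-integrable `]0%R, 1%R[ (gtS u K r) &
   (\int[mu]_(t in `]0%R, 1%R[) gtS u K r t <=
    \int[mu]_(t in `]0%R, 1%R[) value_integrand t + e%:E)%E].
Proof.
have [r0 /andP[r00 r01] gi] := integrable_gtS uw Kd U1.
have mI : measurable (`]0, 1[ : set (measurableTypeR R)) by [].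
(* Keeping the radii above [r0] makes [gtS u K r0], integrable by (U1), a dominating function for
   the sequence. *)
pose rn n := Num.max r0 (1 - n.+2%:R^-1).
have rn01 n : 0 < rn n < 1.
  have /andP[h1 h2] := seq_to1 R n.
  by rewrite lt_max r00 /= gt_max r01.
have mg n := measurable_gtS uw Kd (rn n).
have cv t : 0 < t < 1 -> (gtS u K (rn n) t @[n --> \oo] --> value_integrand t)%E.
  move=> t01; have [v v0 vE] := value_integrand_fin t01; rewrite vE.
  have F n : (v%:E <= gtS u K (rn n) t)%E.
    by rewrite -vE; apply: value_le_gtS => //; case/andP: (rn01 n).
  have near e : 0 < e -> exists N, forall n, (N <= n)%N -> (gtS u K (rn n) t <= (v + e)%:E)%E.
    move=> e0; have [r /andP[r0' r1] hr] := gtS_to_value t01 e0.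
    have := @cvg_seq_to1 R; move=> /cvgr_gt /(_ r r1)[N _ hN]; exists N => n Nn.
    have : (gtS u K r t <= (v + e)%:E)%E by rewrite EFinD -vE.
    apply: le_trans; apply: gtS_mono => //.
    by rewrite /rn le_max; apply/orP; right; apply: ltW; exact: hN.
  apply/fine_cvgP; split.
    have [N hN] := near 1 ltr01; exists N => // n /= Nn.
    have := hN n Nn; have := F n; case: (gtS u K (rn n) t) => [x| |] //.
  apply/cvgrPdist_le => e e0; have [N hN] := near e e0; exists N => // n /= Nn.
  have := hN n Nn; have := F n; rewrite /=.
  case: (gtS u K (rn n) t) => [x| |] //=; rewrite !lee_fin => h1 h2.
  by rewrite ler_norml; apply/andP; split; lra.
(* The integrand of the value is measurable as a pointwise limit of the functions [gtS]. *)
have mV : measurable_fun (`]0, 1[ : set (measurableTypeR R)) value_integrand.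
  by apply: (emeasurable_fun_cvg (fun n => gtS u K (rn n))).
have cvD (t : R) : [set` `]0, 1[] t ->
    (gtS u K (rn n) t @[n --> \oo] --> value_integrand t)%E.
  by rewrite /= in_itv /=; exact: cv.
have domD (t : R) n : [set` `]0, 1[] t ->
    (`|gtS u K (rn n) t| <= gtS u K r0 t)%E.
  rewrite /= in_itv /= => t01; rewrite gee0_abs ?gtS_ge0 //.
  by apply: gtS_mono => //; rewrite le_max lexx.
have [iV _ L] : [/\ mu.-integrable `]0%R, 1%R[ value_integrand,
    [sequence \int[mu]_(t in `]0%R, 1%R[) `|gtS u K (rn n) t - value_integrand t|]_n%E
      @ \oo --> 0%E &
    [sequence \int[mu]_(t in `]0%R, 1%R[) gtS u K (rn n) t]_n%E @ \oo -->
      (\int[mu]_(t in `]0%R, 1%R[) value_integrand t)%E].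
  apply: (@dominated_convergence _ _ _ mu `]0%R, 1%R[ mI (fun n => gtS u K (rn n))
    value_integrand (gtS u K r0) mg mV _ gi); first exact: aeW.
  by apply: aeW => t n; exact: domD.
split => // e e0.
have fV : (\int[mu]_(t in `]0%R, 1%R[) value_integrand t)%E \is a fin_num.
  exact: integrable_fin_num.
have gn n : mu.-integrable `]0%R, 1%R[ (gtS u K (rn n)).
  have /integrableP[_ gfin] := gi.
  apply: (integrable_of_le mI (mg n) _ _ gfin) => t; rewrite /= in_itv /= => t01.
    exact: gtS_ge0.
  by rewrite gee0_abs ?gtS_ge0 //; apply: gtS_mono => //; rewrite le_max lexx.
move: L; rewrite -{1}(fineK fV) => /fine_cvgP[_ /cvgrPdist_le /(_ e e0)[N _ hN]].
exists (rn N); split => //.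
have := hN N (leqnn N); rewrite /=.
have fN := integrable_fin_num mI (gn N).
rewrite distrC => /(le_trans (ler_norm _)).
by rewrite lerBlDr -lee_fin EFinD !fineK // addeC.
Qed.

End Value.

(** * Upper bound *)

Section Compact.
Variables (R : realType) (u : Cx R -> R).
Implicit Types (x y e s r t rho M C : R) (z w : Cx R) (f g : Cx R -> Cx R).
Implicit Types (X : set (Cx R -> Cx R)) (T L : (Cx R -> Cx R) -> Cx R -> Cx R).

Lemma increasing_lt (s : nat -> nat) : increasing_seq s -> {homo s : m n / (m < n)%N}.
Proof. by move=> si m n mn; rewrite ltnNge -leEnat si -ltnNge. Qed.

Lemma homo_ge (s : nat -> nat) : {homo s : m n / (m < n)%N} -> forall n, (n <= s n)%N.
Proof. by move=> si; elim=> // n IH; apply: leq_ltn_trans IH _; exact: si. Qed.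

Lemma cvg_subseq (T : topologicalType) (v : nat -> T) (l : T) (s : nat -> nat) :
  {homo s : m n / (m < n)%N} -> v n @[n --> \oo] --> l -> v (s n) @[n --> \oo] --> l.
Proof.
move=> si vl A /vl[N _ hN]; exists N => // n /= Nn; apply: hN => /=.
exact: leq_trans Nn (homo_ge si n).
Qed.

Lemma bolzano_weierstrassC (v : nat -> Cx R) M : (forall n, cabs (v n) <= M) ->
  exists s : nat -> nat, exists l : Cx R,
    {homo s : m n / (m < n)%N} /\ v (s n) @[n --> \oo] --> l.
Proof.
move=> vM.
have bw (q : nat -> R) : (forall n, `|q n| <= M) -> exists s : nat -> nat, exists l : R,
    {homo s : m n / (m < n)%N} /\ q (s n) @[n --> \oo] --> l.
  move=> qM; have [|s /increasing_lt si /cvg_ex[l sl]] := @bolzano_weierstrass R q.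
    exists M; split; first exact: num_real.
    by move=> k Mk n _; apply: le_trans (qM n) (ltW Mk).
  by exists s, l.
have [s1 [l1 [s1i h1]]] := bw (fun n => complex.Re (v n))
  (fun n => le_trans (cabs_ge_Re _) (vM n)).
have [s2 [l2 [s2i h2]]] := bw (fun n => complex.Im (v (s1 n)))
  (fun n => le_trans (cabs_ge_Im _) (vM _)).
exists (s1 \o s2), (l1 +i* l2)%C; split; first by move=> m n mn; exact/s1i/s2i.
apply: cvg_CReIm => /=; last exact: h2.
exact: (cvg_subseq (v := fun n => complex.Re (v (s1 n))) s2i h1).
Qed.

Hypothesis uw : weight u.
Let u0 := weight_gt0 uw.

Lemma wnorm_cvg0P (F : nat -> Cx R -> Cx R) :
  (wnorm u (F n) @[n --> \oo] --> 0%E) <->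
  forall e, 0 < e -> exists N, forall n, (N <= n)%N -> ubd u (F n) e.
Proof.
split.
  move=> /fine_cvgP[[N1 _ h1] /cvgrPdist_le h2] e e0; have [N2 _ h3] := h2 e e0.
  exists (maxn N1 N2) => n; rewrite geq_max => /andP[n1 n2]; apply/wnorm_leP.
  have := h3 n n2; have := h1 n n1; rewrite /= => fn.
  rewrite sub0r normrN ger0_norm ?fine_ge0 ?wnorm_ge0 // => h.
  by rewrite -(fineK fn) lee_fin.
move=> h; apply/fine_cvgP.
have fin n e : ubd u (F n) e -> wnorm u (F n) \is a fin_num.
  move=> /wnorm_leP Fe; rewrite ge0_fin_numE ?wnorm_ge0 //.
  by apply: le_lt_trans Fe _; rewrite ltry.
split; first by have [N hN] := h 1 ltr01; exists N => // n /hN; exact: fin.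
apply/cvgrPdist_le => e e0; have [N hN] := h e e0; exists N => // n /= Nn.
rewrite sub0r normrN ger0_norm ?fine_ge0 ?wnorm_ge0 //.
by rewrite -lee_fin fineK; [exact/wnorm_leP/hN|exact: fin (hN n Nn)].
Qed.

Lemma opnorm_le X T C : (forall f, X f -> ubd u f 1 -> ubd u (T f) C) ->
  (opnorm u X T <= C%:E)%E.
Proof.
move=> h; apply/ereal_supP => _ [f [Xf /wnorm_leP f1] <-].
by apply/wnorm_leP; exact: h.
Qed.

Lemma opnorm_ub X T C f : (opnorm u X T <= C%:E)%E -> X f -> ubd u f 1 -> ubd u (T f) C.
Proof.
move=> h Xf f1; apply/wnorm_leP; apply: le_trans h.
by apply: ereal_sup_ubound; exists f => //; split => //; exact/wnorm_leP.
Qed.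

Lemma bounded_opP X T : bounded_op u X T <-> (forall f, X f -> Hinf u (T f)) /\
  exists2 C, 0 <= C & forall f, X f -> ubd u f 1 -> ubd u (T f) C.
Proof.
split=> -[h].
  move=> H; split => //; case E : (opnorm u X T) H => [c| |] // _.
    exists (Num.max 0 c); first by rewrite le_max lexx.
    by move=> f; apply: opnorm_ub; rewrite E lee_fin le_max lexx orbT.
  exists 0 => // f Xf f1; have := @opnorm_ub X T 0 f; rewrite E; apply => //.
  exact: leNye.
move=> [C C0 /opnorm_le hC]; split => //.
by apply: le_lt_trans hC _; rewrite ltry.
Qed.

Lemma HinfD f g (a : Cx R) : Hinf u f -> Hinf u g -> Hinf u (fun w => a * f w + g w).
Proof.
move=> /(HinfP uw)[fd [C C0 fC]] /(HinfP uw)[gd [C' C'0 gC]]; apply/(HinfP uw); split.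
  move=> w dw; apply: cdbD; last exact: gd.
  by apply: cdbM; [exact: cdb_cst|exact: fd].
exists (cabs a * C + C'); first by rewrite addr_ge0 // mulr_ge0 ?cabs_ge0.
move=> z dz; apply: (@le_trans _ _ ((cabs a * cabs (f z) + cabs (g z)) * u z)).
  apply: ler_wpM2r; first exact: ltW (u0 dz).
  by rewrite -cabsM; exact: cabsD.
rewrite mulrDl -mulrA; apply: lerD; last exact: gC.
by apply: ler_wpM2l; [exact: cabs_ge0|exact: fC].
Qed.

Lemma Hinf0 : Hinf u (fun=> 0).
Proof.
apply/(HinfP uw); split; first by move=> w _; exact: cdb_cst.
by exists 0 => // z dz; rewrite cabs0 mul0r.
Qed.

(** The bounded scalars [c (f n)] have a convergent subsequence, and the images along it converge to
    a multiple of [h]. *)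
Lemma compact_rank1 X (c : (Cx R -> Cx R) -> Cx R) (h : Cx R -> Cx R) M : 0 <= M ->
  (forall (a : Cx R) f g, X f -> X g -> c (fun w => a * f w + g w) = a * c f + c g) ->
  (forall f, X f -> ubd u f 1 -> cabs (c f) <= M) -> Hinf u h ->
  compact_op u X (fun f z => c f * h z).
Proof.
move=> M0 cl cM hh; have [_ [C C0 hC]] := proj1 (HinfP uw _) hh.
split.
- by move=> a f g Xf Xg z _; rewrite cl // mulrDl mulrA.
- apply/bounded_opP; split.
    move=> f _; have := HinfD (c f) hh Hinf0.
    by congr (Hinf u _); apply/funext => w; rewrite addr0.
  exists (M * C); first exact: mulr_ge0.
  move=> f Xf f1 z dz; rewrite cabsM -mulrA; apply: ler_pM.
  - exact: cabs_ge0.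
  - by rewrite mulr_ge0 ?cabs_ge0 // ltW // u0.
  - exact: cM.
  - exact: hC.
- move=> f fX.
  have fM n : cabs (c (f n)) <= M.
    by have [Xf /wnorm_leP f1] := fX n; exact: cM.
  have [s [l [si sl]]] := bolzano_weierstrassC fM.
  exists s, (fun z => l * h z); split => //.
    have := HinfD l hh Hinf0.
    by congr (Hinf u _); apply/funext => w; rewrite addr0.
  apply/wnorm_cvg0P => e e0.
  have C1 : 0 < C + 1 by lra.
  have := proj1 (cvgCP _ _ _) sl (e / (C + 1)) (divr_gt0 e0 C1).
  move=> [N _ hN]; exists N => n Nn z dz.
  have := hN n Nn; rewrite /= ltr_pdivlMr // -mulrBl cabsM -mulrA => H.
  have := hC z dz; have := cabs_ge0 (c (f (s n)) - l).
  set p := cabs _ in H *; set q := cabs _ * _ => p0 qC.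
  have pqC : p * q <= p * C by rewrite ler_wpM2l.
  by move: H; rewrite mulrDr mulr1; lra.
Qed.

Lemma compact_add X L1 L2 : compact_op u X L1 -> compact_op u X L2 ->
  compact_op u X (fun f z => L1 f z + L2 f z).
Proof.
move=> [l1 /bounded_opP[b1 [C1 C10 c1]] k1] [l2 /bounded_opP[b2 [C2 C20 c2]] k2].
have Hsum f g : Hinf u f -> Hinf u g -> Hinf u (fun w => f w + g w).
  move=> hf hg; have := HinfD 1 hf hg.
  by congr (Hinf u _); apply/funext => w; rewrite mul1r.
have usum f g A B : ubd u f A -> ubd u g B -> ubd u (fun w => f w + g w) (A + B).
  move=> fA gB z dz; apply: (@le_trans _ _ ((cabs (f z) + cabs (g z)) * u z)).
    by apply: ler_wpM2r; [exact: ltW (u0 dz)|exact: cabsD].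
  by rewrite mulrDl lerD ?fA ?gB.
split.
- by move=> a f g Xf Xg z dz; rewrite l1 // l2 //; ring.
- apply/bounded_opP; split; first by move=> f Xf; apply: Hsum; [exact: b1|exact: b2].
  exists (C1 + C2); first exact: addr_ge0.
  by move=> f Xf f1; apply: usum; [exact: c1|exact: c2].
- move=> f fX; have [s1 [h1 [s1i hh1 w1]]] := k1 f fX.
  have [s2 [h2 [s2i hh2 w2]]] := k2 (f \o s1) (fun n => fX (s1 n)).
  exists (s1 \o s2), (fun z => h1 z + h2 z); split.
  - by move=> m n mn; exact/s1i/s2i.
  - exact: Hsum.
  - apply/wnorm_cvg0P => e e0.
    have [N1 hN1] := proj1 (wnorm_cvg0P _) w1 (e / 2) ltac:(lra).
    have [N2 hN2] := proj1 (wnorm_cvg0P _) w2 (e / 2) ltac:(lra).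
    exists (maxn N1 N2) => n; rewrite geq_max => /andP[n1 n2].
    have A := hN1 (s2 n) (leq_trans n1 (homo_ge s2i n)); have B := hN2 n n2.
    have := usum _ _ _ _ A B; rewrite -splitr.
    by congr (ubd u _ _); apply/funext => z /=; ring.
Qed.

Lemma compact_zero X : compact_op u X (fun _ _ => 0).
Proof.
split.
- by move=> a f g _ _ z _; rewrite mulr0 addr0.
- apply/bounded_opP; split; first by move=> f _; exact: Hinf0.
  by exists 0 => // f _ _ z dz; rewrite cabs0 mul0r.
- move=> f _; exists id, (fun=> 0); split => //; first exact: Hinf0.
  by apply/wnorm_cvg0P => e e0; exists 0%N => n _ z dz; rewrite subrr cabs0 mul0r ltW.
Qed.

Lemma compact_sum X (m : nat) (Li : nat -> (Cx R -> Cx R) -> Cx R -> Cx R) :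
  (forall k, compact_op u X (Li k)) ->
  compact_op u X (fun f z => \sum_(k < m) Li k f z).
Proof.
move=> Lc; elim: m => [|m IH].
  have -> : (fun f z => \sum_(k < 0) Li k f z) = (fun _ _ => 0).
    by apply/funext => f; apply/funext => z; rewrite big_ord0.
  exact: compact_zero.
have -> : (fun f z => \sum_(k < m.+1) Li k f z) = (fun f z => \sum_(k < m) Li k f z + Li m f z).
  by apply/funext => f; apply/funext => z; rewrite big_ord_recr.
exact: compact_add.
Qed.

(* Averaging many dilations of increasing radius: at each point all but one of
   the terms are either close to [f] or negligible. *)
Lemma sliding_hump r0 eta (N : nat) : 0 <= r0 < 1 -> 0 < eta ->
  exists r : seq R, exists2 rho : R, r0 <= rho < 1 &
    [/\ size r = N, (forall x, x \in r -> 0 <= x < 1) &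
     forall f, holo f -> ubd u f 1 ->
      [/\ forall w, disc R w ->
            (\sum_(x <- r) cabs (f w - f (toCx x * w))) * u w <= N%:R * (1 + eta) + 1,
          forall w, disc R w -> rho < cabs w ->
            (\sum_(x <- r) cabs (f w - f (toCx x * w))) * u w <= N%:R * (1 + eta) &
          forall w, cabs w <= r0 ->
            \sum_(x <- r) cabs (f w - f (toCx x * w)) <= N%:R * eta]].
Proof.
move=> /andP[r00 r01] eta0; elim: N => [|N [r [rho /andP[r0rho rho1] [sr rr IH]]]].
  exists [::], r0; first by rewrite lexx.
  split => // f fd f1.
  by split => [w dw|w dw _|w _]; rewrite !big_nil !mul0r // add0r.
pose s := (1 + rho) / 2.
have s0 : 0 <= s by rewrite /s; lra.
have s1 : s < 1 by rewrite /s; lra.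
have us0 := u_real_gt0 uw s0 s1.
have d0 : 0 < s - rho by rewrite /s; lra.
(* By [cauchy_lip] between the radii [rho] and [s], this dilation moves functions of the unit ball
   by at most [eta] on |w| <= rho. *)
pose x := Num.max 0 (1 - eta * u (toCx s) * (s - rho) ^+ 2).
have c0 : 0 < eta * u (toCx s) * (s - rho) ^+ 2 by rewrite !mulr_gt0 // exprn_gt0.
have x0 : 0 <= x by rewrite le_max lexx.
have x1 : x < 1 by rewrite gt_max ltr01 /=; lra.
have xc : 1 - x <= eta * u (toCx s) * (s - rho) ^+ 2.
  have : 1 - eta * u (toCx s) * (s - rho) ^+ 2 <= x by rewrite le_max lexx orbT.
  lra.
have ux0 := u_real_gt0 uw x0 x1.
(* The dilated function is bounded by [1 / u (toCx x)] on the whole disc, so beyond [r1] its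
   weighted size is below [eta]. *)
have [r1 /andP[r10 r11] hr1] := u_vanish uw (mulr_gt0 eta0 ux0).
exists (x :: r), (Num.max rho r1); first by rewrite le_max r0rho gt_max rho1.
split => [|y|f fd f1]; first by rewrite /= sr.
  by rewrite in_cons => /orP[/eqP->|/rr]; rewrite ?x0.
have [A B C] := IH f fd f1.
have near w : cabs w <= rho -> cabs (f w - f (toCx x * w)) <= eta.
  move=> wr; have rs : rho < s by rewrite -subr_gt0.
  have M v : cabs v = s -> cabs (f v) <= 1 / u (toCx s).
    by move=> vs; apply: (ubd_growth uw fd f1) => //; rewrite vs.
  apply: le_trans (cauchy_lip fd wr rs s1 x0 (ltW x1) M) _.
  rewrite mul1r mulrA ler_pdivrMr ?exprn_gt0 // ler_pdivrMl //.
  by move: xc; rewrite -mulrA mulrCA.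
have any w : disc R w -> cabs (f w - f (toCx x * w)) * u w <= 2.
  move=> dw; apply: (@le_trans _ _ ((cabs (f w) + cabs (f (toCx x * w))) * u w)).
    by apply: ler_wpM2r; [exact: ltW (u0 dw)|exact: cabsB].
  rewrite mulrDl; have := f1 w dw; have := ubd_dilate uw fd f1 x0 (ltW x1) dw; lra.
have far w : disc R w -> r1 < cabs w -> cabs (f w - f (toCx x * w)) * u w <= 1 + eta.
  move=> dw wr; apply: (@le_trans _ _ ((cabs (f w) + cabs (f (toCx x * w))) * u w)).
    by apply: ler_wpM2r; [exact: ltW (u0 dw)|exact: cabsB].
  rewrite mulrDl; apply: lerD; first exact: f1.
  have : cabs (f (toCx x * w)) <= 1 / u (toCx x).
    apply: (ubd_growth uw fd f1) => //.
    rewrite cabsM cabs_toCx ger0_norm // ler_piMr //; exact: ltW.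
  move=> fx; have ue := ltW (hr1 w wr dw).
  have : cabs (f (toCx x * w)) * u w <= 1 / u (toCx x) * (eta * u (toCx x)).
    by apply: ler_pM; rewrite ?cabs_ge0 //; exact: ltW (u0 dw).
  by rewrite mul1r mulrCA mulVf ?mulr1 // gt_eqF.
have N1 : N.+1%:R = N%:R + 1 :> R by rewrite -natr1.
split => [w dw|w dw|w wr]; rewrite big_cons ?mulrDl N1.
(* Inside [rho] the new term is at most [eta]. Outside, the old terms have already lost their extra
   1, and the new term, at most 2, takes it over. *)
- have [wr|rw] := leP (cabs w) rho.
    have h1 := near w wr; have h2 := A w dw.
    have h3 : cabs (f w - f (toCx x * w)) * u w <= eta * 1.
      by apply: ler_pM; rewrite ?cabs_ge0 ?(ltW (u0 dw)) ?(u_le1 uw).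
    lra.
  have := any w dw; have := B w dw rw; lra.
- rewrite gt_max => /andP[rw r1w].
  have := far w dw r1w; have := B w dw rw; lra.
- have := near w (le_trans wr r0rho); have := C w wr; lra.
Qed.

Lemma monomial_ubd k : ubd u (fun w => w ^+ k) 1.
Proof.
move=> z dz; rewrite -[leRHS]mulr1; apply: ler_pM.
- exact: cabs_ge0.
- exact: ltW (u0 dz).
- by rewrite cabsX; apply: exprn_ile1; [exact: cabs_ge0|exact: ltW].
- exact: u_le1.
Qed.

Lemma monomial_holo k : holo (fun w : Cx R => w ^+ k).
Proof. by move=> w _; apply: cdbX; exact: cdb_id. Qed.

(** Each dilation in the average is replaced by its Taylor polynomial. On the disc the total error
    is [eta] from the hump, [eta] from the extra 1 after averaging and [eta] from the truncation; on
    |w| <= r0 only the first and the last occur. *)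
Lemma finite_rank_approx r0 eta : 0 <= r0 < 1 -> 0 < eta ->
  exists s, exists m : nat, exists2 d : nat -> R, 0 < s < 1 &
    forall f, holo f -> ubd u f 1 ->
      let h w := f w - \sum_(k < m) (toCx (d k) * taylor_coef s k f) * w ^+ k in
      ubd u h (1 + 3 * eta) /\ forall w, cabs w <= r0 -> cabs (h w) <= 2 * eta.
Proof.
move=> r001 eta0; have /andP[r00 r01] := r001.
(* Division by the number of dilations makes the extra 1 of [sliding_hump] smaller than [eta]. *)
have [N hN] : exists N : nat, N.+1%:R^-1 < eta.
  have := @cvg_harmonic R; move=> /cvgrPdist_lt /(_ eta eta0)[N _ /(_ N (leqnn N))].
  rewrite /= sub0r normrN ger0_norm ?invr_ge0 // => h; by exists N.
have [r [rho _ [sr rr H]]] := @sliding_hump r0 eta N.+1 r001 eta0.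
(* A common bound [b < 1] for the radii keeps all dilated arguments in |v| <= b, so that one
   truncation degree works on the whole disc. *)
have [b b01 rb] : exists2 b : R, 0 <= b < 1 & forall x, x \in r -> 0 <= x <= b.
  elim: r rr {sr H} => [|x r IH] rr; first by exists 0 => //; rewrite lexx ltr01.
  have [|b /andP[b0 b1] hb] := IH; first by move=> y yr; apply: rr; rewrite in_cons yr orbT.
  have /andP[x0 x1] := rr x (mem_head _ _).
  exists (Num.max x b); first by rewrite le_max x0 gt_max x1.
  move=> y; rewrite in_cons le_max => /orP[/eqP->|/hb/andP[-> ->]]; last by rewrite orbT.
  by rewrite x0 lexx.
have /andP[b0 b1] := b01.
pose s := (1 + b) / 2.
have s0 : 0 < s by rewrite /s; lra.
have s1 : s < 1 by rewrite /s; lra.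
have bs : b < s by rewrite /s; lra.
have us0 := u_real_gt0 uw (ltW s0) s1.
have [m hm] : exists m : nat, 1 / u (toCx s) * ((b / s) ^+ m / (s - b)) <= eta.
  have bs0 : 0 <= b / s by rewrite divr_ge0 // ltW.
  have bs1 : b / s < 1 by rewrite ltr_pdivrMr // mul1r.
  have : (b / s) ^+ m @[m --> \oo] --> (0 : R) by apply: cvg_expr; rewrite ger0_norm.
  have e0 : 0 < eta * u (toCx s) * (s - b) by rewrite !mulr_gt0 // subr_gt0.
  move=> /cvgrPdist_le /(_ _ e0)[m _ /(_ m (leqnn m))] /=.
  rewrite sub0r normrN ger0_norm ?exprn_ge0 //.
  move=> h; exists m; rewrite mul1r ler_pdivrMl // ler_pdivrMr ?subr_gt0 //.
  by rewrite [u _ * _]mulrC.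
(* The coefficient of w^k in the dilation by [x] carries the factor x^k, and [d k] is the average of
   these factors. *)
pose d k := N.+1%:R^-1 * \sum_(x <- r) x ^+ k.
exists s, m, d; first by rewrite s0.
move=> f fd f1 h; have [A _ C] := H f fd f1.
have fM v : cabs v = s -> cabs (f v) <= 1 / u (toCx s).
  by move=> vs; apply: (ubd_growth uw fd f1) => //; rewrite vs.
have N0 : 0 < N.+1%:R :> R by rewrite ltr0n.
have T x w : x \in r -> cabs w < 1 ->
    cabs (f (toCx x * w) - \sum_(k < m) taylor_coef s k f * (toCx x * w) ^+ k) <= eta.
  move=> xr w1; have /andP[x0 xb] := rb x xr.
  apply: le_trans (taylor_remainder _ fd _ bs s1 fM) hm.
  rewrite cabsM cabs_toCx ger0_norm //; have := cabs_ge0 w; nra.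
have E w : h w = toCx N.+1%:R^-1 * (\sum_(x <- r) (f w - f (toCx x * w)) +
    \sum_(x <- r) (f (toCx x * w) - \sum_(k < m) taylor_coef s k f * (toCx x * w) ^+ k)).
  rewrite -big_split /=.
  under [X in _ = _ * X]eq_bigr => x _ do rewrite addrA subrK.
  rewrite sumrB big_const_seq count_predT sr iter_addr_0 mulrBr; congr (_ - _).
    have -> : f w *+ N.+1 = toCx N.+1%:R * f w.
      by rewrite /toCx rmorph_nat mulr_natl.
    by rewrite mulrA -toCxM mulVf ?toCx1 ?mul1r // gt_eqF.
  rewrite exchange_big /= mulr_sumr; apply: eq_bigr => k _.
  move: (taylor_coef s k f) => a.
  rewrite /d toCxM -!mulrA; congr (_ * _).
  rewrite {1}/toCx rmorph_sum mulr_suml; apply: eq_bigr => x _.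
  by rewrite exprMn -toCxX [RHS]mulrCA.
have Hw w : cabs w < 1 ->
    cabs (h w) <= N.+1%:R^-1 * \sum_(x <- r) cabs (f w - f (toCx x * w)) + eta.
  move=> w1; rewrite E cabsM cabs_toCx ger0_norm ?invr_ge0 //.
  apply: (@le_trans _ _ (N.+1%:R^-1 * (\sum_(x <- r) cabs (f w - f (toCx x * w)) + N.+1%:R * eta))).
    apply: ler_wpM2l; first by rewrite invr_ge0.
    apply: le_trans (cabsD _ _) _; apply: lerD; first exact: cabs_sum.
    apply: le_trans (cabs_sum _ _ _) _.
    have -> : N.+1%:R * eta = \sum_(x <- r) eta.
      by rewrite big_const_seq count_predT sr iter_addr_0 mulr_natl.
    by rewrite big_seq [leRHS]big_seq; apply: ler_sum => x xr; exact: T.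
  by rewrite mulrDr mulrA mulVf ?mul1r // gt_eqF.
split.
  move=> w dw; have dw' : cabs w < 1 by [].
  apply: (@le_trans _ _ ((N.+1%:R^-1 * \sum_(x <- r) cabs (f w - f (toCx x * w)) + eta) * u w)).
    by apply: ler_wpM2r; [exact: ltW (u0 dw)|exact: Hw].
  rewrite mulrDl -mulrA.
  have h1 : N.+1%:R^-1 * ((\sum_(x <- r) cabs (f w - f (toCx x * w))) * u w) <=
      N.+1%:R^-1 * (N.+1%:R * (1 + eta) + 1).
    by apply: ler_wpM2l; [rewrite invr_ge0|exact: A].
  have E2 : N.+1%:R^-1 * (N.+1%:R * (1 + eta) + 1) = 1 + eta + N.+1%:R^-1 :> R.
    by field; rewrite gt_eqF.
  rewrite E2 in h1.
  have h2 : eta * u w <= eta * 1 by apply: ler_wpM2l; [exact: ltW|exact: u_le1].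
  apply: le_trans (lerD h1 h2) _; move: hN; clear; move: (N.+1%:R^-1) => iN; lra.
move=> w wr; have w1 : cabs w < 1 := le_lt_trans wr r01.
apply: le_trans (Hw w w1) _.
have h1 : N.+1%:R^-1 * (\sum_(x <- r) cabs (f w - f (toCx x * w))) <=
    N.+1%:R^-1 * (N.+1%:R * eta).
  by apply: ler_wpM2l; [rewrite invr_ge0|exact: C].
rewrite mulrA mulVf ?mul1r ?gt_eqF // in h1.
by rewrite mulr_natl mulr2n lerD2r.
Qed.

End Compact.

(** * Linearity of the operator and the upper estimate *)

Section UpperBound.
Variables (R : realType) (u : Cx R -> R) (K : Cx R -> Cx R -> Cx R).
Implicit Types (x y e s r t rho M C : R) (z w : Cx R) (f g : Cx R -> Cx R).
Notation mu := (@lebesgue_measure R).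
Hypothesis uw : weight u.
Hypothesis Kd : analytic_disc2 K.
Hypothesis U1 : upper_cond1 u K.
Hypothesis U2 : upper_cond2 u K.
Hypothesis Kb : forall z, disc R z -> exists M, forall w, disc R w -> cabs (K z w) <= M.
Hypothesis dint : (\int[mu]_(s in `]0%R, 1%R[) delta_norm u (toCx s) < +oo)%E.

Let u0 := weight_gt0 uw.
Let mI : measurable (`]0, 1[ : set (measurableTypeR R)). Proof. by []. Qed.

(** The curve formula was proved on the unit ball, and homogeneity extends it to any bound. Dividing
    by [C + 1] covers [C = 0]. *)
Lemma ubd_normalize f C : holo f -> ubd u f C -> exists2 k : Cx R, k != 0 &
  holo (fun w => k^-1 * f w) /\ ubd u (fun w => k^-1 * f w) 1.
Proof.
move=> fd fC; have C0 : 0 <= C.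
  by apply: le_trans (fC 0 (@disc0 R)); rewrite mulr_ge0 ?cabs_ge0 // ltW // u0 //; exact: disc0.
have C1 : 0 < C + 1 by lra.
have k0 : toCx (C + 1) != 0 by rewrite -cabs_eq0 cabs_toCx normr_eq0 gt_eqF.
exists (toCx (C + 1)) => //; split.
  by move=> w dw; apply: cdbM; [exact: cdb_cst|exact: fd].
move=> z dz; rewrite cabsM cabsV cabs_toCx (ger0_norm (ltW C1)).
rewrite -mulrA ler_pdivrMl // mulr1; have := fC z dz; lra.
Qed.

Lemma scale_curve (F : R -> Cx R) (G : R -> Cx R) (k : Cx R) : k != 0 ->
  (fun t => F t * G t) = (fun t => k * ((k^-1 * F t) * G t)).
Proof. by move=> k0; apply/funext => t; rewrite !mulrA divff // mul1r. Qed.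

Lemma cintegrable_IK_bd f C z : disc R z -> holo f -> ubd u f C ->
  cintegrable `]0, 1[ (fun x => f (toCx x) * K z (toCx x)).
Proof.
move=> dz fd fC; have [k k0 [hd h1]] := ubd_normalize fd fC.
rewrite (scale_curve (fun x => f (toCx x)) _ k0).
apply: cintegrableZ => //; exact: (cintegrable_IK uw Kd Kb dint dz hd h1).
Qed.

Lemma IK_scale (k : Cx R) f z : cintegrable `]0, 1[ (fun x => f (toCx x) * K z (toCx x)) ->
  IK K (fun w => k * f w) z = k * IK K f z.
Proof.
move=> fi; rewrite /IK -cintegralZ //; congr (cintegral _ _).
by apply/funext => t; rewrite mulrA.
Qed.

Lemma IK_linear (a : Cx R) f g C C' z : disc R z -> holo f -> ubd u f C -> holo g -> ubd u g C' ->
  IK K (fun w => a * f w + g w) z = a * IK K f z + IK K g z.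
Proof.
move=> dz fd fC gd gC.
have fi := cintegrable_IK_bd dz fd fC; have gi := cintegrable_IK_bd dz gd gC.
rewrite -IK_scale // /IK -cintegralD //.
  by congr (cintegral _ _); apply/funext => t; rewrite mulrDl.
have := cintegrableZ a mI fi; congr (cintegrable _ _).
by apply/funext => t; rewrite mulrA.
Qed.

Lemma curve_bd f C z : disc R z -> holo f -> ubd u f C ->
  cintegrable `]0, 1[ (fun t => f (phi t z) * Tt K t z) /\
  IK K f z = cintegral `]0, 1[ (fun t => f (phi t z) * Tt K t z).
Proof.
move=> dz fd fC; have [k k0 [hd h1]] := ubd_normalize fd fC.
have ci := cintegrable_curve uw Kd U1 U2 dz hd h1.
rewrite (scale_curve (fun t => f (phi t z)) _ k0).
split; first exact: cintegrableZ.
rewrite cintegralZ // -(IK_curve uw Kd U1 U2 Kb dint dz hd h1).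
rewrite -IK_scale; last exact: (cintegrable_IK uw Kd Kb dint dz hd h1).
by congr (IK K _ z); apply/funext => w; rewrite mulrA divff // mul1r.
Qed.

Hypothesis IKb : bounded_op u (Hinf u) (IK K).
Hypothesis W_fin : forall t, 0 < t < 1 -> (weight_ratio_limsup u t < +oo)%E.
Hypothesis T_lim : forall t, 0 < t < 1 ->
  exists l : R, 0 <= l /\ Tt K t z @[z --> disc_at 1] --> toCx l.

Lemma IK_sum (m : nat) (c : nat -> Cx R) f C z : disc R z -> holo f -> ubd u f C ->
  IK K (fun w => f w - \sum_(k < m) c k * w ^+ k) z =
  IK K f z - \sum_(k < m) c k * IK K (fun w => w ^+ k) z.
Proof.
move=> dz fd fC; elim: m => [|m IH].
  rewrite big_ord0 subr0; congr (IK K _ z); apply/funext => w.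
  by rewrite big_ord0 subr0.
rewrite big_ord_recr /= opprD addrA -IH.
have -> : (fun w => f w - \sum_(k < m.+1) c k * w ^+ k) =
    (fun w => - c m * w ^+ m + (f w - \sum_(k < m) c k * w ^+ k)).
  by apply/funext => w; rewrite big_ord_recr /= opprD mulNr addrA [RHS]addrC.
have [hd [B hB]] : holo (fun w => f w - \sum_(k < m) c k * w ^+ k) /\
    exists B, ubd u (fun w => f w - \sum_(k < m) c k * w ^+ k) B.
  elim: m {IH} => [|m [hd [B hB]]].
    have -> : (fun w => f w - \sum_(k < 0) c k * w ^+ k) = f.
      by apply/funext => w; rewrite big_ord0 subr0.
    by split=> //; exists C.
  have -> : (fun w => f w - \sum_(k < m.+1) c k * w ^+ k) =
    (fun w => - c m * w ^+ m + (f w - \sum_(k < m) c k * w ^+ k)).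
    by apply/funext => w; rewrite big_ord_recr /= opprD mulNr addrA [RHS]addrC.
  have M0 : 0 <= Num.max B 0 by rewrite le_max lexx orbT.
  have hm : Hinf u (fun w => w ^+ m).
    by apply/(HinfP uw); split; [exact: monomial_holo|exists 1 => //; exact: monomial_ubd].
  have hf : Hinf u (fun w => f w - \sum_(k < m) c k * w ^+ k).
    apply/(HinfP uw); split => //; exists (Num.max B 0) => // v dv.
    by apply: le_trans (hB v dv) _; rewrite le_max lexx.
  have /(HinfP uw)[h1 [B' _ h2]] := HinfD uw (- c m) hm hf.
  by split=> //; exists B'.
rewrite (IK_linear _ dz (monomial_holo m) (monomial_ubd uw m) hd hB).
by rewrite mulNr addrC.
Qed.

(** After subtraction of the compact operator, [dominated_split] bounds the rest by [1 + 3 * eta]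
    times the integral of [gtS] plus [2 * eta] times that of [ltS]. The second integral depends on
    [r] only, so [eta] can be chosen after it. *)
Lemma ess_norm_le_value :
  (ess_norm u (Hinf u) (IK K) <= \int[mu]_(t in `]0%R, 1%R[) value_integrand u K t)%E.
Proof.
have [Vi VR] := value_integrable uw Kd W_fin T_lim U1.
apply/lee_addgt0Pr => e e0; have e20 : 0 < e / 2 by lra.
have [r [/andP[r0 r1] gi gV]] := VR _ e20.
pose r' := (1 + r) / 2; have r'01 : 0 < r' < 1 by rewrite /r'; apply/andP; split; lra.
have rr' : r < r' by rewrite /r'; lra.
have li := integrable_ltS uw Kd U2 r'01.
have [A A0 AE] : exists2 A, 0 <= A & (\int[mu]_(t in `]0%R, 1%R[) gtS u K r t = A%:E)%E.
  have g0 : (0 <= \int[mu]_(t in `]0%R, 1%R[) gtS u K r t)%E.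
    by apply: integral_ge0 => t; rewrite /= in_itv /=; exact: gtS_ge0.
  have fi := integrable_fin_num mI gi.
  by exists (fine (\int[mu]_(t in `]0%R, 1%R[) gtS u K r t)%E); rewrite ?fine_ge0 // fineK.
have [B B0 BE] : exists2 B, 0 <= B & (\int[mu]_(t in `]0%R, 1%R[) ltS u K r' t = B%:E)%E.
  have g0 : (0 <= \int[mu]_(t in `]0%R, 1%R[) ltS u K r' t)%E.
    by apply: integral_ge0 => t _; exact: ltS_ge0.
  have fi := integrable_fin_num mI li.
  by exists (fine (\int[mu]_(t in `]0%R, 1%R[) ltS u K r' t)%E); rewrite ?fine_ge0 // fineK.
(* The [eta] terms then total at most [e / 2]. The other half of [e] pays for replacing the integral
   of [gtS] by the value. *)
pose eta := e / 2 / (3 * A + 2 * B + 1).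
have den0 : 0 < 3 * A + 2 * B + 1 by lra.
have eta0 : 0 < eta by rewrite divr_gt0.
have etaE : eta * (3 * A + 2 * B + 1) = e / 2 by rewrite /eta divfK // gt_eqF.
have r01 : 0 <= r < 1 by rewrite (ltW r0).
have [s [m [d /andP[s0 s1] H]]] := finite_rank_approx uw r01 eta0.
(* This is the operator applied to the polynomial approximant of [f]. It has rank at most [m], since
   its range is spanned by the images of the monomials. *)
pose L f z := \sum_(k < m) (toCx (d k) * taylor_coef s k f) * IK K (fun w => w ^+ k) z.
have Lc : compact_op u (Hinf u) L.
  apply: (compact_sum uw m (Li := fun k f z =>
    (toCx (d k) * taylor_coef s k f) * IK K (fun w => w ^+ k) z)) => k.
  have us0 := u_real_gt0 uw (ltW s0) s1.
  apply: (compact_rank1 uw (c := fun f => toCx (d k) * taylor_coef s k f)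
    (M := `|d k| * (s ^- k * (1 / u (toCx s))))).
  - by rewrite !mulr_ge0 ?invr_ge0 ?exprn_ge0 // ltW.
  - move=> a f g /(HinfP uw)[fd _] /(HinfP uw)[gd _].
    by rewrite taylor_coef_linear // mulrDr mulrCA.
  - move=> f /(HinfP uw)[fd _] f1; rewrite cabsM cabs_toCx; apply: ler_wpM2l => //.
    apply: taylor_coef_le => // v vs; apply: (ubd_growth uw fd f1) => //.
    by rewrite vs.
  - apply: IKb.1; apply/(HinfP uw); split; first exact: monomial_holo.
    by exists 1 => //; exact: monomial_ubd.
apply: (@le_trans _ _ (opnorm u (Hinf u) (fun f z => IK K f z - L f z))).
  by apply: ereal_inf_lbound; exists L.
apply: (@le_trans _ _ ((1 + 3 * eta) * A + 2 * eta * B)%:E); last first.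
  rewrite AE in gV.
  have -> : ((1 + 3 * eta) * A + 2 * eta * B)%:E = (A%:E + (3 * eta * A + 2 * eta * B)%:E)%E.
    by rewrite -EFinD; congr EFin; ring.
  have -> : e%:E = ((e / 2)%:E + (e / 2)%:E)%E by rewrite -EFinD -splitr.
  rewrite addeA; apply: leeD => //; rewrite lee_fin.
  have : eta * (3 * A + 2 * B + 1) = 3 * eta * A + 2 * eta * B + eta by ring.
  move: (3 * eta * A + 2 * eta * B) => X; rewrite etaE => ->; lra.
apply: opnorm_le => f /(HinfP uw)[fd _] f1 z dz.
have [h1 h2] := H f fd f1.
rewrite /L -(IK_sum m (fun k => toCx (d k) * taylor_coef s k f) dz fd f1).
set h := fun w => f w - _ in h1 h2 *.
have hd : holo h.
  move=> w dw; apply: cdbB; first exact: fd.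
  apply: cdb_sum => k.
  by apply: cdbM; [exact: cdb_cst|apply: cdbX; exact: cdb_id].
have [ci ->] := curve_bd dz hd h1.
have mi := integrable_split uw Kd U2 (1 + 3 * eta) (2 * eta) r'01 gi.
have uz0 := u0 dz.
have p1 : 0 <= 1 + 3 * eta by lra.
have p2 : 0 <= 2 * eta by lra.
(* The weight [u z] is moved under the integral, where the pointwise bound includes it. *)
have := @cabs_cintegral_le R _ _ _ mI (cintegrableZ (toCx (u z)) mI ci) mi.
rewrite cintegralZ // integralD //; last 2 first.
  by apply: integrableZl.
  by apply: integrableZl.
rewrite !integralZl // AE BE -!EFinM -EFinD lee_fin cabsM cabs_toCx (ger0_norm (ltW uz0)) [u z * _]mulrC.
apply => t; rewrite /= in_itv /= => t01.
rewrite cabsM cabs_toCx (ger0_norm (ltW uz0)) [u z * _]mulrC.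
exact: dominated_split.
Qed.

End UpperBound.

Section Restriction.
Variables (R : realType) (u : Cx R -> R).

(** Restricting a compact operator keeps it compact and does not increase norms. The upper bound is
    thus needed only on H^infty_u and the lower bound only on H^0_u. *)
Lemma ess_norm_Hzero_le (T : (Cx R -> Cx R) -> Cx R -> Cx R) :
  (ess_norm u (Hzero u) T <= ess_norm u (Hinf u) T)%E.
Proof.
have sub f : Hzero u f -> Hinf u f by case.
have opn S : (opnorm u (Hzero u) S <= opnorm u (Hinf u) S)%E.
  by apply: ereal_sup_le => _ [f [/sub fX f1] <-]; exists f.
apply/ereal_infP => _ [L [ll [lb lb'] lc] <-].
apply: le_trans (opn _); apply: ereal_inf_lbound; exists L => //; split.
- by move=> a f g /sub fX /sub gX; exact: ll.
- by split; [move=> f /sub; exact: lb|exact: le_lt_trans (opn _) lb'].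
- by move=> f fX; apply: lc => n; have [/sub] := fX n.
Qed.

End Restriction.

(** * Lower bound *)

Section Spike.
Variable R : realType.
Implicit Types (x y e s r t d c : R) (z w a : Cx R).

(** The parameter d of the n-th spike; the n-th test point is [1 - step n ^+ 2]. *)
Definition step n : R := n.+2%:R^-1.

Lemma step_gt0 n : 0 < step n.
Proof. by rewrite invr_gt0 ltr0n. Qed.

Lemma step_lt1 n : step n < 1.
Proof. by have /andP[h _] := seq_to1 R n; rewrite subr_gt0 in h. Qed.

Lemma step_small e : 0 < e -> exists N : nat, forall n, (N <= n)%N -> step n < e.
Proof.
move=> e0; have /cvgrPdist_lt /(_ e e0)[N _ h] := @cvg_seq_to1 R.
exists N => n /h /=; rewrite opprB addrC subrK ger0_norm //; exact: ltW (step_gt0 n).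
Qed.

(* The first factor kills the point 1, the second one everything away from 1,
   and both are close to 1 at distance [d ^+ 2] from 1. *)
Definition spike d z : Cx R :=
  (1 - z) / (1 - z + toCx (d ^+ 3)) * (toCx d / (1 - z + toCx d)).

(** The real part of 1 - z is positive on the disc, so adding a positive real number increases the
    modulus. *)
Lemma cabs_shift z c : disc R z -> 0 < c ->
  [/\ 0 < cabs (1 - z), cabs (1 - z) <= cabs (1 - z + toCx c) &
      c <= cabs (1 - z + toCx c)].
Proof.
move=> dz c0; have Rz : 0 < complex.Re (1 - z).
  have h := cabs_ge_Re z; rewrite cReD cReN /=.
  have := le_lt_trans (le_trans (ler_norm _) h) dz; lra.
have Rc : complex.Re (1 - z + toCx c) = complex.Re (1 - z) + c by rewrite cReD.
have Ic : complex.Im (1 - z + toCx c) = complex.Im (1 - z) by rewrite cImD /= addr0.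
split.
- exact: lt_le_trans Rz (le_trans (ler_norm _) (cabs_ge_Re _)).
- rewrite -(@ler_pXn2r _ 2) ?nnegrE ?cabs_ge0 // !cabs_sqr Rc Ic lerD2r.
  by move: Rz; clear -c0; move: (complex.Re _) => q q0; nra.
- apply: le_trans (le_trans (ler_norm _) (cabs_ge_Re _)); rewrite Rc; lra.
Qed.

(** The second bound is used near 1, where it makes the spike vanish; the third is used away from 1,
    where it is small with [d]. *)
Lemma spike_bounds d z : disc R z -> 0 < d ->
  [/\ cabs (spike d z) <= 1, cabs (spike d z) <= cabs (1 - z) / d ^+ 3 &
      cabs (spike d z) <= d / cabs (1 - z)].
Proof.
move=> dz d0; have d30 : 0 < d ^+ 3 by exact: exprn_gt0.
have [p0 A1 A2] := cabs_shift dz d30; have [_ B1 B2] := cabs_shift dz d0.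
rewrite /spike !cabsM !cabsV cabs_toCx (ger0_norm (ltW d0)).
set P := cabs (1 - z) in p0 A1 B1 *.
set A := cabs _ in A1 A2 *; set B := cabs _ in B1 B2 *.
have A0 : 0 < A by exact: lt_le_trans d30 A2.
have B0 : 0 < B by exact: lt_le_trans d0 B2.
have a1 : P / A <= 1 by rewrite ler_pdivrMr // mul1r.
have b1 : d / B <= 1 by rewrite ler_pdivrMr // mul1r.
have a0 : 0 <= P / A by rewrite divr_ge0 // ltW.
have b0 : 0 <= d / B by rewrite divr_ge0 // ltW.
split.
- by rewrite -[leRHS]mulr1; apply: ler_pM.
- apply: (@le_trans _ _ (P / A)); first by rewrite -[leRHS]mulr1; apply: ler_wpM2l.
  by apply: ler_wpM2l; [exact: ltW|rewrite lef_pV2 ?posrE].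
- apply: (@le_trans _ _ (d / B)); first by rewrite -[leRHS]mul1r; apply: ler_wpM2r.
  by apply: ler_wpM2l; [exact: ltW|rewrite lef_pV2 ?posrE].
Qed.

Lemma spike_holo d : 0 < d -> holo (spike d).
Proof.
move=> d0 w dw; have d30 : 0 < d ^+ 3 by exact: exprn_gt0.
have nz c : 0 < c -> 1 - w + toCx c != 0.
  by move=> c0; have [p0 A1 _] := cabs_shift dw c0; rewrite -cabs_gt0; exact: lt_le_trans A1.
have P : cdb (fun w : Cx R => 1 - w) w by apply: cdbB; [exact: cdb_cst|exact: cdb_id].
have Pc c : cdb (fun w : Cx R => 1 - w + toCx c) w by apply: cdbD => //; exact: cdb_cst.
apply: cdbM; apply: cdbM => //; last first.
- by apply: cdbV; [exact: nz|exact: Pc].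
- exact: cdb_cst.
- by apply: cdbV; [exact: nz|exact: Pc].
Qed.

(** Here p = 1 - phi_t(1 - d^2) is real and lies between (1 - t) d^2 and d^2 / t. The first factor
    misses 1 by at most d^3 / p <= d / (1 - t), the second by at most p / d <= d / t. *)
Lemma spike_peak d t : 0 < t < 1 -> 0 < d < 1 ->
  cabs (spike d (phi t (toCx (1 - d ^+ 2))) - 1) <= d * ((1 - t)^-1 + t^-1).
Proof.
move=> /andP[t0 t1] /andP[d0 d1].
pose D := t + (1 - t) * d ^+ 2; pose p := (1 - t) * d ^+ 2 / D.
have d20 : 0 < d ^+ 2 by exact: exprn_gt0.
have d21 : d ^+ 2 < 1 by rewrite expr_lt1 // ltW.
have d30 : 0 < d ^+ 3 by exact: exprn_gt0.
have D0 : 0 < D by rewrite /D; nra.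
have D1 : D <= 1 by rewrite /D; nra.
have Dt : t <= D by rewrite /D; nra.
have p0 : 0 < p by rewrite /p divr_gt0 // mulr_gt0 // subr_gt0.
have E : 1 - phi t (toCx (1 - d ^+ 2)) = toCx p.
  have -> : phi t (toCx (1 - d ^+ 2)) = toCx (t / D).
    rewrite /phi toCxM toCxV; congr (_ / _).
    by rewrite -toCx1 -toCxB -toCxM -toCxD; congr toCx; rewrite /D; ring.
  rewrite -toCx1 -toCxB; congr toCx; rewrite /p.
  by apply: (mulIf (lt0r_neq0 D0)); rewrite mulrBl !divfK ?gt_eqF // /D; ring.
rewrite /spike E -!toCxD -!toCxV -!toCxM -toCx1 -toCxB cabs_toCx.
have P3 : 0 < p + d ^+ 3 by lra.
have P1 : 0 < p + d by lra.
set a := p / (p + d ^+ 3); set b := d / (p + d).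
have a1 : 1 - a <= d / (1 - t).
  have -> : 1 - a = d ^+ 3 / (p + d ^+ 3) by rewrite /a; field; rewrite gt_eqF.
  rewrite ler_pdivrMr // -mulrA mulrC -ler_pdivrMr //.
  have -> : d ^+ 3 / d = d ^+ 2 by field; rewrite gt_eqF.
  rewrite ler_pdivlMl ?subr_gt0 //.
  have : (1 - t) * d ^+ 2 <= p by rewrite ler_pdivlMr // ler_piMr // ltW // mulr_gt0 // subr_gt0.
  lra.
have b1 : 1 - b <= d / t.
  have -> : 1 - b = p / (p + d) by rewrite /b; field; rewrite gt_eqF.
  rewrite ler_pdivrMr //.
  have : p <= d ^+ 2 / t.
    rewrite /p; apply: ler_pM => //; first by rewrite ltW // mulr_gt0 // subr_gt0.
    - by rewrite invr_ge0 ltW.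
    - nra.
    - by rewrite lef_pV2 ?posrE.
  have -> : d ^+ 2 / t = d / t * d by ring.
  have h : 0 < d / t by rewrite divr_gt0.
  nra.
have a0 : 0 < a by rewrite divr_gt0.
have b0 : 0 < b by rewrite divr_gt0.
have a2 : a <= 1 by rewrite ler_pdivrMr // mul1r; lra.
have b2 : b <= 1 by rewrite ler_pdivrMr // mul1r; lra.
rewrite mulrDr ler_norml; apply/andP; split; last first.
  have : 0 <= d / (1 - t) + d / t by apply: le_trans (lerD a1 b1); lra.
  nra.
nra.
Qed.

Lemma cvg_left_seq (T : topologicalType) (Q : R -> T) (l : T) :
  Q r @[r --> (1 : R)^'-] --> l -> Q (1 - step n ^+ 2) @[n --> \oo] --> l.
Proof.
move=> Ql A /Ql /near_left1P[r0 /andP[_ r01] h].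
have [N hN] := step_small (e := 1 - r0) ltac:(lra).
exists N => // n /= /hN sn; apply: h.
  have := step_lt1 n; have := step_gt0 n; rewrite expr2; nra.
by have := exprn_gt0 2 (step_gt0 n); lra.
Qed.

Lemma disc_seq n : disc R (toCx (1 - step n ^+ 2)).
Proof.
have s0 := step_gt0 n; have s1 := step_lt1 n.
by apply: disc_toCx; rewrite ?expr2; nra.
Qed.

Lemma cvg_disc_seq (T : topologicalType) (Q : Cx R -> T) (l : T) :
  Q z @[z --> disc_at 1] --> l -> Q (toCx (1 - step n ^+ 2)) @[n --> \oo] --> l.
Proof.
move=> Ql A /Ql /disc_atP[d d0 h].
have [N hN] := step_small d0.
exists N => // n /= /hN sn; apply: h; first exact: disc_seq.
rewrite -toCx1 -toCxB cabs_toCx [_ - _]addrC addKr normrN ger0_norm ?sqr_ge0 //.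
by have := step_lt1 n; have := step_gt0 n; rewrite expr2; nra.
Qed.

End Spike.

(** * The test functions and their images under a compact operator *)

Section Peaks.
Variables (R : realType) (u : Cx R -> R) (g : Cx R -> Cx R).
Implicit Types (x y e s r t rho M C d : R) (z w : Cx R) (f : Cx R -> Cx R).
Notation mu := (@lebesgue_measure R).
Notation step := (step R).
Hypothesis uw : weight u.
Hypothesis gd : holo g.
Hypothesis g1 : ubd u g 1.
Hypothesis g_bdry : forall a : Cx R, cabs a = 1 -> a != 1 ->
  limf_esup (fun z : Cx R => (cabs (g z) * u z)%:E) (disc_at a) = 0%E.

Let u0 := weight_gt0 uw.

Definition peak n w := g w * spike (step n) w.

Lemma peak_le n z : disc R z -> cabs (peak n z) * u z <= cabs (spike (step n) z).
Proof.
move=> dz; rewrite cabsM mulrAC -[leRHS]mul1r; apply: ler_wpM2r; last exact: g1.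
exact: cabs_ge0.
Qed.

Lemma peak_holo n : holo (peak n).
Proof. by move=> w dw; apply: cdbM; [exact: gd|exact: spike_holo (step_gt0 R n) w dw]. Qed.

Lemma peak_ubd n : ubd u (peak n) 1.
Proof.
move=> z dz; apply: le_trans (peak_le n dz) _.
by have [] := spike_bounds dz (step_gt0 R n).
Qed.

(** Compactness makes the boundary condition on [g] uniform: a sequence of exceptions would
    accumulate at a boundary point [a] other than 1, where the upper limit is 0. *)
Lemma away_from_1 rho e : 0 < rho -> 0 < e -> exists2 r : R, 0 <= r < 1 &
  forall z, r < cabs z -> disc R z -> rho <= cabs (1 - z) -> cabs (g z) * u z <= e.
Proof.
move=> rho0 e0; apply: contrapT => H.
have /choice[v hv] (n : nat) : exists z, [/\ 1 - step n < cabs z, disc R z,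
    rho <= cabs (1 - z) & e < cabs (g z) * u z].
  apply: contrapT => hn; apply: H; exists (1 - step n); first by have /andP[/ltW -> ->] := seq_to1 R n.
  move=> z z1 dz zr; rewrite leNgt; apply/negP => ez; apply: hn; by exists z.
have [|s [a [si sa]]] := @bolzano_weierstrassC R v 1.
  by move=> n; have [_ /ltW] := hv n.
have stc : (1 - step (s n) : R) @[n --> \oo] --> (1 : R).
  exact: (cvg_subseq (v := fun n => 1 - step n) si (@cvg_seq_to1 R)).
have a1 : cabs a = 1.
  have ca : cabs (v (s n)) @[n --> \oo] --> cabs a by apply: cvg_cabs.
  have c1 : cabs (v (s n)) @[n --> \oo] --> (1 : R).
    apply: (squeeze_cvgr _ stc (cvg_cst (1 : R))).
    by apply: nearW => n; have [/ltW -> /ltW ->] := hv (s n).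
  exact: (cvg_unique _ ca c1).
have an1 : a != 1.
  apply/eqP => aE; rewrite aE in sa.
  have [N _ /(_ N (leqnn N))] := proj1 (cvgCP _ _ _) sa rho rho0.
  by rewrite /= cabsBC ltNge; have [_ _ ->] := hv (s N).
have := @limf_esup_disc_lt R a (fun z => cabs (g z) * u z) e.
rewrite (g_bdry a1 an1) lte_fin => /(_ e0)[d d0 hd].
have [N _ /(_ N (leqnn N)) hN] := proj1 (cvgCP _ _ _) sa d d0.
have [_ dz _] := hv (s N).
by rewrite ltNge hd.
Qed.

(** Close to 1 the spike is small; elsewhere near the boundary [g] is small in the weighted
    sense. *)
Lemma peak_Hzero n : Hzero u (peak n).
Proof.
apply/(HzeroP uw); split.
  by apply/(HinfP uw); split; [exact: peak_holo|exists 1 => //; exact: peak_ubd].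
move=> e e0; have e20 : 0 < e / 2 by lra.
have s0 := step_gt0 R n; have s30 : 0 < step n ^+ 3 by exact: exprn_gt0.
have [r r01 hr] := away_from_1 (mulr_gt0 e20 s30) e20; exists r => // z rz dz.
apply: (@le_lt_trans _ _ (e / 2)); last lra.
have [b1 b2 _] := spike_bounds dz s0.
have [zr|rz'] := ltP (cabs (1 - z)) (e / 2 * step n ^+ 3).
  apply: le_trans (peak_le n dz) (le_trans b2 _).
  by rewrite ler_pdivrMr // ltW.
apply: le_trans (hr z rz dz rz'); rewrite cabsM mulrAC -[leRHS]mulr1.
by apply: ler_wpM2l => //; rewrite mulr_ge0 ?cabs_ge0 // ltW // u0.
Qed.

(* Each point sees at most one of the chosen spikes. *)
Lemma spike_hump (s : nat -> nat) (N m : nat) eta : {homo s : m n / (m < n)%N} -> 0 < eta ->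
  exists v : nat -> nat, (forall k, (N <= v k)%N) /\
   exists2 rho : R, 0 < rho &
    (forall z, disc R z -> \sum_(k < m) cabs (spike (step (s (v k))) z) <= 1 + m%:R * eta) /\
    (forall z, disc R z -> cabs (1 - z) < rho ->
       \sum_(k < m) cabs (spike (step (s (v k))) z) <= m%:R * eta).
Proof.
move=> si eta0; elim: m => [|m [v [vN [rho rho0 [h1 h2]]]]].
  by exists (fun=> N); split => //; exists 1 => //; split => [z _|z _ _]; rewrite big_ord0 mul0r ?addr0.
(* At distance at least [rho] from 1 the new spike is at most its width divided by [rho], hence at
   most [eta]. *)
have [N' hN'] := step_small (mulr_gt0 eta0 rho0).
pose n := maxn N N'; have sn : step (s n) <= eta * rho.
  by apply/ltW/hN'; apply: leq_trans (homo_ge si n); exact: leq_maxr.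
have s0 := step_gt0 R (s n); have s30 : 0 < step (s n) ^+ 3 by exact: exprn_gt0.
pose v' k := if (k < m)%N then v k else n.
exists v'; split; first by move=> k; rewrite /v'; case: ifP => // _; exact: leq_maxl.
have E z : \sum_(k < m.+1) cabs (spike (step (s (v' k))) z) =
    \sum_(k < m) cabs (spike (step (s (v k))) z) + cabs (spike (step (s n)) z).
  rewrite big_ord_recr /= {2}/v' ltnn; congr (_ + _).
  by apply: eq_bigr => k _; rewrite /v' ltn_ord.
have m1 : m.+1%:R = m%:R + 1 :> R by rewrite -natr1.
(* Within this distance of 1 the new spike is also at most [eta], by the second bound of
   [spike_bounds]. *)
exists (Num.min rho (eta * step (s n) ^+ 3)); first by rewrite lt_min rho0 mulr_gt0.
split=> [z dz|z dz]; have [b1 b2 b3] := spike_bounds dz s0.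
  rewrite E m1; have [zr|rz] := ltP (cabs (1 - z)) rho.
    have := h2 z dz zr; lra.
  have := h1 z dz; suff : cabs (spike (step (s n)) z) <= eta by lra.
  apply: le_trans b3 _; rewrite ler_pdivrMr ?(lt_le_trans rho0) //.
  by apply: le_trans sn _; apply: ler_wpM2l => //; exact: ltW.
rewrite lt_min => /andP[z1 z2]; rewrite E m1.
have := h2 z dz z1; suff : cabs (spike (step (s n)) z) <= eta by lra.
by apply: le_trans b2 _; rewrite ler_pdivrMr // ltW.
Qed.

Lemma Hzero_comb (a : Cx R) f f' : Hzero u f -> Hzero u f' -> Hzero u (fun w => a * f w + f' w).
Proof.
move=> /(HzeroP uw)[fH f0] /(HzeroP uw)[fH' f0']; apply/(HzeroP uw).
split; first exact: HinfD.
move=> e e0; have k0 : 0 < e / 2 / (cabs a + 1).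
  by rewrite !divr_gt0 // ltr_wpDl ?cabs_ge0.
have [r /andP[r0 r1] hr] := f0 _ k0; have [r' /andP[r0' r1'] hr'] := f0' (e / 2) ltac:(lra).
exists (Num.max r r'); first by rewrite le_max r0 gt_max r1.
move=> z; rewrite gt_max => /andP[zr zr'] dz.
apply: (@le_lt_trans _ _ ((cabs a * cabs (f z) + cabs (f' z)) * u z)).
  by apply: ler_wpM2r; [exact: ltW (u0 dz)|rewrite -cabsM; exact: cabsD].
rewrite mulrDl -mulrA [ltRHS]splitr; apply: ler_ltD; last exact: hr'.
apply: (@le_trans _ _ ((cabs a + 1) * (e / 2 / (cabs a + 1)))).
  have A := cabs_ge0 a; apply: ler_pM => //.
  - by rewrite mulr_ge0 ?cabs_ge0 // ltW // u0.
  - lra.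
  - exact/ltW/hr.
by rewrite mulrC divfK // gt_eqF // ltr_wpDl ?cabs_ge0.
Qed.

Lemma Hzero_0 : Hzero u (fun=> 0).
Proof.
apply/(HzeroP uw); split; first exact: Hinf0.
move=> e e0; exists (1 / 2); first by apply/andP; split; lra.
by move=> z _ _; rewrite cabs0 mul0r.
Qed.

Lemma linear_op_sum L (X : set (Cx R -> Cx R)) (c : Cx R) (F : nat -> Cx R -> Cx R) (m : nat) :
  linear_op X L -> X (fun=> 0) ->
  (forall (a : Cx R) f f', X f -> X f' -> X (fun w => a * f w + f' w)) ->
  (forall k, X (F k)) ->
  X (fun w => \sum_(k < m) c * F k w) /\
  forall z, disc R z -> L (fun w => \sum_(k < m) c * F k w) z = \sum_(k < m) c * L (F k) z.
Proof.
move=> Ll X0 XD XF; elim: m => [|m [IH1 IH2]].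
  have -> : (fun w => \sum_(k < 0) c * F k w) = (fun=> 0).
    by apply/funext => w; rewrite big_ord0.
  split=> // z dz; rewrite big_ord0.
  (* With [a = 1] and both functions zero, linearity reads L 0 = L 0 + L 0, so L 0 = 0 on the
     disc. *)
  have := Ll 1 _ _ X0 X0 z dz.
  have -> : (fun w : Cx R => 1 * 0 + 0) = (fun=> 0 : Cx R).
    by apply/funext => w; rewrite mulr0 addr0.
  by rewrite mul1r -[LHS]addr0 => /addrI.
have -> : (fun w => \sum_(k < m.+1) c * F k w) =
    (fun w => c * F m w + \sum_(k < m) c * F k w).
  by apply/funext => w; rewrite big_ord_recr /= addrC.
split=> [|z dz]; first exact: XD.
by rewrite Ll // IH2 // big_ord_recr /= addrC.
Qed.

(* Sums of many of the almost disjoint peaks stay bounded, so a nonzero limit of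
   their images would violate the boundedness of [L]. *)
Lemma compact_peak L : compact_op u (Hzero u) L -> exists2 s : nat -> nat,
  {homo s : m n / (m < n)%N} & forall e, 0 < e ->
    exists N, forall n, (N <= n)%N -> ubd u (L (peak (s n))) e.
Proof.
move=> [Ll /bounded_opP[_ [C C0 LC]] Lk].
have [n|s [h [si hH /(wnorm_cvg0P uw) Lh]]] := Lk peak.
  by split; [exact: peak_Hzero|apply/wnorm_leP; exact: peak_ubd].
exists s => //.
suff h0 e : 0 < e -> ubd u h e.
  move=> e e0; have e20 : 0 < e / 2 by lra.
  have [N hN] := Lh _ e20; exists N => n Nn z dz.
  have A := hN n Nn z dz; have B := h0 _ e20 z dz.
  have -> : L (peak (s n)) z = (L (peak (s n)) z - h z) + h z by rewrite subrK.
  apply: (@le_trans _ _ ((cabs (L (peak (s n)) z - h z) + cabs (h z)) * u z)).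
    by apply: ler_wpM2r; [exact: ltW (u0 dz)|exact: cabsD].
  rewrite mulrDl; lra.
move=> e0 z dz; have e20 : 0 < e / 2 by lra.
have [N hN] := Lh _ e20.
(* With [M] terms the image of the sum is within [M * (e / 2)] of [M * h] and is bounded by [2 * C].
   So |h| u <= e / 2 + 2 C / M, and [M = m.+1] makes the last term at most [e / 2]. *)
have [m hm] : exists m : nat, 4 * C / e <= m.+1%:R.
  exists (Num.bound (4 * C / e)); apply/ltW.
  have := @archi_boundP R (4 * C / e); rewrite divr_ge0 ?mulr_ge0 ?(ltW e0) // => /(_ isT).
  by move=> hb; apply: lt_trans hb _; rewrite ltr_nat.
have m0 : 0 < m.+1%:R :> R by rewrite ltr0n.
have im0 : 0 < m.+1%:R^-1 :> R by rewrite invr_gt0.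
have [v [vN [rho _ [h1 _]]]] := spike_hump N m.+1 si im0.
(* With [eta] the inverse of the number of terms, the spikes add up to at most 2, so the factor 1/2
   puts the sum of peaks into the unit ball. *)
pose c : Cx R := toCx (1 / 2).
pose F k := peak (s (v k)).
have [FX LF] := linear_op_sum c (F := F) m.+1 Ll Hzero_0 Hzero_comb (fun k => peak_Hzero _).
have c2 : cabs c = 1 / 2 by rewrite cabs_toCx ger0_norm //; lra.
have F1 : ubd u (fun w => \sum_(k < m.+1) c * F k w) 1.
  move=> w dw; have := h1 w dw; rewrite divff ?gt_eqF // => h1w.
  apply: (@le_trans _ _ ((\sum_(k < m.+1) 1 / 2 * cabs (F k w)) * u w)).
    apply: ler_wpM2r; first exact: ltW (u0 dw).
    by apply: le_trans (cabs_sum _ _ _) _; apply: ler_sum => k _; rewrite cabsM c2.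
  rewrite -mulr_sumr -mulrA mulr_suml.
  suff : \sum_(k < m.+1) cabs (F k w) * u w <= \sum_(k < m.+1) cabs (spike (step (s (v k))) w).
    lra.
  by apply: ler_sum => k _; exact: peak_le.
have B := LC _ FX F1 z dz; rewrite LF // in B.
have uz0 := u0 dz.
have A : cabs (m.+1%:R * h z - \sum_(k < m.+1) L (F k) z) * u z <= m.+1%:R * (e / 2).
  have -> : m.+1%:R * h z - \sum_(k < m.+1) L (F k) z = \sum_(k < m.+1) (h z - L (F k) z).
    by rewrite sumrB sumr_const card_ord mulr_natl.
  apply: (@le_trans _ _ ((\sum_(k < m.+1) cabs (h z - L (F k) z)) * u z)).
    by apply: ler_wpM2r; [exact: ltW|exact: cabs_sum].
  have -> : m.+1%:R * (e / 2) = \sum_(k < m.+1) e / 2 by rewrite sumr_const card_ord mulr_natl.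
  by rewrite mulr_suml; apply: ler_sum => k _; rewrite cabsBC; exact: hN.
rewrite -mulr_sumr cabsM c2 -mulrA in B.
have D : m.+1%:R * (cabs (h z) * u z) <= m.+1%:R * (e / 2) + 2 * C.
  apply: (@le_trans _ _ ((cabs (m.+1%:R * h z - \sum_(k < m.+1) L (F k) z) +
      cabs (\sum_(k < m.+1) L (F k) z)) * u z)); last by rewrite mulrDl; lra.
  rewrite mulrA; apply: ler_wpM2r; first exact: ltW.
  have -> : m.+1%:R * cabs (h z) = cabs (m.+1%:R * h z).
    rewrite cabsM; congr (_ * _).
    have -> : m.+1%:R = toCx m.+1%:R :> Cx R by rewrite /toCx rmorph_nat.
    by rewrite cabs_toCx ger0_norm // ltW.
  rewrite -{1}[m.+1%:R * h z](subrK (\sum_(k < m.+1) L (F k) z)); exact: cabsD.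
have E : 2 * C <= m.+1%:R * (e / 2) by rewrite ler_pdivrMr // in hm; lra.
by rewrite -(ler_pM2l m0); lra.
Qed.

End Peaks.

(** * Lower estimate along the test points *)

Section LowerBound.
Variables (R : realType) (u : Cx R -> R) (K : Cx R -> Cx R -> Cx R) (g : Cx R -> Cx R).
Implicit Types (x y e s r t rho M C d : R) (z w : Cx R) (f : Cx R -> Cx R).
Notation mu := (@lebesgue_measure R).
Notation step := (step R).
Hypothesis uw : weight u.
Hypothesis Kd : analytic_disc2 K.
Hypothesis U1 : upper_cond1 u K.
Hypothesis U2 : upper_cond2 u K.
Hypothesis Kb : forall z, disc R z -> exists M, forall w, disc R w -> cabs (K z w) <= M.
Hypothesis dint : (\int[mu]_(s in `]0%R, 1%R[) delta_norm u (toCx s) < +oo)%E.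
Hypothesis T_lim : forall t, 0 < t < 1 ->
  exists l : R, 0 <= l /\ Tt K t z @[z --> disc_at 1] --> toCx l.
Hypothesis gd : holo g.
Hypothesis g1 : ubd u g 1.
Hypothesis g_bdry : forall a : Cx R, cabs a = 1 -> a != 1 ->
  limf_esup (fun z : Cx R => (cabs (g z) * u z)%:E) (disc_at a) = 0%E.
Hypothesis g_one : cabs (g (toCx r)) * u (toCx r) @[r --> (1 : R)^'-] --> (1 : R).
Hypothesis g_ratio : forall t : R, 0 < t < 1 ->
  (weight_ratio_limsup u t < +oo)%E /\
  g (phi t (toCx r)) / g (toCx r) @[r --> (1 : R)^'-] --> toCx (fine (weight_ratio_limsup u t)).

Let u0 := weight_gt0 uw.
Let mI : measurable (`]0, 1[ : set (measurableTypeR R)). Proof. by []. Qed.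
Let W_fin t (t01 : 0 < t < 1) : (weight_ratio_limsup u t < +oo)%E := proj1 (g_ratio t01).
Let Vi := (value_integrable uw Kd W_fin T_lim U1).1.
Let V := (\int[mu]_(t in `]0%R, 1%R[) value_integrand u K t)%E.
Let zz n : Cx R := toCx (1 - step n ^+ 2).

Lemma cvg_spike_peak t : 0 < t < 1 -> spike (step n) (phi t (zz n)) @[n --> \oo] --> (1 : Cx R).
Proof.
move=> t01; have /andP[t0 t1] := t01; apply/cvgCP => e e0.
have c0 : 0 < (1 - t)^-1 + t^-1 by rewrite addr_gt0 // invr_gt0 ?subr_gt0.
have [N hN] := step_small (divr_gt0 e0 c0).
exists N => // n /= /hN; rewrite ltr_pdivlMr //; apply: le_lt_trans.
by apply: spike_peak => //; rewrite step_gt0 step_lt1.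
Qed.

(** Dividing the integrand at [zz n] by [g (zz n)] leaves the product of g(phi_t) / g, the spike at
    phi_t and T_t, each of which converges. The lost factor returns as [cabs (g (zz n)) * u (zz n)],
    which tends to 1. *)
Let q n t : Cx R := (g (zz n))^-1 * (peak g n (phi t (zz n)) * Tt K t (zz n)).

Lemma cvg_mul1 (a b c : nat -> Cx R) (l m : Cx R) : a n @[n --> \oo] --> l ->
  b n @[n --> \oo] --> (1 : Cx R) -> c n @[n --> \oo] --> m ->
  a n * b n * c n @[n --> \oo] --> l * m.
Proof.
move=> al b1 cm; rewrite -[l]mulr1; apply: (@cvgM (Cx R)); last exact: cm.
by apply: (@cvgM (Cx R)); [exact: al|exact: b1].
Qed.

Lemma cvg_q t : 0 < t < 1 -> q n t @[n --> \oo] --> toCx (fine (value_integrand u K t)).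
Proof.
move=> t01; have [l [l0 Tl]] := T_lim t01.
rewrite (value_integrandE uw W_fin t01 l0 Tl) /= toCxM.
have A := cvg_left_seq (g_ratio t01).2.
have B := cvg_spike_peak t01.
have C := cvg_disc_seq Tl.
have E : (fun n => q n t) = (fun n =>
    g (phi t (toCx (1 - step n ^+ 2))) / g (toCx (1 - step n ^+ 2)) *
    spike (step n) (phi t (zz n)) * Tt K t (toCx (1 - step n ^+ 2))).
  by apply/funext => n; rewrite /q /peak /zz; ring.
rewrite E; exact: cvg_mul1 A B C.
Qed.

Lemma IK_peak_lower e : 0 < e -> exists N, forall n, (N <= n)%N ->
  fine V - e <= cabs (IK K (peak g n) (zz n)) * u (zz n).
Proof.
move=> e0.
have G1 : cabs (g (zz n)) * u (zz n) @[n --> \oo] --> (1 : R) := cvg_left_seq g_one.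
(* The bound 1/2 makes [g (zz n)] nonzero and is the source of the factor 2 in the dominating
   function. *)
have [N0 _ hN0] : \forall n \near \oo, 1 / 2 < cabs (g (zz n)) * u (zz n).
  by apply: (cvgr_gt _ G1); lra.
have [h hi hdom] := dominating uw Kd U1 U2.
have qc n t : 0 < t < 1 -> ccont (q n) t.
  move=> t01; apply: ccontM; first exact: ccont_cst.
  exact: (@ccont_curve R K Kd (peak g n) (zz n) t t01 (disc_seq R n) (peak_holo gd n)).
have gn n : (N0 <= n)%N -> 0 < cabs (g (zz n)).
  move=> /hN0 /= hn; rewrite lt_neqAle cabs_ge0 andbT; apply/eqP => g0.
  by rewrite -g0 mul0r in hn; lra.
(* The shift by [N0] makes the domination valid for every index. *)
have Q : cintegral `]0, 1[ (q (n + N0)) @[n --> \oo] -->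
    cintegral `]0, 1[ (fun t => toCx (fine (value_integrand u K t))).
  apply: (cintegral_dominated mI (h := fun t => (2%:E * h t)%E)).
  - by move=> n; have [] := ccont_measurable (qc (n + N0)%N).
  - by move=> n; have [] := ccont_measurable (qc (n + N0)%N).
  - have mV := measurable_int _ Vi.
    exact: (measurableT_comp (fine_measurable measurableT) mV).
  - exact: measurable_cst.
  - exact: integrableZl.
  - move=> n t; rewrite /= in_itv /= => t01; set m := (n + N0)%N.
    have mN : (N0 <= m)%N by exact: leq_addl.
    have H := hdom _ t _ t01 (disc_seq R m) (peak_holo gd m) (peak_ubd g1 m).
    apply: le_trans (lee_wpmul2l _ H); last by rewrite lee_fin.
    have qE : cabs (q m t) = (cabs (g (zz m)))^-1 *
        cabs (peak g m (phi t (zz m)) * Tt K t (zz m))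
      by rewrite -cabsV -cabsM.
    rewrite -EFinM lee_fin qE -/(zz m); set X := cabs (_ * _).
    rewrite ler_pdivrMl ?gn //.
    have -> : cabs (g (zz m)) * (2 * (X * u (zz m))) =
      X * (2 * (cabs (g (zz m)) * u (zz m))) by ring.
    rewrite ler_peMr ?cabs_ge0 //; have := hN0 m mN; rewrite /=; lra.
  - move=> t; rewrite /= in_itv /= => t01.
    by have := cvg_q t01; rewrite -(cvg_shiftn N0).
have IV : cintegral `]0, 1[ (fun t => toCx (fine (value_integrand u K t))) = toCx (fine V).
  apply: CxP => /=; last by rewrite Rintegral_cst //= mul0r.
  rewrite /Rintegral; congr fine; apply: eq_integral => t; rewrite inE /= in_itv /= => t01.
  by have [v v0 ->] := value_integrand_fin uw W_fin T_lim t01.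
rewrite IV in Q.
have G1' : cabs (g (zz (n + N0))) * u (zz (n + N0)) @[n --> \oo] --> (1 : R).
  by rewrite (cvg_shiftn N0 (fun n => cabs (g (zz n)) * u (zz n))).
have P := cvgM (cvg_cabs _ Q) G1'.
rewrite mulr1 cabs_toCx in P.
have [N _ hN] : \forall n \near \oo, fine V - e <
    cabs (cintegral `]0, 1[ (q (n + N0))) * (cabs (g (zz (n + N0))) * u (zz (n + N0))).
  apply: (cvgr_gt _ (P _ _)); have := ler_norm (fine V); lra.
exists (N + N0)%N => n Nn; have N0n : (N0 <= n)%N by apply: leq_trans Nn; exact: leq_addl.
have := hN (n - N0)%N; rewrite /= leq_subRL // addnC Nn subnK // => /(_ isT)/ltW.
move/le_trans; apply; rewrite mulrA -cabsM.
have cc := cintegrable_curve uw Kd U1 U2 (disc_seq R n) (peak_holo gd n) (peak_ubd g1 n).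
rewrite (IK_curve uw Kd U1 U2 Kb dint (disc_seq R n) (peak_holo gd n) (peak_ubd g1 n)).
rewrite /q cintegralZ // mulrAC mulVf ?mul1r // -cabs_gt0; exact: gn.
Qed.

Lemma ess_norm_ge_value : (V <= ess_norm u (Hzero u) (IK K))%E.
Proof.
have VE : V = (fine V)%:E by rewrite fineK //; exact: integrable_fin_num.
apply/ereal_infP => _ [L Lc <-].
have [s si sL] := compact_peak uw gd g1 g_bdry Lc.
(* If [c] were below the value, then for large [n] the image of the peak at the test point would be
   at least [fine V - e] and at most [c + e], which is impossible for this [e]. *)
have key c : (opnorm u (Hzero u) (fun f z => (IK K f z - L f z)%R) <= c%:E)%E -> fine V <= c.
  move=> hc; rewrite leNgt; apply/negP => cV.
  have e0 : 0 < (fine V - c) / 4 by lra.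
  have [N1 h1] := sL _ e0; have [N2 h2] := IK_peak_lower e0.
  pose n := maxn N1 N2; have A := h1 n (leq_maxl _ _) (zz (s n)) (disc_seq R _).
  have B := h2 (s n) (leq_trans (leq_maxr _ _) (homo_ge si n)).
  have D := opnorm_ub hc (peak_Hzero uw gd g1 g_bdry (s n)) (peak_ubd g1 (s n)) (disc_seq R (s n)).
  have uz := u0 (disc_seq R (s n)).
  have := ler_wpM2r (ltW uz) (cabs_dist (IK K (peak g (s n)) (zz (s n))) (L (peak g (s n)) (zz (s n)))).
  rewrite mulrBl => E; have := le_trans E D; lra.
rewrite VE; case E : (opnorm _ _ _) => [c| |]; rewrite ?leey //.
  by rewrite lee_fin; apply: key; rewrite E.
(* The case of an operator norm -oo is excluded by applying [key] to a number below the value. *)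
have k : fine V <= fine V - 1 by apply: key; rewrite E leNye.
by move: k; rewrite -{1}[fine V]addr0 lerD2l oppr_ge0 ler10.
Qed.

End LowerBound.

Theorem corollary6p2 (R : realType) (u : Cx R -> R)
    (K : Cx R -> Cx R -> Cx R) (g : Cx R -> Cx R)
    (u_weight : weight u)
    (delta_bounded : forall z : Cx R, disc R z -> (delta_norm u z < +oo)%E)
    (delta_integrable :
      (\int[lebesgue_measure]_(s in `]0%R, 1%R[) delta_norm u (toCx s)
        < +oo)%E)
    (K_analytic : analytic_disc2 K)
    (K_bounded : forall z : Cx R, disc R z ->
      exists M : R, forall w : Cx R, disc R w -> cabs (K z w) <= M)
    (K_infty : cabs (K p.1 p.2)
      @[p --> within (disc R `*` disc R) (nbhs (1 : Cx R, 1 : Cx R))] --> +oo)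
    (IK_bounded : bounded_op u (Hinf u) (IK K))
    (g_analytic : analytic_disc g)
    (g_norm : (wnorm u g <= 1)%E)
    (g_bdry : forall a : Cx R, cabs a = 1 -> a != 1 ->
      limf_esup (fun z : Cx R => (cabs (g z) * u z)%:E) (disc_at a) = 0%E)
    (g_one : cabs (g (toCx r)) * u (toCx r) @[r --> (1 : R)^'-] --> (1 : R))
    (g_ratio : forall t : R, 0 < t < 1 ->
      (weight_ratio_limsup u t < +oo)%E /\
      g (phi t (toCx r)) / g (toCx r) @[r --> (1 : R)^'-]
        --> toCx (fine (weight_ratio_limsup u t)))
    (T_lim : forall t : R, 0 < t < 1 ->
      exists l : R, 0 <= l /\ Tt K t z @[z --> disc_at 1] --> toCx l)
    (U1 : upper_cond1 u K)
    (U2 : upper_cond2 u K) :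
  let value : \bar R :=
    (\int[lebesgue_measure]_(t in `]0%R, 1%R[)
       limf_esup (fun z : Cx R => (u z / u (phi t z) * complex.Re (Tt K t z))%:E)
         (disc_at 1))%E in
  ess_norm u (Hinf u) (IK K) = value /\ ess_norm u (Hzero u) (IK K) = value.
Proof.
have gd : holo g by apply/analyticP.
have g1 : ubd u g 1 by apply/wnorm_leP.
have W_fin t (t01 : 0 < t < 1) := (g_ratio t t01).1.
have A := ess_norm_le_value u_weight K_analytic U1 U2 K_bounded delta_integrable
  IK_bounded W_fin T_lim.
have B := ess_norm_ge_value u_weight K_analytic U1 U2 K_bounded delta_integrable
  T_lim gd g1 g_bdry g_one g_ratio.
have C := ess_norm_Hzero_le u (IK K).
move=> value; split; apply/eqP; rewrite eq_le.
  by rewrite A (le_trans B C).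
by rewrite (le_trans C A) B.
Qed.
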